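(* Let $G=(V,E,w)$ be a weighted hypergraph, $p\in[1,\infty)$ and $T>0$. For every $x_0\in\mathbb{R}^V$ and $h\in L^2(0,T;\mathbb{R}^V)$, the Cauchy problem $$\text{(C)}\qquad \frac{d}{dt}x(t)+L_{G,p}(x(t))\ni h(t)\quad (t\in(0,T)),\qquad x(0)=x_0,$$ possesses a unique solution $x$, and it satisfies: $x\in W^{1,2}(0,T;\mathbb{R}^V)$; the map $t\mapsto\varphi_{G,p}(x(t))$ is absolutely continuous on $[0,T]$; and $$\left(\int_0^t|x'(s)|_{\ell^2}^2\,ds\right)^{1/2}\le\left(\int_0^t|h(s)|_{\ell^2}^2\,ds\right)^{1/2}+\sqrt{\varphi_{G,p}(x_0)}\qquad\forall t\in[0,T].$$ Moreover, if $t_0\in[0,T)$ is a right-Lebesgue point of $h$, then $x$ is right-differentiable at $t_0$ and its right-derivative $\frac{d^+x}{dt}$ satisfies $$\frac{d^+x}{dt}(t_0)=\big(h(t_0+0)-L_{G,p}(x(t_0))\big)^{\circ},\qquad h(t_0+0):=\lim_{\tau\to+0}\frac1\tau\int_{t_0}^{t_0+\tau}h(s)\,ds .$$ If $h\in W^{1,1}(0,T;\mathbb{R}^V)$, the solution also fulfills $t\,x'(t)\in L^\infty(0,T;\mathbb{R}^V)$ and, for all $t\in(0,T)$, $$\left|\frac{d^+x}{dt}(t)\right|_{\ell^2}\le|h(t)|_{\ell^2}+\frac1t|x_0-\overline{x_0}|_{\ell^2}+\frac1{t^2}\int_0^ts^2|h'(s)|_{\ell^2}\,ds+\frac{\sq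rt2}{t}\left(\int_0^ts|h'(s)|_{\ell^2}\,ds\right)^{1/2}\left(|x_0-\overline{x_0}|_{\ell^2}+\int_0^t|h(s)|_{\ell^2}\,ds\right)^{1/2}.$$
   Context: A weighted hypergraph $G=(V,E,w)$ consists of a finite set $V=\{v_1,\dots,v_n\}$, a set $E\subset 2^V$ of hyperedges, each $e\in E$ containing more than one element of $V$, and a weight function $w:E\to(0,\infty)$. $\mathbb{R}^V$ is the space of functions $x:V\to\mathbb{R}$ with inner product $x\cdot y=\sum_{v\in V}x(v)y(v)$ and norm $|x|_{\ell^2}=(x\cdot x)^{1/2}$. For $S\subset V$, $1_S\in\mathbb{R}^V$ is the indicator function of $S$, $1_v:=1_{\{v\}}$, and $\#S$ is the number of elements of $S$. For $e\in E$ let $B_e:=\operatorname{conv}\{1_u-1_v:\ u,v\in e\}$ and $f_e(x):=\max_{u,v\in e}(x(u)-x(v))=\max_{b\in B_e}b\cdot x$. For $p\in[1,\infty)$ define $\varphi_{G,p}(x):=\frac1p\sum_{e\in E}w(e)(f_e(x))^p$, and let the hypergraph $p$-Laplacian be its (multivalued) subdifferential $$L_{G,p}(x):=\partial\varphi_{G,p}(x)=\Big\{\sum_{e\in E}w(e)(f_e(x))^{p-1}b_e:\ b_e\in\operatorname{argmax}_{b\in B_e}b\cdot x\Big\}.$$ (When $p=1$, the factor $(f_e(x))^{p-1}$ is $1$.) The sets $L_{G,p}(x)$ are closed and convex. For a closed convex set $C\subset\mathbb{R}^V$, $C^\circ$ denotes its element of minimal $\ell^2$-norm (the projection of $0$ onto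 $C$). Connected components: $S_1,\dots,S_l$ are the equivalence classes of $V$ under the relation: $u\sim v$ iff $u=v$ or there are $u_0=u,u_1,\dots,u_k=v$ in $V$ and $e_1,\dots,e_k\in E$ with $u_{j-1},u_j\in e_j$ for all $j=1,\dots,k$. For $x\in\mathbb{R}^V$, $\overline{x}:=\sum_{k=1}^l c_k1_{S_k}$ with $c_k=\frac{1}{\#S_k}\sum_{v\in S_k}x(v)$. $L^q(0,T;\mathbb{R}^V)$ and $W^{1,q}(0,T;\mathbb{R}^V)$ are the usual Lebesgue and Sobolev spaces of $\mathbb{R}^V$-valued functions (w.r.t. the $\ell^2$-norm), with elements of $W^{1,q}$ identified with their continuous representatives, and $x'=\frac{d}{dt}x$. A solution of (C) is an absolutely continuous function $x:[0,T]\to\mathbb{R}^V$ with $x(0)=x_0$ satisfying the inclusion for a.e. $t\in(0,T)$. A point $t_0\in[0,T)$ is a right-Lebesgue point of $h$ if the limit $h(t_0+0)$ exists and $\lim_{\tau\to+0}\frac1\tau\int_{t_0}^{t_0+\tau}|h(s)-h(t_0+0)|_{\ell^2}\,ds=0$. *)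

(* Defs.v *)
From HB Require Import structures.
From mathcomp Require Import all_boot all_order all_algebra.
From mathcomp Require Import all_classical all_reals all_analysis.
Import Order.TTheory GRing.Theory Num.Theory.
Import numFieldNormedType.Exports.

Set Implicit Arguments.
Unset Strict Implicit.
Unset Printing Implicit Defensive.

Local Open Scope classical_set_scope.
Local Open Scope ring_scope.

(* R^V is the type V -> R, with the pointwise vector space structure. *)

Definition dotV (R : realType) (V : finType) (x y : V -> R) : R :=
  \sum_v x v * y v.

Definition l2norm (R : realType) (V : finType) (x : V -> R) : R :=
  Num.sqrt (dotV x x).

Record hypergraph (R : realType) (V : finType) := Hypergraph {
  edges : {set {set V}} ;
  weight : {set V} -> R ; (* only its values on [edges] are relevant *)
  edge_card_gt1 : forall e, e \in edges -> (1 < #|e|)%N ;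
  weight_gt0 : forall e, e \in edges -> 0 < weight e }.

(* The default value 0 of the maximum is harmless: the pairs u = v
   contribute 0, and hyperedges are nonempty. *)
Definition edge_osc (R : realType) (V : finType) (e : {set V}) (x : V -> R) : R :=
  \big[Num.max/0]_(u in e) \big[Num.max/0]_(v in e) (x u - x v).

Definition energy (R : realType) (V : finType) (G : hypergraph R V) (p : R)
    (x : V -> R) : R :=
  p^-1 * \sum_(e in edges G) weight G e * edge_osc e x `^ p.

Definition subdifferential (R : realType) (V : finType) (F : (V -> R) -> R)
    (x : V -> R) : set (V -> R) :=
  [set z | forall y, F x + dotV z (y - x) <= F y].

Definition laplacian (R : realType) (V : finType) (G : hypergraph R V) (p : R)
    (x : V -> R) : set (V -> R) :=
  subdifferential (energy G p) x.

(* [min_norm_elt C z] reads "z = C°"; such a z is unique when C is closed and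
   convex. *)
Definition min_norm_elt (R : realType) (V : finType) (C : set (V -> R))
    (z : V -> R) : Prop :=
  C z /\ forall y, C y -> l2norm z <= l2norm y.

Definition share_edge (R : realType) (V : finType) (G : hypergraph R V) : rel V :=
  fun u v => [exists e in edges G, (u \in e) && (v \in e)].

Definition components (R : realType) (V : finType) (G : hypergraph R V) :
    {set {set V}} :=
  equivalence_partition (connect (share_edge G)) [set: V].

Definition comp_mean (R : realType) (V : finType) (G : hypergraph R V)
    (x : V -> R) : V -> R :=
  fun v => \sum_(S in components G)
             ((#|S|%:R)^-1 * \sum_(u in S) x u) * (v \in S)%:R.

(* Functions on an interval are represented by total functions on R of which
   only the values on that interval matter. *)

Definition abs_continuous (R : realType) (W : zmodType) (nrm : W -> R)
    (a b : R) (f : R -> W) : Prop :=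
  forall eps, 0 < eps -> exists2 delta, 0 < delta &
    forall (n : nat) (l r : 'I_n -> R),
      (forall i, a <= l i /\ l i <= r i /\ r i <= b) ->
      trivIset [set: 'I_n] (fun i => `]l i, r i[%classic) ->
      \sum_i (r i - l i) < delta ->
      \sum_i nrm (f (r i) - f (l i)) < eps.

Definition derivable_vec (R : realType) (V : finType) (x : R -> V -> R) (t : R) :
    Prop :=
  forall v, derivable (fun s => x s v) t 1.

Definition derive_vec (R : realType) (V : finType) (x : R -> V -> R) (t : R) :
    V -> R :=
  fun v => derive1 (fun s => x s v) t.

Definition right_derivable (R : realType) (V : finType) (x : R -> V -> R)
    (t0 : R) : Prop :=
  forall v, cvg (tau^-1 * (x (t0 + tau) v - x t0 v) @[tau --> 0^'+]).

Definition right_derive (R : realType) (V : finType) (x : R -> V -> R)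
    (t0 : R) : V -> R :=
  fun v => lim (tau^-1 * (x (t0 + tau) v - x t0 v) @[tau --> 0^'+]).

(* Membership in L^q(0,T;R^V), 1 <= q <= oo; measurability of an R^V-valued
   function is measurability of its coordinates. *)
Definition inL (R : realType) (V : finType) (q : \bar R) (T : R)
    (f : R -> V -> R) : Prop :=
  (forall v, measurable_fun `]0, T[ (fun t => f t v)) /\
  ('N[@lebesgue_measure R]_q[EFin \o ((fun t => l2norm (f t)) \_ `]0, T[)%R]
     < +oo)%E.

Definition test_function (R : realType) (T : R) (psi : R -> R) : Prop :=
  [/\ forall t, derivable psi t 1,
      continuous (derive1 psi),
      compact (closure [set t | psi t != 0]) &
      closure [set t | psi t != 0] `<=` `]0, T[].

Definition weak_derivative (R : realType) (V : finType) (T : R)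
    (f df : R -> V -> R) : Prop :=
  forall psi, test_function T psi -> forall v,
    \int[@lebesgue_measure R]_(s in `]0, T[) (f s v * derive1 psi s) =
    - \int[@lebesgue_measure R]_(s in `]0, T[) (df s v * psi s).

(* f is the continuous representative of an element of W^{1,q}(0,T;R^V), whose
   derivative is (the class of) df. *)
Definition inW1 (R : realType) (V : finType) (q : \bar R) (T : R)
    (f df : R -> V -> R) : Prop :=
  [/\ forall v, {within `[0, T], continuous (fun t => f t v)},
      inL q T f, inL q T df & weak_derivative T f df].

(* The mean of h over (t0, t0 + tau), and its limit h(t0+0) as tau -> +0. *)
Definition right_mean (R : realType) (V : finType) (h : R -> V -> R) (t0 tau : R) :
    V -> R :=
  fun v => tau^-1 * \int[@lebesgue_measure R]_(s in `]t0, t0 + tau[) h s v.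

Definition right_value (R : realType) (V : finType) (h : R -> V -> R) (t0 : R) :
    V -> R :=
  fun v => lim (right_mean h t0 tau v @[tau --> 0^'+]).

Definition right_lebesgue_point (R : realType) (V : finType) (h : R -> V -> R)
    (t0 : R) : Prop :=
  (forall v, cvg (right_mean h t0 tau v @[tau --> 0^'+])) /\
  (tau^-1 * \int[@lebesgue_measure R]_(s in `]t0, t0 + tau[)
              l2norm (h s - right_value h t0) @[tau --> 0^'+] --> 0).

Definition cauchy_solution (R : realType) (V : finType) (G : hypergraph R V)
    (p T : R) (h : R -> V -> R) (x0 : V -> R) (x : R -> V -> R) : Prop :=
  [/\ abs_continuous (@l2norm R V) 0 T x,
      x 0 = x0 &
      {ae @lebesgue_measure R, forall t, t \in `]0, T[ ->
        derivable_vec x t /\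
        [set derive_vec x t + z | z in laplacian G p (x t)] (h t)}].

(* Main.v *)
Require Import Defs.
From HB Require Import structures.
From mathcomp Require Import all_boot all_order all_algebra.
From mathcomp Require Import all_classical all_reals all_analysis.
From mathcomp Require Import measurable_realfun ess_sup_inf.
From mathcomp Require Import ring lra.
Import Order.TTheory GRing.Theory Num.Theory.
Import numFieldNormedType.Exports.

Set Implicit Arguments.
Unset Strict Implicit.
Unset Printing Implicit Defensive.

Local Open Scope classical_set_scope.
Local Open Scope ring_scope.

(** The evolution is the gradient flow of the convex function [energy G p], and
    everything rests on two consequences of the subgradient inequality. First,
    subdifferentials are monotone ([subdifferential_monotone]), so that the
    distance of two solutions grows at most by the integral of the difference of
    their forcing terms ([contraction]); this gives uniqueness, the a priori
    bound obtained by comparison with a constant minimizer such as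
    [comp_mean G x0], and the estimate of the speed obtained by comparing a
    solution with its own translates. Secondly, along a solution [x] the
    increments of [phi (x t)] over backward intervals are bounded by those of a
    linear functional of [x], which replaces the chain rule in all energy
    estimates ([weighted_energy]). Both arguments differentiate absolutely
    continuous functions at almost every time only; the passage to inequalities
    between values is the one-sided derivative test [ac_left_dini].

    Existence. Beyond a level that the a priori bound excludes, the powers in the
    energy are continued affinely; the resulting potential has bounded
    subgradients. For such a potential the unknown [u = x - H], with [H] the
    primitive of the forcing, solves an inclusion with bounded right-hand side,
    and explicit Euler schemes for [u] on dyadic grids form a Cauchy sequence
    because monotonicity controls the distance between two of them
    ([euler_cauchy]). The limit is Lipschitz, hence differentiable almost
    everywhere ([lipschitz_derivable_ae], from the Radon-Nikodym theorem), and
    it moves by a negative subgradient wherever it is differentiable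
    ([flow_subgradient]).

    Regularity. Testing the inclusion with [x'] gives [phi (x t) + \int |x'|^2 <=
    phi (x 0) + \int h . x'], a quadratic inequality for the norm of [x'] from
    which the announced bound follows ([derivative_bound]).

    Right derivative. At a right Lebesgue point, comparison with the constant
    solution of value [x t0] for the forcing [z] in [L (x t0)] bounds the difference
    quotients by the distance from [h (t0 + 0)] to [z], up to a vanishing error.
    Their cluster points belong to [h (t0 + 0) - L (x t0)] by integration of the
    subgradient inequality, so each is the element of minimal norm and the
    quotients converge ([right_derivative]).

    Weakly differentiable forcing. Such an [h] is the primitive of its weak
    derivative (du Bois-Reymond). Let [k t] be the norm of the right derivative.
    Comparing [x] with its translates gives [k t <= |x' s| + \int_s^t |h'|]
    ([slope_le]); averaging over [s] with weight [s], and using the bound of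
    [\int s |x'|^2] obtained by testing with [s x' + (x - c)]
    ([weighted_dissipation_le]), gives the decay estimate ([slope_decay]). *)

(** * Inner product and norm on R^V *)

Section Vectors.
Variables (R : realType) (V : finType).
Implicit Types (x y z w : V -> R) (c : R).

Lemma dotVC x y : dotV x y = dotV y x.
Proof. by apply: eq_bigr => v _; rewrite mulrC. Qed.

Lemma dotVDl x y z : dotV (x + y) z = dotV x z + dotV y z.
Proof. by rewrite -big_split; apply: eq_bigr => v _; rewrite [LHS]mulrDl. Qed.

Lemma dotVNl x z : dotV (- x) z = - dotV x z.
Proof. by rewrite /dotV -sumrN; apply: eq_bigr => v _; rewrite [LHS]mulNr. Qed.

Lemma dotVBl x y z : dotV (x - y) z = dotV x z - dotV y z.
Proof. by rewrite dotVDl dotVNl. Qed.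

Lemma dotVZl c x z : dotV (c *: x) z = c * dotV x z.
Proof. by rewrite /dotV mulr_sumr; apply: eq_bigr => v _; rewrite mulrA. Qed.

Lemma dotVDr x y z : dotV z (x + y) = dotV z x + dotV z y.
Proof. by rewrite dotVC dotVDl !(dotVC z). Qed.

Lemma dotVNr x z : dotV z (- x) = - dotV z x.
Proof. by rewrite dotVC dotVNl (dotVC z). Qed.

Lemma dotVBr x y z : dotV z (x - y) = dotV z x - dotV z y.
Proof. by rewrite dotVDr dotVNr. Qed.

Lemma dotVZr c x z : dotV z (c *: x) = c * dotV z x.
Proof. by rewrite dotVC dotVZl (dotVC z). Qed.

Definition dotVE := (dotVDl, dotVDr, dotVNl, dotVNr, dotVZl, dotVZr).

Lemma dotV0l x : dotV 0 x = 0.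
Proof. by rewrite /dotV big1// => v _; rewrite mul0r. Qed.

Lemma dotV_ge0 x : 0 <= dotV x x.
Proof. by apply: sumr_ge0 => v _; rewrite -expr2 sqr_ge0. Qed.

Lemma l2norm_ge0 x : 0 <= l2norm x.
Proof. exact: sqrtr_ge0. Qed.

Lemma sqr_l2norm x : l2norm x ^+ 2 = dotV x x.
Proof. by rewrite sqr_sqrtr// dotV_ge0. Qed.

Lemma l2norm0 : l2norm (0 : V -> R) = 0.
Proof. by rewrite /l2norm dotV0l sqrtr0. Qed.

Lemma l2norm_le0 x : l2norm x <= 0 -> x = 0.
Proof.
move=> x0; have : dotV x x == 0.
  by rewrite -sqr_l2norm (_ : l2norm x = 0) ?expr0n//; have := l2norm_ge0 x; lra.
rewrite psumr_eq0; last by move=> v _; rewrite -expr2 sqr_ge0.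
move=> /allP h; apply/funext => v; apply/eqP.
by have := h v (mem_index_enum v); rewrite mulf_eq0 orbb.
Qed.

Lemma dotV_le x y : dotV x y <= l2norm x * l2norm y.
Proof.
have [x0|x0] := eqVneq (l2norm x) 0.
  by rewrite (@l2norm_le0 x) ?x0// dotV0l mulr_ge0// l2norm_ge0.
have [y0|y0] := eqVneq (l2norm y) 0.
  by rewrite (@l2norm_le0 y) ?y0// dotVC dotV0l mulr_ge0// l2norm_ge0.
have xp : 0 < l2norm x by rewrite lt_neqAle eq_sym x0 l2norm_ge0.
have yp : 0 < l2norm y by rewrite lt_neqAle eq_sym y0 l2norm_ge0.
have := dotV_ge0 (l2norm y *: x - l2norm x *: y).
rewrite !dotVE -!sqr_l2norm (dotVC y x).
move=> h; rewrite -(ler_pM2l (mulr_gt0 xp yp)); nra.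
Qed.

Lemma l2normN x : l2norm (- x) = l2norm x.
Proof. by rewrite /l2norm dotVNl dotVNr opprK. Qed.

Lemma l2normB x y : l2norm (x - y) = l2norm (y - x).
Proof. by rewrite -l2normN opprB. Qed.

Lemma l2normZ c x : l2norm (c *: x) = `|c| * l2norm x.
Proof. by rewrite /l2norm dotVZl dotVZr mulrA -expr2 sqrtrM ?sqr_ge0// sqrtr_sqr. Qed.

Lemma ler_sqr_l2norm x c : 0 <= c -> (l2norm x <= c) = (dotV x x <= c ^+ 2).
Proof. by move=> c0; rewrite -sqr_l2norm ler_sqr// nnegrE l2norm_ge0. Qed.

Lemma sqr_l2normB x y :
  l2norm (x - y) ^+ 2 = l2norm x ^+ 2 - 2 * dotV x y + l2norm y ^+ 2.
Proof. by rewrite !sqr_l2norm dotVBl !dotVBr (dotVC y x); ring. Qed.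

Lemma l2normD x y : l2norm (x + y) <= l2norm x + l2norm y.
Proof.
rewrite ler_sqr_l2norm ?addr_ge0 ?l2norm_ge0//.
rewrite !dotVE (dotVC y x) sqrrD !sqr_l2norm.
by have := dotV_le x y; lra.
Qed.

Lemma l2norm_triangle z x y : l2norm (x - y) <= l2norm (x - z) + l2norm (z - y).
Proof. by rewrite -[x - y](_ : (x - z) + (z - y) = _) ?l2normD// addrA subrK. Qed.

Lemma ler_l2normB x y : `|l2norm x - l2norm y| <= l2norm (x - y).
Proof.
have h1 := l2normD (x - y) y; have h2 := l2normD (y - x) x.
rewrite subrK in h1; rewrite subrK (l2normB y) in h2; rewrite ler_norml; apply/andP; split; lra.
Qed.

Lemma normr_dotV_le x y : `|dotV x y| <= l2norm x * l2norm y.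
Proof.
rewrite ler_norml dotV_le andbT lerNl -dotVNl.
by rewrite (le_trans (dotV_le _ _))// l2normN.
Qed.

Lemma normr_le_l2norm x v : `|x v| <= l2norm x.
Proof.
rewrite -sqrtr_sqr ler_wsqrtr// /dotV (bigD1 v)//= -expr2 lerDl.
by apply: sumr_ge0 => u _; rewrite -expr2 sqr_ge0.
Qed.

Lemma l2norm_le_sum x : l2norm x <= \sum_v `|x v|.
Proof.
have s0 : 0 <= \sum_v `|x v| by apply: sumr_ge0.
rewrite ler_sqr_l2norm// expr2 mulr_suml; apply: ler_sum => v _.
rewrite (le_trans (ler_norm _))// normrM ler_wpM2l//.
by rewrite (bigD1 v)//= lerDl sumr_ge0.
Qed.

(** The denominator is nonzero even when [V] is empty. *)
Lemma l2norm_le_coord x c : 0 < c ->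
  (forall v, `|x v| <= c / (#|V|%:R + 1)) -> l2norm x <= c.
Proof.
move=> c0 H; rewrite (le_trans (l2norm_le_sum _))//.
apply: (@le_trans _ _ (\sum_(v : V) (c / (#|V|%:R + 1)))).
  by apply: ler_sum => v _; exact: H.
rewrite sumr_const -[_ *+ _]mulr_natr -mulrA ger_pMr//.
by rewrite mulrC ler_pdivrMr ?mul1r ?lerDl// ltr_wpDl.
Qed.

(** The subdifferential of any function is a monotone relation: add the two
    defining inequalities. *)
Lemma subdifferential_monotone (F : (V -> R) -> R) x y z w :
  subdifferential F x z -> subdifferential F y w -> 0 <= dotV (z - w) (x - y).
Proof.
move=> /(_ y) h1 /(_ x) h2; move: h1 h2.
by rewrite dotVBl !dotVBr; lra.
Qed.

End Vectors.

(** * Absolutely continuous functions *)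

Notation acR := (abs_continuous (fun r => `|r|)).

Section AbsolutelyContinuous.
Variables (R : realType).
Implicit Types (a b c t s : R).

(** Absolute continuity is inherited by every function whose increments are
    controlled by those of absolutely continuous ones; all the closure
    properties below are instances. *)
Lemma ac_dom (W W1 W2 : zmodType) (n : W -> R) (n1 : W1 -> R) (n2 : W2 -> R)
    a b (F : R -> W) (f : R -> W1) (g : R -> W2) C :
  0 <= C -> abs_continuous n1 a b f -> abs_continuous n2 a b g ->
  (forall s t, a <= s -> s <= t -> t <= b ->
     n (F t - F s) <= C * (n1 (f t - f s) + n2 (g t - g s))) ->
  abs_continuous n a b F.
Proof.
move=> C0 acf acg H e e0.
have e1 : 0 < e / (C + 1) / 2 by rewrite !divr_gt0// ltr_wpDl.
have [d1 d10 h1] := acf _ e1; have [d2 d20 h2] := acg _ e1.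
exists (Num.min d1 d2); first by rewrite lt_min d10.
move=> m l r lr tr; rewrite lt_min => /andP[s1 s2].
have {}h1 := h1 m l r lr tr s1; have {}h2 := h2 m l r lr tr s2.
apply: (@le_lt_trans _ _ (C * (\sum_i n1 (f (r i) - f (l i)) +
    \sum_i n2 (g (r i) - g (l i))))).
  rewrite -big_split mulr_sumr; apply: ler_sum => i _.
  by have [? [? ?]] := lr i; exact: H.
set S := _ + _.
have S1 : S < e / (C + 1).
  by rewrite (splitr (e / (C + 1))) ltrD.
apply: (@le_lt_trans _ _ (C * (e / (C + 1)))).
  by rewrite ler_wpM2l// ltW.
by rewrite mulrCA gtr_pMr// ltr_pdivrMr ?mul1r ?ltrDl// ltr_wpDl.
Qed.

Lemma ac_dom1 (W W1 : zmodType) (n : W -> R) (n1 : W1 -> R)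
    a b (F : R -> W) (f : R -> W1) C :
  0 <= C -> abs_continuous n1 a b f ->
  (forall s t, a <= s -> s <= t -> t <= b -> n (F t - F s) <= C * n1 (f t - f s)) ->
  abs_continuous n a b F.
Proof.
move=> C0 acf H; apply: (@ac_dom _ _ _ n n1 n1 a b F f f (C / 2)) => //.
  by rewrite divr_ge0.
by move=> s t as_ st tb; rewrite (le_trans (H s t as_ st tb))//; lra.
Qed.

Lemma acS (W : zmodType) (n : W -> R) a b a' b' (f : R -> W) :
  a <= a' -> b' <= b -> abs_continuous n a b f -> abs_continuous n a' b' f.
Proof.
move=> aa bb acf e /acf[d d0 H]; exists d => // m l r lr; apply: H => i.
by have [? [? ?]] := lr i; rewrite (le_trans aa)// (le_trans _ bb).
Qed.

Lemma ac_id a b : acR a b (fun t => t).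
Proof.
move=> e e0; exists e => // n l r lr _.
move=> /le_lt_trans; apply; apply: ler_sum => i _ /=.
by rewrite ger0_norm// subr_ge0; case: (lr i) => ? [].
Qed.

(** A single interval is an admissible family. *)
Lemma ac_unif (W : zmodType) (n : W -> R) a b (f : R -> W) e :
  abs_continuous n a b f -> 0 < e -> exists2 d, 0 < d &
  forall s t, a <= s -> s <= t -> t <= b -> t - s < d -> n (f t - f s) < e.
Proof.
move=> acf /acf[d d0 H]; exists d => // s t as_ st tb tsd.
have := H 1%N (fun=> s) (fun=> t); rewrite !big_ord1; apply => //.
by move=> i j _ _ _; rewrite !ord1.
Qed.

Lemma ac_within a b (f : R -> R) : acR a b f -> {within `[a, b], continuous f}.
Proof.
move=> acf; apply/subspace_continuousP => x /=; rewrite in_itv/= => /andP[ax xb].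
apply/cvgrPdist_lt => /= e e0; have [d d0 H] := ac_unif acf e0.
rewrite near_withinE; near=> y.
rewrite /= in_itv/= => /andP[ay yb].
have xyd : `|x - y| < d.
  by near: y; apply: cvgr_dist_lt => //; exact: cvg_id.
have [xy|yx] := leP x y.
  by rewrite distrC H//; move: xyd; rewrite ler0_norm; lra.
by rewrite H// ?(ltW yx)//; move: xyd; rewrite gtr0_norm; lra.
Unshelve. all: by end_near. Qed.

Lemma within_bounded a b (f : R -> R) : {within `[a, b], continuous f} ->
  exists2 M, 0 < M & forall t, a <= t -> t <= b -> `|f t| <= M.
Proof.
move=> cf; have [ab|ba] := leP a b; last first.
  by exists 1 => // t at_ tb; have := le_trans at_ tb; rewrite leNgt ba.
have [c _ hc] := EVT_max ab cf; have [d _ hd] := EVT_min ab cf.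
exists (`|f c| + `|f d| + 1).
  by rewrite ltr_wpDl// addr_ge0.
move=> t at_ tb.
have t1 : t \in `[a, b] by rewrite in_itv/= at_ tb.
have := hc t t1; have := hd t t1.
have := ler_norm (f c); have := ler_norm (- f d); rewrite normrN.
have := normr_ge0 (f c); have := normr_ge0 (f d).
by move=> *; rewrite ler_norml; apply/andP; split; lra.
Qed.

Lemma ac_bounded a b (f : R -> R) : acR a b f ->
  exists2 M, 0 < M & forall t, a <= t -> t <= b -> `|f t| <= M.
Proof. by move=> acf; exact/within_bounded/ac_within. Qed.

Lemma ac_cst a b (k : R) : acR a b (cst k).
Proof.
apply: (@ac_dom1 _ _ (fun r => `|r|) (fun r => `|r|) a b _ _ 0) (ac_id a b) _ => //.
by move=> s t _ _ _; rewrite subrr normr0 mul0r.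
Qed.

Lemma acD a b (f g : R -> R) : acR a b f -> acR a b g ->
  acR a b (fun t => f t + g t).
Proof.
move=> acf acg; apply: (ac_dom ler01 acf acg) => s t _ _ _.
by rewrite mul1r opprD addrACA ler_normD.
Qed.

Lemma acN a b (f : R -> R) : acR a b f -> acR a b (fun t => - f t).
Proof.
move=> acf; apply: (ac_dom1 ler01 acf) => s t _ _ _.
by rewrite mul1r -opprD normrN.
Qed.

Lemma acB a b (f g : R -> R) : acR a b f -> acR a b g ->
  acR a b (fun t => f t - g t).
Proof. by move=> acf acg; apply: acD => //; exact: acN. Qed.

Lemma acM a b (f g : R -> R) : acR a b f -> acR a b g ->
  acR a b (fun t => f t * g t).
Proof.
move=> acf acg; have [M M0 hM] := ac_bounded acf; have [N N0 hN] := ac_bounded acg.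
apply: (ac_dom (C := M + N) _ acf acg); first by rewrite addr_ge0// ltW.
move=> s t as_ st tb.
rewrite (_ : _ - _ = f t * (g t - g s) + g s * (f t - f s)); last by ring.
rewrite (le_trans (ler_normD _ _))// !normrM.
have h1 := hM t (le_trans as_ st) tb; have h2 := hN s as_ (le_trans st tb).
have n1 := normr_ge0 (g t - g s); have n2 := normr_ge0 (f t - f s).
have h3 : `|f t| * `|g t - g s| <= M * `|g t - g s| by rewrite ler_wpM2r.
have h4 : `|g s| * `|f t - f s| <= N * `|f t - f s| by rewrite ler_wpM2r.
nra.
Qed.

Lemma ac_sum (I : Type) (r : seq I) (P : pred I) a b (f : I -> R -> R) :
  (forall i, acR a b (f i)) -> acR a b (fun t => \sum_(i <- r | P i) f i t).
Proof.
move=> acf; elim: r => [|i r IH].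
  rewrite (_ : (fun t => _) = cst 0); first exact: ac_cst.
  by apply/funext => t; rewrite big_nil.
rewrite (_ : (fun t => _) = (fun t => if P i then
    f i t + \sum_(j <- r | P j) f j t else \sum_(j <- r | P j) f j t)).
  by case: (P i) => //; exact: acD.
by apply/funext => t; rewrite big_cons.
Qed.

Lemma ac_vec (V : finType) a b (x : R -> V -> R) :
  abs_continuous (@l2norm R V) a b x <-> forall v, acR a b (fun t => x t v).
Proof.
split=> acx => [v|].
  apply: (ac_dom1 ler01 acx) => s t _ _ _; rewrite mul1r.
  exact: (normr_le_l2norm (x t - x s)).
have acs : abs_continuous (fun y : V -> R => \sum_v `|y v|) a b x.
  move=> e e0.
  have e1 : 0 < e / (#|V|%:R + 1) by rewrite divr_gt0// ltr_wpDl.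
  have /choice[d hd] v : exists d, 0 < d /\ forall n (l r : 'I_n -> R),
      (forall i, a <= l i /\ l i <= r i /\ r i <= b) ->
      trivIset [set: 'I_n] (fun i => `]l i, r i[%classic) ->
      \sum_i (r i - l i) < d ->
      \sum_i `|x (r i) v - x (l i) v| < e / (#|V|%:R + 1).
    by have [d d0 hd] := acx v _ e1; exists d.
  exists (\big[Num.min/1]_v d v).
    by apply: (big_ind (fun z => 0 < z)) => // [p q p0 q0|v _]; [rewrite lt_min p0|case: (hd v)].
  move=> n l r lr tr sd; rewrite exchange_big/=.
  apply: (@le_lt_trans _ _ (\sum_(v : V) (e / (#|V|%:R + 1)))).
    apply: ler_sum => v _; apply: ltW.
    have [_ H] := hd v; apply: (H n l r lr tr); apply: (lt_le_trans sd).
    by rewrite (bigD1 v)//= ge_min lexx.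
  rewrite sumr_const -[_ *+ _]mulr_natr -mulrA gtr_pMr//.
  by rewrite mulrC ltr_pdivrMr ?mul1r ?ltrDl// ltr_wpDl.
apply: (ac_dom1 ler01 acs) => s t _ _ _; rewrite mul1r; exact: l2norm_le_sum.
Qed.

End AbsolutelyContinuous.

(** * Monotonicity from one-sided derivatives *)

Section Dini.
Variable (R : realType).
Implicit Types (a b c t : R) (U : set R).
Notation mu := (@lebesgue_measure R).

(** [chain U c b s]: [s] lists, from left to right, the endpoints of
    non-overlapping intervals of [c, b] whose interiors lie in [U]. *)
Fixpoint chain U c b (s : seq (R * R)) : Prop :=
  match s with
  | [::] => c <= b
  | p :: s' => [/\ c <= p.1, p.1 <= p.2, `]p.1, p.2[ `<=` U & chain U p.2 b s']
  end.

Lemma chain_le U c b s : chain U c b s -> c <= b.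
Proof.
by elim: s c => [//|p s IH] c /= [h1 h2 _ /IH h3]; rewrite (le_trans h1)// (le_trans h2).
Qed.

Lemma chain_weaken U c c' b s : c' <= c -> chain U c b s -> chain U c' b s.
Proof.
by move=> cc; case: s => [|p s] /=; [exact: le_trans|case=> h1 *; split=> //; exact: (le_trans cc)].
Qed.

Lemma chain_nth U c b s j : chain U c b s -> (j < size s)%N ->
  let p := nth (0, 0) s j in c <= p.1 /\ p.1 <= p.2 /\ p.2 <= b.
Proof.
elim: s c j => [//|p s IH] c [|j] /= [h1 h2 _ h3] js.
  by split => //; split => //; exact: chain_le h3.
have [k1 k2] := IH _ _ h3 js; split => //.
by rewrite (le_trans h1)// (le_trans h2).
Qed.

Lemma chain_lt U c b s i j : chain U c b s -> (i < j)%N -> (j < size s)%N ->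
  (nth (0, 0) s i).2 <= (nth (0, 0) s j).1.
Proof.
elim: s c i j => [//|p s IH] c [|i] [|j] //= [h1 h2 _ h3] ij js.
  by have [] := chain_nth h3 js.
exact: (IH p.2).
Qed.

Lemma chain_trivIset U c b s : chain U c b s ->
  trivIset [set: 'I_(size s)]
    (fun i => `](nth (0, 0) s i).1, (nth (0, 0) s i).2[%classic).
Proof.
move=> cs; apply/trivIsetP => i j _ _.
wlog ij : i j / (i < j)%N => [H ij|_].
  have [h|h|h] := ltngtP (val i) (val j).
  - exact: H.
  - by rewrite setIC; apply: H => //; rewrite eq_sym.
  - by move/eqP : ij; case; exact: val_inj.
have h := chain_lt cs ij (ltn_ord j).
rewrite -subset0 => x /= []; rewrite !in_itv/= => /andP[_ x1] /andP[x2 _].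
by have := lt_trans x1 (le_lt_trans h x2); rewrite ltxx.
Qed.

Lemma chain_length U c b s : measurable U -> chain U c b s ->
  ((\sum_(p <- s) (p.2 - p.1))%:E <= mu (U `&` `]c, b[))%E.
Proof.
move=> mU; elim: s c => [|p s IH] c /=.
  by rewrite big_nil.
move=> [h1 h2 h3 h4]; rewrite big_cons EFinD.
apply: (@le_trans _ _ (mu (`]p.1, p.2[ `|` (U `&` `]p.2, b[)))).
  rewrite measureU//=; last 2 first.
  - exact: measurableI.
  - rewrite -subset0 => x /= []; rewrite !in_itv/= => /andP[_ x1] [_ /andP[x2 _]].
    by have := lt_trans x1 x2; rewrite ltxx.
  rewrite leeD//; last exact: IH.
  rewrite lebesgue_measure_itv/= lte_fin; case: ltP => // h.
  by rewrite lee_fin; lra.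
apply: le_measure; rewrite ?inE.
- by apply: measurableU => //; exact: measurableI.
- exact: measurableI.
move=> x /= [px|[Ux]]; last first.
  rewrite !in_itv/= => /andP[x1 x2]; split => //.
  by rewrite x2 andbT (le_lt_trans _ x1)// (le_trans h1).
split; first exact: h3.
move: px; rewrite !in_itv/= => /andP[x1 x2].
by rewrite (le_lt_trans h1)//= (lt_le_trans x2)// (chain_le h4).
Qed.

Lemma ac_chain a b e (F : R -> R) : acR a b F -> 0 < e ->
  exists2 d, 0 < d & forall U, measurable U -> (mu U < d%:E)%E ->
    forall s, chain U a b s -> \sum_(p <- s) `|F p.2 - F p.1| < e.
Proof.
move=> acF e0; have [d d0 H] := acF _ e0; exists d => // U mU mUd s cs.
rewrite (big_nth (0, 0)) big_mkord.
apply: (H _ (fun i => (nth (0, 0) s i).1) (fun i => (nth (0, 0) s i).2)).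
- by move=> i; exact: chain_nth cs (ltn_ord i).
- exact: chain_trivIset cs.
rewrite -(big_mkord xpredT (fun i => (nth (0, 0) s i).2 - (nth (0, 0) s i).1)).
rewrite -(big_nth (0,0) xpredT (fun p => p.2 - p.1)).
rewrite -lte_fin; apply: le_lt_trans mUd.
apply: (le_trans (chain_length mU cs)).
by apply: le_measure; rewrite ?inE//; apply: measurableI.
Qed.

(** The left-hand derivative test for absolutely continuous functions.  Cover
    the exceptional null set by an open [U] of small measure and let [V c] be
    the variation of [F] on [U] inside [c, b], which absolute continuity makes
    small.  Then the set of [c] with [F b - F c <= e * (b - c) + V c] contains
    [b], can be extended to the left from each of its points, and is closed to
    the left by continuity, hence contains [a]. *)
Theorem ac_left_dini a b (F : R -> R) (N : set R) : a <= b -> acR a b F ->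
  mu.-negligible N ->
  (forall t, a < t -> t < b -> ~ N t -> forall e, 0 < e -> exists2 d, 0 < d &
     forall s, a <= s -> t - d < s -> s < t -> F t - F s <= e * (t - s)) ->
  F b <= F a.
Proof.
move=> ab acF [A [mA A0 NA]] dini.
suff H e : 0 < e -> F b - F a <= e * (b - a) + e.
  apply/ler_addgt0Pr => e e0; rewrite -lerBlDl.
  have ba : 0 < b - a + 1 by rewrite ltr_wpDl// subr_ge0.
  have e1 : 0 < e / (b - a + 1) by rewrite divr_gt0.
  apply: (le_trans (H _ e1)).
  by rewrite -[X in _ + X]mulr1 -mulrDr divfK// gt_eqF.
move=> e0.
pose A' := A `|` [set b].
have mA' : measurable A' by exact: measurableU.
have muA' : (mu A' = 0)%E.
  apply/eqP; rewrite eq_le measure_ge0 andbT.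
  rewrite -[X in (_ <= X)%E]adde0 -{1}A0 -(lebesgue_measure_set1 b).
  exact: measureU2.
have [d d0 Hd] := ac_chain acF e0.
have [U [oU AU UA]] : exists U, [/\ open U, A' `<=` U & (mu (U `\` A') < d%:E)%E].
  by apply: lebesgue_regularity_outer => //; exact: (eq_ind_r (fun z => (z < +oo)%E) (ltry 0) muA').
have mU : measurable U by exact: open_measurable.
have {}UA : (mu U < d%:E)%E.
  apply: le_lt_trans UA; rewrite -[X in (_ <= X)%E]add0e -muA'.
  rewrite (_ : mu U = mu (A' `|` (U `\` A'))); last by rewrite setDUK.
  by apply: (@measureU2 _ _ _ (@lebesgue_measure R)) => //; exact: measurableD.
have {}Hd := Hd U mU UA.
pose W c : set R := [set z : R | exists2 s, chain U c b s & z = \sum_(p <- s) `|F p.2 - F p.1|].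
pose V c := sup (W c).
have W0 c : c <= b -> W c 0 by move=> cb; exists [::] => //; rewrite big_nil.
have Wub c : a <= c -> ubound (W c) e.
  by move=> ac_ _ [s cs ->]; apply/ltW/Hd/(chain_weaken ac_).
have Wsup c : a <= c -> c <= b -> has_sup (W c).
  by move=> ac_ cb; split; [exists 0; exact: W0|exists e; exact: Wub].
have V0 c : a <= c -> c <= b -> 0 <= V c.
  by move=> ac_ cb; apply: ub_le_sup; [exact: (Wsup _ ac_ cb).2|exact: W0].
have Vmono c c' : a <= c' -> c' <= c -> c <= b -> V c <= V c'.
  move=> ac' cc cb; apply: le_sup.
  - move=> z Wz; exists z; split => //.
    by case: Wz => s cs ->; exists s => //; exact: chain_weaken cs.
  - by exists 0; exact: W0.
  - by apply: Wsup => //; exact: (le_trans cc).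
have Vstep c c' : a <= c' -> c' <= c -> c <= b -> `]c', c[ `<=` U ->
    `|F c - F c'| + V c <= V c'.
  move=> ac' cc cb cU; rewrite addrC -lerBrDr; apply: ge_sup.
    by exists 0; exact: W0.
  move=> _ [s cs ->]; rewrite lerBrDr addrC; apply: ub_le_sup.
    by apply: (Wsup _ ac' _).2; exact: (le_trans cc).
  by exists ((c', c) :: s) => //; rewrite big_cons.
pose S := [set c | [/\ a <= c, c <= b & F b - F c <= e * (b - c) + V c]].
have Sb : S b by split => //; rewrite !subrr mulr0 add0r; exact: V0.
have Slb : lbound S a by move=> c [].
have iS : has_inf S by split; [exists b|exists a].
pose m := inf S.
have am : a <= m by apply: lb_le_inf => //; exists b.
have mb : m <= b by apply: ge_inf => //; exists a.
have Sm : S m.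
  split => //; apply/ler_addgt0Pr => eta eta0.
  have [d' d'0 Hd'] := ac_unif acF eta0.
  have [c Sc cm] := inf_adherent d'0 iS.
  have mc : m <= c by apply: ge_inf => //; exists a.
  case: Sc => [ac_ cb Fc].
  have := Hd' m c am mc cb; rewrite ltrBlDl => /(_ cm) h1.
  have h2 := ler_norm (F c - F m).
  have h3 := Vmono _ _ am mc cb.
  have h4 : e * (b - c) <= e * (b - m) by rewrite ler_pM2l// lerB.
  lra.
have step c : S c -> a < c -> exists2 c', S c' & c' < c.
  move=> [ac_ cb Fc] ac1.
  have [A'c|nA'c] := pselect (A' c).
    have : nbhs c U by apply: open_nbhs_nbhs; split => //; exact: AU.
    move=> /nbhs_ballP[r /= r0 rU].
    pose c' := Num.max a (c - r / 2).
    have c'c : c' < c by rewrite gt_max ac1/=; lra.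
    have ac' : a <= c' by rewrite le_max lexx.
    exists c' => //; split => //; first by rewrite (le_trans (ltW c'c)).
    have : `|F c - F c'| + V c <= V c'.
      apply: (Vstep _ _ ac' (ltW c'c) cb) => x /=; rewrite in_itv/= => /andP[x1 x2]; apply: rU.
      rewrite /ball/= gtr0_norm ?subr_gt0//.
      have : c - r / 2 < x by rewrite (le_lt_trans _ x1)// le_max lexx orbT.
      lra.
    have := ler_norm (F c - F c').
    have : e * (b - c) <= e * (b - c') by rewrite ler_pM2l// lerB// ltW.
    lra.
  have cb' : c < b.
    by rewrite lt_neqAle cb andbT; apply/eqP => cb'; apply: nA'c; right.
  have nNc : ~ N c by move=> /NA Ac; apply: nA'c; left.
  have [r r0 Hr] := dini c ac1 cb' nNc e e0.
  pose c' := Num.max a (c - r / 2).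
  have c'c : c' < c by rewrite gt_max ac1/=; lra.
  have ac' : a <= c' by rewrite le_max lexx.
  exists c' => //; split => //; first by rewrite (le_trans (ltW c'c)).
  have c'r : c - r < c' by rewrite lt_max; apply/orP; right; lra.
  have h1 := Hr c' ac' c'r c'c.
  have h2 := Vmono _ _ ac' (ltW c'c) cb.
  have : e * (b - c') = e * (b - c) + e * (c - c') by ring.
  lra.
have ma : m = a.
  apply/eqP; rewrite eq_le am andbT leNgt; apply/negP => am'.
  have [c' Sc' c'm] := step m Sm am'.
  have : m <= c' by apply: ge_inf => //; exists a.
  by rewrite leNgt c'm.
move: Sm; rewrite ma => -[_ _ /le_trans]; apply; rewrite lerD2l.
by apply: ge_sup; [exists 0; exact: W0|exact: Wub].
Qed.

End Dini.

Section DerivativeTest.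
Variable (R : realType).
Implicit Types (a b t D : R) (F : R -> R).
Notation mu := (@lebesgue_measure R).

Lemma aeW (P : R -> Prop) : (forall t, P t) -> {ae mu, forall t, P t}.
Proof. by move=> H; apply: (@filterE _ _ (ae_filter_ringOfSetsType mu)). Qed.

Lemma aeS (P Q : R -> Prop) : (forall t, P t -> Q t) ->
  {ae mu, forall t, P t} -> {ae mu, forall t, Q t}.
Proof. by move=> H; apply: (@filterS _ _ (ae_filter_ringOfSetsType mu)). Qed.

Lemma aeS2 (P Q S : R -> Prop) : (forall t, P t -> Q t -> S t) ->
  {ae mu, forall t, P t} -> {ae mu, forall t, Q t} -> {ae mu, forall t, S t}.
Proof. by move=> H; apply: (@filterS2 _ _ (ae_filter_ringOfSetsType mu)). Qed.

Lemma aeI (P Q : R -> Prop) : {ae mu, forall t, P t} -> {ae mu, forall t, Q t} ->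
  {ae mu, forall t, P t /\ Q t}.
Proof. exact: aeS2. Qed.

Lemma ae_forall (I : finType) (P : I -> R -> Prop) :
  (forall i, {ae mu, forall t, P i t}) -> {ae mu, forall t, forall i, P i t}.
Proof. exact: (@filter_forall _ _ _ _ (ae_filter_ringOfSetsType mu)). Qed.

(** The estimate form holds trivially at [s = t], so that it can be added and
    multiplied without excluding the base point. *)
Lemma is_deriveP F t (D : R) : is_derive t 1 F D <->
  forall e : R, 0 < e -> exists2 d : R, 0 < d &
    forall s : R, `|s - t| < d -> `|F s - F t - D * (s - t)| <= e * `|s - t|.
Proof.
have quot s : s != t -> forall e, (`|D - (s - t)^-1 * (F s - F t)| <= e) =
    (`|F s - F t - D * (s - t)| <= e * `|s - t|).
  move=> st e; have st0 : s - t != 0 by rewrite subr_eq0.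
  rewrite -(@ler_pM2r _ `|s - t|) ?normr_gt0// -normrM.
  rewrite (_ : (D - _) * _ = - (F s - F t - D * (s - t))) ?normrN//.
  by field.
split=> [[dF DF] e e0|H].
  have : h^-1 *: (F (h *: (1:R) + t) - F t) @[h --> (0:R)^'] --> D.
    by rewrite -DF; exact: dF.
  move=> /cvgrPdist_le /(_ _ e0) /nbhs_ballP[d /= d0 Hd].
  exists d => // s std; have [->|st] := eqVneq s t.
    by rewrite !subrr mulr0 subrr normr0 mulr0.
  rewrite -quot//; have := Hd (s - t); rewrite /ball/= sub0r normrN => /(_ std).
  by rewrite subr_eq0 => /(_ st); rewrite [_%:A]mulr1 subrK.
have cF : h^-1 *: (F (h *: (1:R) + t) - F t) @[h --> (0:R)^'] --> D.
  apply/cvgrPdist_le => e e0; have [d d0 Hd] := H e e0.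
  apply/nbhs_ballP; exists d => //= h; rewrite /ball/= sub0r normrN => hd h0.
  have ht : h + t != t by rewrite -subr_eq0 addrK.
  have := quot _ ht e; rewrite addrK [_%:A]mulr1 => ->.
  by have := Hd (h + t); rewrite addrK; exact.
apply: DeriveDef; first by apply/cvg_ex; exists D.
by apply/cvg_lim => //; exact: Rhausdorff.
Qed.

(** It suffices that the backward increments of [F] are bounded by those of
    some function [k] (depending on the point) with nonpositive derivative. *)
Theorem ac_left_majorant a b F : a <= b -> acR a b F ->
  {ae mu, forall t, a < t -> t < b -> exists2 k : R -> R,
     (forall s, a <= s -> s < t -> F t - F s <= k t - k s) &
     exists2 D : R, is_derive t 1 k D & D <= 0} ->
  F b <= F a.
Proof.
move=> ab acF aeF; apply: (ac_left_dini ab acF aeF) => t at_ tb /contrapT.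
move=> + e e0 => /(_ at_ tb)[k Fk [D /is_deriveP /(_ e e0)[d d0 Hd] D0]].
exists d => // s as_ ds st; apply: (le_trans (Fk s as_ st)); have := Hd s.
rewrite distrC gtr0_norm ?subr_gt0// => /(_ _)/wrap[]; first by lra.
move=> /ler_normlP[h _].
have : D * (t - s) <= 0 by rewrite mulr_le0_ge0// subr_ge0 ltW.
by move: h; rewrite (_ : - (_ - _ - _) = k t - k s - D * (t - s)); [lra|ring].
Qed.

Theorem ac_nonincreasing a b F : a <= b -> acR a b F ->
  {ae mu, forall t, a < t -> t < b -> exists2 D : R, is_derive t 1 F D & D <= 0} ->
  F b <= F a.
Proof.
move=> ab acF aeF; apply: ac_left_majorant => //; apply: aeS aeF => t H at_ tb.
by exists F => //; exact: H.
Qed.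

Lemma ac_constant a b F : a <= b -> acR a b F ->
  {ae mu, forall t, a < t -> t < b -> is_derive t 1 F 0} -> F b = F a.
Proof.
move=> ab acF aeF; apply/eqP; rewrite eq_le; apply/andP; split.
  apply: ac_nonincreasing => //; apply: aeS aeF => t H *.
  by exists 0 => //; exact: H.
rewrite -lerN2; apply: (@ac_nonincreasing a b (fun t => - F t)) => //.
  exact: acN.
apply: aeS aeF => t H at_ tb; exists (- 0); last by rewrite oppr0.
by have := H at_ tb => ?; exact: is_deriveN.
Qed.

End DerivativeTest.

(** * Indefinite integrals *)

Section Primitive.
Variable (R : realType).
Implicit Types (a b t s : R) (f g : R -> R).
Notation mu := (@lebesgue_measure R).

Definition prim a f t : R := \int[mu]_(s in `]a, t[) f s.

Notation intb a b f := (mu.-integrable `]a, b[ (EFin \o f)).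

Lemma intbS a b a' b' f : a <= a' -> b' <= b -> intb a b f -> intb a' b' f.
Proof.
move=> aa bb; apply: integrableS => //.
by apply: subset_itv; rewrite bnd_simp.
Qed.

Lemma prim0 a t f : t <= a -> prim a f t = 0.
Proof. by move=> ta; rewrite /prim set_itv_ge ?Rintegral_set0// bnd_simp -leNgt. Qed.

Lemma prim_split a s t f : a <= s -> s <= t -> intb a t f ->
  prim a f t = prim a f s + prim s f t.
Proof.
move=> as_ st fi; have fas : intb a s f by exact: intbS fi.
have fst : intb s t f by exact: intbS fi.
have [->|as1] := eqVneq a s; first by rewrite [X in _ = X + _]prim0// add0r.
have ats : `]a, t[%classic = `]a, s[ `|` `[s, t[.
  by apply: itv_bndbnd_setU; rewrite bnd_simp// lt_neqAle as1.
rewrite /prim ats Rintegral_setU//.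
- by congr (_ + _); rewrite -Rintegral_itv_obnd_cbnd.
- by rewrite -ats.
- apply/disj_setPLR => x /=; rewrite !in_itv/= => /andP[_ xs] /andP[sx _].
  by have := lt_le_trans xs sx; rewrite ltxx.
Qed.

Lemma prim_cst a t (k : R) : a <= t -> prim a (fun=> k) t = k * (t - a).
Proof.
move=> at_; rewrite /prim Rintegral_cst//= lebesgue_measure_itv/= lte_fin.
by move: at_; rewrite le_eqVlt => /predU1P[->|->]//; rewrite ltxx subrr.
Qed.

Lemma intb_restrict a b f : intb a b f ->
  mu.-integrable setT (EFin \o (f \_ `]a, b[)).
Proof. by move=> fi; rewrite -restrict_EFin; apply: (integrable_mkcond _ _).1. Qed.

Lemma le_normr_prim a t f : intb a t f ->
  `|prim a f t| <= prim a (fun s => `|f s|) t.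
Proof. exact: le_normr_Rintegral. Qed.

(** Absolute continuity of the integral over sets of small measure, applied to
    finite unions of intervals. *)
Lemma prim_ac a b f : intb a b f -> acR a b (prim a f).
Proof.
move=> fi e e0; pose g := f \_ `]a, b[.
have gi := intb_restrict fi; rewrite -/g in gi.
have [d [d0 Hd]] := integral_normr_continuous gi e0.
exists d => // n l r lr tr sd.
pose D := \big[setU/set0]_(i <- index_enum 'I_n) `]l i, r i[%classic.
have mD : measurable D by apply: bigsetU_measurable.
have muD : (mu D < d%:E)%E.
  rewrite /D measure_bigsetU_ord// -lte_fin in sd *; apply: le_lt_trans sd.
  rewrite -sumEFin; apply: lee_sum => i _.
  rewrite /= lebesgue_measure_itv/= lte_fin; case: ltP => // _.
  by rewrite lee_fin subr_ge0; case: (lr i) => _ [].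
apply: le_lt_trans (Hd D mD muD).
have gni A : measurable A -> mu.-integrable A (EFin \o (fun x => `|g x|)).
  move=> mA; apply: (@integrableS _ _ _ _ setT) => //.
  exact: integrable_norm.
rewrite {1}/Rintegral ge0_integral_bigsetU//.
- rewrite -sum_fine; last by move=> i _; apply: integrable_fin_num => //; exact: gni.
  apply: ler_sum => i _; have [al [lri rb]] := lr i.
  rewrite (prim_split al lri); last exact: intbS fi.
  rewrite addrAC subrr add0r (le_trans (le_normr_prim _))//.
    exact: intbS fi.
  rewrite le_eqVlt; apply/orP; left; apply/eqP/eq_Rintegral => x.
  rewrite inE/= in_itv/= => /andP[x1 x2]; rewrite /g patchE mem_set//=.
  by rewrite in_itv/= (le_lt_trans al)//= (lt_le_trans x2).
- exact: index_enum_uniq.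
- by apply: sub_trivIset tr.
- by case/integrableP: (gni D mD).
Qed.

(** Almost every point is a Lebesgue point of [f]. *)
Lemma prim_derive a b f : intb a b f ->
  {ae mu, forall t, a < t -> t < b -> is_derive t 1 (prim a f) (f t)}.
Proof.
move=> fi; pose g := f \_ `]a, b[.
have gi := intb_restrict fi; rewrite -/g in gi.
have lg : locally_integrable setT g by exact: integrable_locally.
have := lebesgue_differentiation lg; apply: aeS => t gt at_ tb.
have giab u : mu.-integrable `]a, u] (EFin \o g) by exact: integrableS gi.
have [dG G'] := FTC1_lebesgue_pt tb (giab b) (at_ : (BRight a < BRight t)%O) gt.
have ft : g t = f t by rewrite /g patchE mem_set//= in_itv/= at_ tb.
rewrite -ft -G' derive1E.
apply: (@near_eq_is_derive _ _ _ (fun y => \int[mu]_(t in `]a, y]) g t)).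
  near=> y; rewrite /prim -Rintegral_itv_bndo_bndc; last first.
    by apply: integrableS gi.
  have yb : y < b by near: y; exact: lt_nbhsl.
  apply: eq_Rintegral => x; rewrite inE/= in_itv/= => /andP[ax xy].
  by rewrite /g patchE mem_set//= in_itv/= ax (lt_trans xy).
by apply: DeriveDef.
Unshelve. all: by end_near. Qed.

End Primitive.
Notation intb a b f := ((@lebesgue_measure _).-integrable `]a, b[ (EFin \o f)).

(** * Lipschitz functions are differentiable almost everywhere *)

Section Lipschitz.
Variable (R : realType).
Notation mu := (@lebesgue_measure R).

Lemma lipschitz_continuous (u : R -> R) (L : R) :
  (forall s t, `|u t - u s| <= L * `|t - s|) -> continuous u.
Proof.
move=> uL t; apply/cvgrPdist_lt => e e0.
have L1 : 0 < `|L| + 1 by rewrite ltr_wpDl.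
near=> s; apply: (le_lt_trans (uL _ _)).
have : `|t - s| < e / (`|L| + 1).
  by near: s; apply: cvgr_dist_lt; rewrite ?divr_gt0//; exact: cvg_id.
rewrite ltr_pdivlMr// => h; apply: le_lt_trans h.
rewrite mulrC ler_wpM2l//; have := ler_norm L; lra.
Unshelve. all: by end_near. Qed.

(** The Stieltjes measures of the nondecreasing functions [L * t + u t] and
    [L * t - u t] add up to [2 * L] times the Lebesgue measure; hence both have
    densities, and an indefinite integral is differentiable almost everywhere. *)
Theorem lipschitz_derivable_ae (u : R -> R) (L a b : R) :
  (forall s t, `|u t - u s| <= L * `|t - s|) ->
  {ae mu, forall t, a < t -> t < b -> derivable u t 1}.
Proof.
move=> uL.
have [ab|ba] := ltP a b; last first.
  by apply: aeW => t at_ tb; have := lt_trans at_ tb; rewrite ltNge ba.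
wlog L0 : L uL / 0 < L => [H|].
  apply: (H (`|L| + 1)); last by rewrite ltr_wpDl.
  move=> s t; apply: (le_trans (uL s t)); rewrite ler_wpM2r//.
  by have := ler_norm L; lra.
have cu := lipschitz_continuous uL.
pose f t := L * t + u t; pose f' t := L * t - u t.
have cL : continuous (fun t : R => L * t).
  by move=> t; apply: cvgMr; exact: cvg_id.
have ndf : {homo f : x y / x <= y}.
  move=> s t st; have := uL s t; rewrite [X in _ * X]ger0_norm ?subr_ge0//.
  by move=> /ler_normlP[h1 h2]; rewrite /f; lra.
have ndf' : {homo f' : x y / x <= y}.
  move=> s t st; have := uL s t; rewrite [X in _ * X]ger0_norm ?subr_ge0//.
  by move=> /ler_normlP[h1 h2]; rewrite /f'; lra.
have rcf : right_continuous f.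
  by apply: right_continuousW => t; apply: cvgD; [exact: cL|exact: cu].
have rcf' : right_continuous f'.
  by apply: right_continuousW => t; apply: cvgB; [exact: cL|exact: cu].
pose F : cumulative R R := HB.pack f (isCumulative.Build R _ R f ndf rcf).
pose F' : cumulative R R := HB.pack f' (isCumulative.Build R _ R f' ndf' rcf').
pose m := lebesgue_stieltjes_measure F.
pose m' := lebesgue_stieltjes_measure F'.
have mE (G : cumulative R R) s t : s <= t ->
    lebesgue_stieltjes_measure G `]s, t] = (G t - G s)%:E.
  move=> st; rewrite /lebesgue_stieltjes_measure/= /measure_extension/=.
  rewrite measurable_mu_extE; last exact: is_ocitv.
  exact: (wlength_itv_bnd G false false st).
have m0 : m set0 = 0%E := measure0 (lebesgue_stieltjes_measure F).
have m'0 : m' set0 = 0%E := measure0 (lebesgue_stieltjes_measure F').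
have k0 : 0 <= (2 * L)^-1 by rewrite invr_ge0 mulr_ge0// ltW.
have msE A : mscale (NngNum k0) (measure_add m m') A =
    ((2 * L)^-1%:E * (m A + m' A))%E by rewrite -measure_addE.
have muE A : measurable A -> mu A = ((2 * L)^-1%:E * (m A + m' A))%E.
  move=> mA; rewrite -msE; apply: lebesgue_measure_unique => // X [[s t] _ <-].
  rewrite [RHS]msE; move: s t => s t /=.
  have [st|ts] := leP s t; last first.
    by rewrite set_itv_ge ?bnd_simp -?leNgt ?ltW// m0 m'0 measure0 adde0 mule0.
  rewrite [X in (_ * (X + _))%E](mE F _ _ st) [X in (_ * (_ + X))%E](mE F' _ _ st).
  rewrite lebesgue_measure_itv/= lte_fin /= /f /f'.
  rewrite -EFinD -EFinM; case: ltP => [_|ts]; congr EFin.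
    by field; rewrite gt_eqF.
  have -> : s = t by apply/eqP; rewrite eq_le st ts.
  by rewrite !subrr addr0 mulr0.
have m_dom A : measurable A -> mu A = 0%E -> m A = 0%E.
  move=> mA; rewrite muE// => /eqP.
  rewrite mule_eq0 eqe invr_eq0 mulf_eq0 pnatr_eq0/= gt_eqF//= padde_eq0 ?measure_ge0//.
  by move=> /andP[/eqP].
have mab : (lebesgue_stieltjes_measure F `]a, b]%classic < +oo)%E.
  by rewrite mE ?ltry// ltW.
have mD : measurable (`]a, b]%classic : set (measurableTypeR R)).
  exact: measurable_itv.
pose nu : {finite_measure set (measurableTypeR R) -> \bar R} := mfrestr mD mab.
have nu_mu : nu `<< mu.
  move=> A A0 B mB BA; apply: m_dom; first exact: measurableI.
  by apply: A0; [exact: measurableI|move=> x [/BA]].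
have [g [g0 gfin gi gE]] := @radon_nikodym_sigma_finite _ _ R mu nu nu_mu.
pose h t := fine (g t).
have gh : g = EFin \o h by apply/funext => t; rewrite /h/= fineK.
have hi : intb a b h by rewrite -gh; exact: integrableS gi.
have fE t : a < t -> t < b -> f t = f a + prim a h t.
  move=> at_ tb; apply/eqP; rewrite addrC -subr_eq; apply/eqP.
  rewrite /prim Rintegral_itv_bndo_bndc; last by apply: intbS hi; rewrite // ltW.
  rewrite /Rintegral; have -> : (\int[mu]_(s in `]a, t]) (h s)%:E =
      \int[mu]_(s in `]a, t]) g s)%E by rewrite gh.
  rewrite -gE// (_ : nu _ = m (`]a, t] `&` `]a, b])%classic)// setIidl.
    by rewrite /m mE// ltW.
  by apply: subset_itvl; rewrite bnd_simp ltW.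
have := prim_derive hi; apply: aeS => t H at_ tb.
have := H at_ tb => dh.
have df : is_derive t 1 f (h t).
  apply: (@near_eq_is_derive _ _ _ (fun s => f a + prim a h s)).
    near=> s; have as_ : a < s by near: s; exact: lt_nbhsr.
    have sb : s < b by near: s; exact: lt_nbhsl.
    by rewrite (fE s).
  by rewrite -[h t]add0r; exact: is_deriveD.
have -> : u = (fun t => f t - L * t) by apply/funext => s; rewrite /f addrAC subrr add0r.
by apply: derivableB => //; apply: derivableM.
Unshelve. all: by end_near. Qed.

End Lipschitz.

(** * Measurability of the derivative *)

Section MeasurableDerivative.
Variable (R : realType).
Implicit Types (f : R -> R) (t r : R).

Definition dquot f r t : R := r^-1 * (f (t + r) - f t).

Lemma continuous_dquot f r : continuous f -> continuous (dquot f r).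
Proof.
move=> cf t; apply: cvgMr; apply: cvgB; last exact: cf.
apply: (@cvg_comp _ _ _ (fun s => s + r) f) (cf _).
by apply: cvgD; [exact: cvg_id|exact: cvg_cst].
Qed.

Lemma dquot_cvg f t : derivable f t 1 ->
  dquot f n.+1%:R^-1 t @[n --> \oo] --> derive1 f t.
Proof.
move=> df; have /is_deriveP H : is_derive t 1 f (derive1 f t).
  by apply: DeriveDef; rewrite // derive1E.
apply/cvgrPdist_le => e e0; have [d d0 Hd] := H e e0.
near=> n; have n0 : 0 < n.+1%:R^-1 :> R by rewrite invr_gt0.
have := Hd (t + n.+1%:R^-1); rewrite [t + _]addrC addrK (gtr0_norm n0) => /(_ _)/wrap[].
  by near: n; exact: near_infty_natSinv_lt (PosNum d0).
set r := _^-1 in n0 * => h.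
rewrite /dquot distrC [t + r]addrC.
have -> : r^-1 * (f (r + t) - f t) - derive1 f t = r^-1 * (f (r + t) - f t - derive1 f t * r).
  by field; rewrite gt_eqF.
by rewrite normrM gtr0_norm ?invr_gt0// mulrC ler_pdivrMr.
Unshelve. all: by end_near. Qed.

(** Points where the difference quotients with small steps oscillate little;
    for continuous [f] each inner set is an intersection of closed sets. *)
Lemma derivable_setE f : continuous f ->
  [set t | derivable f t 1] = \bigcap_(k : nat) \bigcup_(j : nat)
    [set t | forall r r', r != 0 -> r' != 0 -> `|r| < j.+1%:R^-1 ->
      `|r'| < j.+1%:R^-1 -> `|dquot f r t - dquot f r' t| <= k.+1%:R^-1].
Proof.
move=> cf; apply/seteqP; split=> t /= H.
  move=> k _.
  have {}H : is_derive t 1 f (derive1 f t) by apply: DeriveDef; rewrite // derive1E.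
  have k0 : 0 < k.+1%:R^-1 / 2 :> R by rewrite divr_gt0// invr_gt0.
  have [d d0 Hd] := (is_deriveP _ _ _).1 H _ k0.
  have {}Hd r : r != 0 -> `|r| < d -> `|dquot f r t - derive1 f t| <= k.+1%:R^-1 / 2.
    move=> r0 rd; have := Hd (t + r); rewrite [t + r]addrC addrK => /(_ rd) h.
    rewrite /dquot [t + r]addrC.
    have -> : r^-1 * (f (r + t) - f t) - derive1 f t = r^-1 * (f (r + t) - f t - derive1 f t * r).
      by field.
    by rewrite normrM normfV mulrC ler_pdivrMr ?normr_gt0.
  have [j _ jd] : exists2 j : nat, True & j.+1%:R^-1 < d :> R.
    near \oo => j; exists j => //; near: j.
    exact: near_infty_natSinv_lt (PosNum d0).
  exists j => // r r' r0 r'0 rj r'j.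
  have h1 := Hd r r0 (lt_trans rj jd); have h2 := Hd r' r'0 (lt_trans r'j jd).
  rewrite (le_trans (ler_distD (derive1 f t) _ _))// (splitr k.+1%:R^-1) lerD//.
  by rewrite distrC.
pose q n := dquot f n.+1%:R^-1 t.
have cq : cvgn q.
  apply/cauchy_cvgP/cauchyP => _ /posnumP[e].
  near \oo => k.
  have [j _ Hj] := H k I.
  exists (q j.+1).
  change (\forall n \near \oo, ball (q j.+1) e%:num (q n)).
  near=> n; rewrite /ball/=.
  have ke : k.+1%:R^-1 < e%:num by near: k; exact: near_infty_natSinv_lt.
  apply: le_lt_trans ke; apply: (Hj j.+2%:R^-1 n.+1%:R^-1).
  - by rewrite invr_eq0.
  - by rewrite invr_eq0.
  - by rewrite ger0_norm// ltf_pV2 ?posrE// ltr_nat.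
  - rewrite ger0_norm// ltf_pV2 ?posrE// ltr_nat ltnS.
    by near: n; exact: nbhs_infty_gt.
pose l := limn q.
suff : is_derive t 1 f l by case.
apply/is_deriveP => e e0.
near \oo => k.
have ke : k.+1%:R^-1 < e by near: k; exact: near_infty_natSinv_lt (PosNum e0).
have [j _ Hj] := H k I.
exists j.+1%:R^-1; first by rewrite invr_gt0.
move=> s sj; have [->|st] := eqVneq s t.
  by rewrite !subrr mulr0 subrr normr0 mulr0.
have st0 : s - t != 0 by rewrite subr_eq0.
suff h : `|dquot f (s - t) t - l| <= e.
  move: h; rewrite /dquot [t + _]addrC subrK.
  have -> : (s - t)^-1 * (f s - f t) - l = (s - t)^-1 * (f s - f t - l * (s - t)).
    by field.
  by rewrite normrM normfV mulrC ler_pdivrMr ?normr_gt0.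
apply: le_trans (ltW ke).
have cn : `|dquot f (s - t) t - q n| @[n --> \oo] --> `|dquot f (s - t) t - l|.
  by apply: cvg_norm; apply: cvgB => //; exact: cvg_cst.
rewrite -(cvg_lim (@Rhausdorff R) cn); apply: limr_le; first by apply/cvg_ex; eexists; exact: cn.
near=> n; apply: (Hj (s - t) n.+1%:R^-1) => //.
rewrite ger0_norm// ltf_pV2 ?posrE// ltr_nat ltnS.
by near: n; exact: nbhs_infty_gt.
Unshelve. all: by end_near. Qed.

Lemma measurable_derivable f : continuous f -> measurable [set t | derivable f t 1].
Proof.
move=> cf; rewrite derivable_setE//; apply: bigcapT_measurable => k.
apply: bigcupT_measurable => j; apply: closed_measurable.
rewrite (_ : [set t | _] = \bigcap_(p in [set p : R * R |
    [/\ p.1 != 0, p.2 != 0, `|p.1| < j.+1%:R^-1 & `|p.2| < j.+1%:R^-1]])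
    [set t | `|dquot f p.1 t - dquot f p.2 t| <= k.+1%:R^-1]); last first.
  apply/seteqP; split=> t /= H; first by move=> [r r'] /= [? ? ? ?]; exact: H.
  by move=> r r' ? ? ? ?; exact: (H (r, r')).
apply: closed_bigI => -[r r'] _ /=.
apply: (@closed_comp _ _ (fun t => `|dquot f r t - dquot f r' t|)
   [set x | x <= k.+1%:R^-1]); last exact: closed_le.
move=> t _ /=; apply: cvg_norm; apply: cvgB; exact: continuous_dquot.
Qed.

(** The limit of the quotients with step [1 / (n + 1)] on the measurable set
    where [f] is derivable, a constant elsewhere. *)
Lemma measurable_derive1 f : continuous f -> measurable_fun setT (derive1 f).
Proof.
move=> cf; pose D := [set t | derivable f t 1].
have mD : measurable D by exact: measurable_derivable.
(* the value that a limit takes by default when it does not exist *)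
pose c : R := point.
pose g (n : nat) t : R := \1_D t * dquot f n.+1%:R^-1 t + (1 - \1_D t) * c.
apply: (@measurable_fun_cvg _ _ _ setT g).
- move=> n; apply: measurable_funD; apply: measurable_funM.
  + exact: measurable_indic.
  + by apply: continuous_measurable_fun; exact: continuous_dquot.
  + by apply: measurable_funB => //; exact: measurable_indic.
  + exact: measurable_cst.
move=> t _; have [Dt|nDt] := pselect (D t).
  rewrite (_ : g ^~ t = fun n => dquot f n.+1%:R^-1 t); first exact: dquot_cvg.
  by apply/funext => n; rewrite /g indicE mem_set//= mul1r subrr mul0r addr0.
rewrite (_ : g ^~ t = cst (derive1 f t)); first exact: cvg_cst.
apply/funext => n; rewrite /g indicE memNset//= mul0r add0r subr0 mul1r.
by rewrite derive1E; apply/esym; exact: dvgP.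
Qed.

End MeasurableDerivative.

(** * The explicit Euler scheme *)

Section DyadicGrid.
Variable (R : realType).
Implicit Types (t : R) (m j : nat).

Definition step m : R := 2^-1 ^+ m.
(** Negative times fall into the cell [0], so that paths read off the grid are
    constant there. *)
Definition cell m t : nat := Num.truncn (t * 2 ^+ m).

Lemma step_gt0 m : 0 < step m.
Proof. by rewrite exprn_gt0// invr_gt0. Qed.

Lemma stepM2 m : step m * 2 ^+ m = 1.
Proof. by rewrite -exprMn mulVf ?expr1n// pnatr_eq0. Qed.

Lemma stepD m j : step (m + j) * (2 ^ j)%:R = step m.
Proof. by rewrite /step exprD natrX -mulrA stepM2 mulr1. Qed.

Lemma step_le m j : step (m + j) <= step m.
Proof.
by rewrite /step exprD ler_piMr ?(ltW (step_gt0 m))// exprn_ile1 ?invr_ge0// invf_le1 ?ler1n.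
Qed.

Lemma step_small (e : R) : 0 < e -> exists M, forall m, (M <= m)%N -> step m < e.
Proof.
move=> e0; have : (2^-1 : R) ^+ n @[n --> \oo] --> 0.
  by apply: cvg_expr; rewrite ger0_norm ?invr_ge0// invf_lt1 ?ltr1n.
move=> /cvgrPdist_lt /(_ _ e0)[M _ HM]; exists M => m Mm.
have := HM m Mm; by rewrite sub0r normrN ger0_norm// exprn_ge0// invr_ge0.
Qed.

Lemma cell_itv m t : 0 <= t ->
  (cell m t)%:R * step m <= t /\ t < (cell m t)%:R * step m + step m.
Proof.
move=> t0; have := @truncn_itv _ (t * 2 ^+ m); rewrite mulr_ge0 ?exprn_ge0//.
move=> /(_ isT)/andP[h1 h2]; have s0 := step_gt0 m.
rewrite -(ler_pM2r s0) -mulrA [2 ^+ m * _]mulrC stepM2 mulr1 in h1.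
rewrite -(ltr_pM2r s0) -mulrA [2 ^+ m * _]mulrC stepM2 mulr1 -natr1 mulrDl mul1r in h2.
by [].
Qed.

Lemma cell_neg m t : t <= 0 -> cell m t = 0%N.
Proof.
move=> t0; apply/truncn0Pn; rewrite -ltNge (@le_lt_trans _ _ 0)//.
by rewrite mulr_le0_ge0// exprn_ge0.
Qed.

Lemma cell_le m s t : s <= t -> (cell m s <= cell m t)%N.
Proof. by move=> st; apply: le_truncn; rewrite ler_wpM2r// exprn_ge0. Qed.

Lemma cell_coarse m j t : (cell (m + j) t %/ 2 ^ j)%N = cell m t.
Proof.
have [t0|t0] := leP 0 t; last by rewrite !cell_neg ?div0n// ltW.
have [h1 h2] := cell_itv (m + j) t0; set k := cell (m + j) t in h1 h2 *.
apply/esym/truncn_def; have s0 := step_gt0 m; have sj0 := step_gt0 (m + j).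
rewrite -(ler_pM2r s0) -(ltr_pM2r s0) -mulrA [2 ^+ m * _]mulrC stepM2 mulr1.
rewrite -(stepD m j) !mulrA ![_ * step (m + j) * _]mulrAC -!natrM; apply/andP; split.
  by apply: le_trans h1; rewrite ler_pM2r// ler_nat leq_divM.
apply: (lt_le_trans h2); rewrite -[X in _ + X]mul1r -mulrDl natr1 ler_pM2r//.
by rewrite ler_nat ltn_ceil// expn_gt0.
Qed.

Lemma cell_dist m s t : s <= t ->
  (cell m t - cell m s)%:R * step m <= t - s + step m.
Proof.
move=> st; have s0 := step_gt0 m.
have [t0|t0] := leP 0 t; last first.
  by rewrite (cell_neg m (ltW t0)) sub0n mul0r addr_ge0 ?(ltW s0)// subr_ge0.
have [h1 _] := cell_itv m t0.
rewrite natrB ?cell_le// mulrBl.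
have [s1|s1] := leP 0 s.
  by have [_ h2] := cell_itv m s1; lra.
by rewrite (cell_neg m (ltW s1)) mul0r; lra.
Qed.

End DyadicGrid.

Lemma cvg_l2norm (R : realType) (V : finType) (I : Type) (F : set_system I)
    {FF : Filter F} (f : I -> V -> R) (l : V -> R) :
  (forall v, (fun i => f i v) @ F --> l v) ->
  forall e, 0 < e -> \forall i \near F, l2norm (f i - l) <= e.
Proof.
move=> fl e e0.
have e1 : 0 < e / (#|V|%:R + 1) by rewrite divr_gt0// ltr_wpDl.
have : \forall i \near F, forall v, `|l v - f i v| <= e / (#|V|%:R + 1).
  by apply: filter_forall => v; move/cvgrPdist_le : (fl v) => /(_ _ e1).
apply: filterS => i H; rewrite l2normB; apply: l2norm_le_coord => // v; exact: H.
Qed.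

Section Euler.
Variables (R : realType) (V : finType).
Variables (psi : (V -> R) -> R) (zeta : (V -> R) -> (V -> R)) (L : R).
Hypothesis zetaP : forall x, subdifferential psi x (zeta x).
Hypothesis zeta_le : forall x, l2norm (zeta x) <= L.
Variables (H : R -> V -> R) (x0 : V -> R).
Hypothesis H_unif : forall e : R, 0 < e -> exists2 d : R, 0 < d &
  forall s t : R, `|t - s| < d -> l2norm (H t - H s) <= e.

Let L0 : 0 <= L. Proof. exact: le_trans (l2norm_ge0 _) (zeta_le x0). Qed.

Lemma psi_lipschitz x y : psi x - psi y <= L * l2norm (x - y).
Proof.
have := zetaP x y; have := dotV_le (zeta x) (x - y).
have : l2norm (zeta x) * l2norm (x - y) <= L * l2norm (x - y).
  by rewrite ler_wpM2r// l2norm_ge0.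
by rewrite !dotVBr; lra.
Qed.

(** The scheme approximates [u = x - H], where [H] is a primitive of the forcing
    term: the increments of [u] are then bounded although the forcing is only
    integrable. *)
Fixpoint euler m k : V -> R :=
  if k is k'.+1 then
    euler m k' - step R m *: zeta (euler m k' + H (k'%:R * step R m))
  else x0.

Definition eslope m k := zeta (euler m k + H (k%:R * step R m)).

Lemma eulerS m k : euler m k.+1 = euler m k - step R m *: eslope m k.
Proof. by []. Qed.

Lemma euler_lip m k l : (l <= k)%N ->
  l2norm (euler m k - euler m l) <= L * ((k - l)%:R * step R m).
Proof.
move=> /subnK <-; rewrite addnK; elim: (k - l)%N => {k} [|k IH].
  by rewrite add0n subrr l2norm0 mul0r mulr0.
rewrite addSn eulerS addrAC (le_trans (l2normD _ _))// l2normN l2normZ.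
rewrite gtr0_norm ?step_gt0// -natr1 mulrDl mul1r mulrDr lerD//.
by rewrite mulrC ler_wpM2r ?zeta_le// ltW// step_gt0.
Qed.

(** The polygonal interpolation of the coarse scheme, read on the finer grid. *)
Definition refine m j k : V -> R :=
  euler m (k %/ 2 ^ j) - ((k %% 2 ^ j)%:R * step R (m + j)) *: eslope m (k %/ 2 ^ j).

Lemma refineS m j k :
  refine m j k.+1 = refine m j k - step R (m + j) *: eslope m (k %/ 2 ^ j).
Proof.
have j0 : (0 < 2 ^ j)%N by rewrite expn_gt0.
rewrite /refine.
have [h|h] := ltnP (k %% 2 ^ j).+1 (2 ^ j).
  have hk : (k.+1 %/ 2 ^ j = k %/ 2 ^ j)%N.
    by rewrite {1}(divn_eq k (2 ^ j)) -addnS divnMDl// (divn_small h) addn0.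
  have hr : (k.+1 %% 2 ^ j = (k %% 2 ^ j).+1)%N.
    by rewrite {1}(divn_eq k (2 ^ j)) -addnS modnMDl (modn_small h).
  by rewrite hk hr -natr1 mulrDl mul1r scalerDl opprD addrA.
have hr1 : (k %% 2 ^ j).+1 = (2 ^ j)%N.
  by apply/eqP; rewrite eqn_leq h andbT ltn_mod.
have hk1 : k.+1 = ((k %/ 2 ^ j).+1 * 2 ^ j)%N.
  by rewrite {1}(divn_eq k (2 ^ j)) -addnS hr1 mulSn addnC.
have hk : (k.+1 %/ 2 ^ j = (k %/ 2 ^ j).+1)%N by rewrite hk1 mulnK.
have hr : (k.+1 %% 2 ^ j = 0)%N by rewrite hk1 modnMl.
have hs : step R m = (k %% 2 ^ j)%:R * step R (m + j) + step R (m + j).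
  by rewrite -(stepD R m j) -[in LHS]hr1 -natr1 mulrDr mulr1 [in LHS]mulrC.
by rewrite hk hr mul0r scale0r subr0 eulerS {1}hs scalerDl opprD addrA.
Qed.

(** The two schemes separate slowly: on each fine step, monotonicity of the
    subdifferential leaves only the error made by evaluating the slopes at
    points off the interpolated curves. *)
Lemma euler_cauchy m j k w : 0 <= w ->
  (forall s t : R, `|t - s| <= step R m -> l2norm (H t - H s) <= w) ->
  l2norm (refine m j k - euler (m + j) k) ^+ 2 <=
    k%:R * step R (m + j) * (8 * L ^+ 2 * step R m + 4 * L * w).
Proof.
move=> w0 Hw; set S := step R (m + j).
have S0 : 0 < S := step_gt0 R (m + j).
have SS : S <= step R m := step_le R m j.
have s0 := step_gt0 R m.
elim: k => [|k IH].
  rewrite /refine div0n mod0n /= mul0r scale0r subr0 subrr l2norm0 expr0n.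
  by rewrite !mul0r.
rewrite refineS eulerS -/S.
set z1 := eslope m _; set z2 := eslope (m + j) k.
set d := refine m j k - euler (m + j) k.
have -> : refine m j k - S *: z1 - (euler (m + j) k - S *: z2) = d - S *: (z1 - z2).
  by apply/funext => v; rewrite /d !fctE; ring.
set q := (k %/ 2 ^ j)%N in z1 *.
pose xi1 := euler m q + H (q%:R * step R m).
pose xi2 := euler (m + j) k + H (k%:R * S).
have mono : 0 <= dotV (z1 - z2) (xi1 - xi2) by apply: subdifferential_monotone; exact: zetaP.
have j0 : (0 < 2 ^ j)%N by rewrite expn_gt0.
have qk : k%:R * S - q%:R * step R m = (k %% 2 ^ j)%:R * S.
  rewrite {1}(divn_eq k (2 ^ j)) natrD mulrDl natrM -/q -(stepD R m j) -/S; ring.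
have rS : (k %% 2 ^ j)%:R * S <= step R m.
  by rewrite -(stepD R m j) mulrC ler_wpM2l ?(ltW S0)// ler_nat ltnW// ltn_mod.
have erE : d = (xi1 - xi2) + ((refine m j k - euler m q) + (H (k%:R * S) - H (q%:R * step R m))).
  by apply/funext => v; rewrite /d /xi1 /xi2 !fctE; ring.
have h1 : l2norm (refine m j k - euler m q) <= L * step R m.
  rewrite /refine -/q addrAC subrr add0r l2normN l2normZ ger0_norm; last first.
    by rewrite mulr_ge0// ltW.
  rewrite mulrC ler_pM// ?l2norm_ge0 ?zeta_le//.
  by rewrite mulr_ge0// ltW.
have h2 : l2norm (H (k%:R * S) - H (q%:R * step R m)) <= w.
  by apply: Hw; rewrite qk ger0_norm// mulr_ge0// ltW.
have z12 : l2norm (z1 - z2) <= 2 * L.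
  rewrite (le_trans (l2normD _ _))// l2normN mulrC mulr_natr mulr2n.
  by rewrite lerD// zeta_le.
have z0 := l2norm_ge0 (z1 - z2).
set E := (refine m j k - euler m q) + _ in erE.
have EE : l2norm E <= L * step R m + w by rewrite (le_trans (l2normD _ _))// lerD.
have hd : - dotV (z1 - z2) d <= 2 * L * (L * step R m + w).
  rewrite erE dotVDr opprD.
  have : - dotV (z1 - z2) E <= 2 * L * (L * step R m + w).
    rewrite -dotVNr (le_trans (dotV_le _ _))// l2normN ler_pM// l2norm_ge0//.
  lra.
have := hd; rewrite -(ler_pM2l S0) => {}hd.
rewrite sqr_l2normB dotVZr l2normZ exprMn ger0_norm ?(ltW S0)// dotVC.
have hz : l2norm (z1 - z2) ^+ 2 <= 4 * L ^+ 2.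
  by rewrite (_ : 4 * L ^+ 2 = (2 * L) ^+ 2); [rewrite ler_sqr ?nnegrE ?mulr_ge0|ring].
have hz2 : S ^+ 2 * l2norm (z1 - z2) ^+ 2 <= S * step R m * (4 * L ^+ 2).
  by rewrite ler_pM ?sqr_ge0// expr2 ler_pM2l.
rewrite -[k.+1%:R]natr1 -/d in IH *.
have -> : (k%:R + 1) * S * (8 * L ^+ 2 * step R m + 4 * L * w) =
  k%:R * S * (8 * L ^+ 2 * step R m + 4 * L * w) +
  2 * (S * (2 * L * (L * step R m + w))) + S * step R m * (4 * L ^+ 2) by ring.
move: IH hd hz2; move: (l2norm d ^+ 2) (dotV (z1 - z2) d) (l2norm (z1 - z2) ^+ 2).
by move=> A B C; lra.
Qed.

Definition euler_path m (t : R) := euler m (cell m t).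

Lemma euler_path_cauchy (T e : R) : 0 < e -> exists M, forall m j t,
  (M <= m)%N -> t <= T -> l2norm (euler_path m t - euler_path (m + j) t) <= e.
Proof.
move=> e0; pose T' := `|T| + 1; have T'0 : 0 < T' by rewrite ltr_wpDl.
pose w := e ^+ 2 / (32 * (L + 1) * T').
have L1 : 0 < L + 1 by rewrite ltr_wpDl.
have w0 : 0 < w by rewrite divr_gt0 ?exprn_gt0// !mulr_gt0.
have [d d0 Hd] := H_unif w0.
pose c := Num.min (e / (2 * (L + 1))) (e ^+ 2 / (64 * (L + 1) ^+ 2 * T')).
have c0 : 0 < c.
  by rewrite lt_min !divr_gt0 ?exprn_gt0// !mulr_gt0// exprn_gt0.
have [M1 HM1] := step_small d0; have [M2 HM2] := step_small c0.
exists (maxn M1 M2) => m j t; rewrite geq_max => /andP[m1 m2] tT.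
have {}HM1 := HM1 m m1; have {}HM2 := HM2 m m2.
have s0 := step_gt0 R m.
have Hw s t' : `|t' - s| <= step R m -> l2norm (H t' - H s) <= w.
  by move=> h; apply: Hd; exact: le_lt_trans HM1.
move: HM2; rewrite lt_min => /andP[c1 c2].
set k := cell (m + j) t.
have kT : k%:R * step R (m + j) <= T'.
  have [t0|t0] := leP 0 t.
    have [h _] := cell_itv (m + j) t0; have := ler_norm T; rewrite /T' -/k in h *; lra.
  by rewrite /k cell_neg ?mul0r ltW.
have E := euler_cauchy j k (ltW w0) Hw.
have h1 : l2norm (euler_path m t - refine m j k) <= e / 2.
  rewrite /refine cell_coarse /euler_path opprB addrCA subrr addr0 l2normZ.
  rewrite ger0_norm ?mulr_ge0 ?(ltW (step_gt0 _ _))//.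
  apply: (@le_trans _ _ (step R m * (L + 1))).
    rewrite ler_pM ?mulr_ge0 ?l2norm_ge0 ?(ltW (step_gt0 _ _))//.
      rewrite -(stepD R m j) mulrC ler_wpM2l ?(ltW (step_gt0 _ _))// ler_nat ltnW// ltn_mod.
      by rewrite expn_gt0.
    by rewrite (le_trans (zeta_le _))// lerDl.
  by rewrite -ler_pdivlMr// -mulrA -invfM ltW.
have h2 : l2norm (refine m j k - euler_path (m + j) t) <= e / 2.
  rewrite -ler_sqr ?nnegrE ?l2norm_ge0 ?divr_ge0 ?(ltW e0)// /euler_path -/k.
  apply: (le_trans E).
  have LL : L ^+ 2 <= (L + 1) ^+ 2 by rewrite ler_sqr ?nnegrE ?(ltW L1)// lerDl.
  have q0 : 0 <= 8 * L ^+ 2 * step R m + 4 * L * w.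
    by have := mulr_ge0 (sqr_ge0 L) (ltW s0); have := mulr_ge0 L0 (ltW w0); lra.
  apply: (@le_trans _ _ (T' * (8 * (L + 1) ^+ 2 * step R m + 4 * (L + 1) * w))).
    apply: (@le_trans _ _ (T' * (8 * L ^+ 2 * step R m + 4 * L * w))).
      by rewrite ler_wpM2r.
    rewrite ler_pM2l// lerD//.
      by rewrite ler_pM2r// ler_pM2l.
    by rewrite ler_pM2r// ler_pM2l// lerDl.
  have -> : (e / 2) ^+ 2 = e ^+ 2 / 8 + e ^+ 2 / 8 by field.
  rewrite mulrDr lerD//.
    apply: (@le_trans _ _ (T' * (8 * (L + 1) ^+ 2 * (e ^+ 2 / (64 * (L + 1) ^+ 2 * T'))))).
      by rewrite ler_pM2l// ler_pM2l ?(ltW c2)// mulr_gt0// exprn_gt0.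
    have -> : T' * (8 * (L + 1) ^+ 2 * (e ^+ 2 / (64 * (L + 1) ^+ 2 * T'))) = e ^+ 2 / 8.
      by field; rewrite !gt_eqF.
    by [].
  rewrite /w.
  have -> : T' * (4 * (L + 1) * (e ^+ 2 / (32 * (L + 1) * T'))) = e ^+ 2 / 8.
    by field; rewrite !gt_eqF.
  by [].
by rewrite (le_trans (l2norm_triangle (refine m j k) _ _))// (splitr e) lerD.
Qed.

Definition flow (t : R) (v : V) : R := limn (fun m => euler_path m t v).

Lemma euler_path_cvg t v : (fun m => euler_path m t v) @ \oo --> flow t v.
Proof.
apply/cauchy_cvgP/cauchyP => _ /posnumP[e].
have [M HM] := euler_path_cauchy t (gt0 e).
have [M' HM'] : exists M', forall j, l2norm (euler_path M' t - euler_path (M' + j) t) < e%:num.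
  have e2 : 0 < e%:num / 2 by [].
  have [M' HM'] := euler_path_cauchy t e2; exists M' => j.
  by rewrite (le_lt_trans (HM' _ _ _ (leqnn _) (lexx _)))// gtr_pMr// invf_lt1 ?ltr1n.
exists (euler_path M' t v).
exists M' => // m /= Mm; rewrite /ball/=.
rewrite (le_lt_trans (normr_le_l2norm (euler_path M' t - euler_path m t) v))//.
by have := HM' (m - M')%N; rewrite subnKC.
Qed.

Lemma euler_path_unif (T e : R) : 0 < e -> exists M, forall m t,
  (M <= m)%N -> t <= T -> l2norm (euler_path m t - flow t) <= e.
Proof.
move=> e0; have e2 : 0 < e / 2 by rewrite divr_gt0.
have [M HM] := euler_path_cauchy T e2; exists M => m t Mm tT.
have [N _ HN] := cvg_l2norm (fun v => @euler_path_cvg t v) e2.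
rewrite (le_trans (l2norm_triangle (euler_path (m + N) t) _ _))// (splitr e) lerD//.
  exact: HM.
by apply: HN => /=; rewrite leq_addl.
Qed.

Lemma flow0 t : t <= 0 -> flow t = x0.
Proof.
move=> t0; apply/funext => v; apply: cvg_lim => //.
rewrite (_ : (fun m => _) = cst (x0 v)); first exact: cvg_cst.
by apply/funext => m; rewrite /euler_path cell_neg.
Qed.

Lemma flow_lipschitz s t : l2norm (flow t - flow s) <= L * `|t - s|.
Proof.
wlog st : s t / s <= t => [W|].
  have [/W//|/ltW/W] := leP s t.
  by rewrite l2normB distrC.
rewrite ger0_norm ?subr_ge0//; apply/ler_addgt0Pr => e e0.
have e3 : 0 < e / 3 by rewrite divr_gt0.
have [M HM] := euler_path_unif t e3.
have d0 : 0 < e / (3 * (L + 1)) by rewrite divr_gt0// mulr_gt0// ltr_wpDl.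
have [M' HM'] := step_small d0.
pose m := maxn M M'.
have h1 := HM m t (leq_maxl _ _) (lexx _).
have h2 := HM m s (leq_maxl _ _) st.
have h3 := euler_lip m (cell_le m st).
have h4 := cell_dist m st.
have h5 := HM' m (leq_maxr _ _).
have h6 : L * step R m <= e / 3.
  apply: (@le_trans _ _ ((L + 1) * (e / (3 * (L + 1))))).
    by rewrite ler_pM ?(ltW h5) ?lerDl// ltW// step_gt0.
  by rewrite le_eqVlt; apply/orP; left; apply/eqP; field; rewrite gt_eqF// ltr_wpDl.
have h7 : L * ((cell m t - cell m s)%:R * step R m) <= L * (t - s) + L * step R m.
  by rewrite -mulrDr ler_wpM2l.
have h8 := l2norm_triangle (euler_path m t) (flow t) (flow s).
have h9 := l2norm_triangle (euler_path m s) (euler_path m t) (flow s).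
rewrite l2normB in h1.
have -> : e = e / 3 + e / 3 + e / 3 by field.
rewrite /euler_path in h1 h2 h3 h8 h9 *; lra.
Qed.

(** The subgradient inequalities of [n] consecutive steps, all taken within [eta]
    of [x], add up. *)
Lemma euler_increment m k n x y (eta : R) : 0 <= eta ->
  (forall i, (i < n)%N ->
    l2norm (euler m (k + i) + H ((k + i)%:R * step R m) - x) <= eta) ->
  n%:R * step R m * (psi x - psi y - 2 * L * eta) <=
    dotV (euler m (k + n) - euler m k) (y - x).
Proof.
move=> eta0; elim: n => [_|n IH Hn].
  by rewrite addn0 subrr dotV0l !mul0r.
rewrite addnS eulerS [X in dotV X _]addrAC dotVBl dotVZl.
have {}IH := IH (fun i (h : (i < n)%N) => Hn i (ltnW h)).
set xi := euler m (k + n) + H ((k + n)%:R * step R m).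
have xix : l2norm (xi - x) <= eta by exact: Hn.
have s0 := step_gt0 R m.
have h1 := zetaP xi y; rewrite -/(eslope m (k + n)) in h1.
have h2 := psi_lipschitz x xi; rewrite l2normB in h2.
have h3 : L * l2norm (xi - x) <= L * eta by rewrite ler_wpM2l.
have h4 : dotV (eslope m (k + n)) (xi - x) <= L * eta.
  by rewrite (le_trans (dotV_le _ _))// ler_pM ?l2norm_ge0// zeta_le.
have h5 : psi x - psi y - 2 * L * eta <= - dotV (eslope m (k + n)) (y - x).
  by rewrite !dotVBr in h1 h4 *; rewrite -/(eslope m (k + n)) in h1; lra.
have {}h5 : step R m * (psi x - psi y - 2 * L * eta) <=
    step R m * - dotV (eslope m (k + n)) (y - x) by rewrite ler_pM2l.
by rewrite -[n.+1%:R]natr1; lra.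
Qed.

(** Passage to the limit in [euler_increment]: for [b] close to [t] all steps
    between [t] and [b] are evaluated near [x]. *)
Lemma flow_increment t b x y (e : R) : 0 <= t -> t < b -> x = flow t + H t ->
  0 < e -> b - t < e / (2 * (L + 1)) ->
  (forall s, `|s - t| <= b - t -> l2norm (H s - H t) <= e) ->
  (b - t) * (psi x - psi y - 6 * L * e) <= dotV (flow b - flow t) (y - x).
Proof.
move=> t0 tb xE e0 bt He; have L1 : 0 < L + 1 by rewrite ltr_wpDl.
set Q := psi x - psi y - 6 * L * e; set Y := l2norm (y - x).
have Y0 : 0 <= Y := l2norm_ge0 _.
apply/ler_addgt0Pr => eps eps0.
have W0 : 0 < 2 * Y + `|Q| + 1 by rewrite ltr_wpDl// addr_ge0// mulr_ge0.
pose rho := Num.min e (eps / (2 * Y + `|Q| + 1)).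
have rho0 : 0 < rho by rewrite lt_min e0 divr_gt0.
have [M1 HM1] := euler_path_unif b rho0.
have c0 : 0 < Num.min rho (Num.min (b - t) (e / (2 * (L + 1)))).
  by rewrite lt_min rho0 lt_min subr_gt0 tb divr_gt0// mulr_gt0.
have [M2 HM2] := step_small c0.
pose m := maxn M1 M2.
have hb := HM1 m b (leq_maxl _ _) (lexx _).
have ht := HM1 m t (leq_maxl _ _) (ltW tb).
have := HM2 m (leq_maxr _ _); rewrite lt_min => /andP[s1]; rewrite lt_min => /andP[s2 s3].
have s0 := step_gt0 R m.
have [k1 k2] := cell_itv m t0.
have [l1 l2] := cell_itv m (le_trans t0 (ltW tb)).
have kl := cell_le m (ltW tb).
set k := cell m t in k1 k2 kl *; set n := (cell m b - k)%N.
have kn : cell m b = (k + n)%N by rewrite /n subnKC.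
rewrite kn natrD mulrDl in l1 l2.
have rhoe : rho <= e by rewrite ge_min lexx.
have := @euler_increment m k n x y (3 * e) => /(_ _ _)/wrap[].
- by rewrite mulr_ge0// ltW.
- move=> i ni; rewrite xE.
  have h1 := euler_lip m (leq_addr i k); rewrite addKn in h1.
  have inR : i%:R * step R m <= n%:R * step R m by rewrite ler_pM2r// ler_nat ltnW.
  have h2 : L * (i%:R * step R m) <= e.
    apply: (@le_trans _ _ ((L + 1) * (b - t + step R m))).
      by rewrite ler_pM ?lerDl// ?mulr_ge0// ?(ltW s0)//; lra.
    apply: (@le_trans _ _ ((L + 1) * (e / (2 * (L + 1)) + e / (2 * (L + 1))))).
      by rewrite ler_pM2l// lerD// ltW.
    by rewrite le_eqVlt; apply/orP; left; apply/eqP; field; rewrite gt_eqF.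
  have h3 : l2norm (H ((k + i)%:R * step R m) - H t) <= e.
    apply: He; rewrite natrD mulrDl ler_norml; apply/andP; split.
      have : 0 <= i%:R * step R m by rewrite mulr_ge0// ltW.
      lra.
    lra.
  have -> : euler m (k + i) + H ((k + i)%:R * step R m) - (flow t + H t) =
    (euler m (k + i) - flow t) + (H ((k + i)%:R * step R m) - H t).
    by apply/funext => v; rewrite !fctE; ring.
  have h4 := l2normD (euler m (k + i) - flow t) (H ((k + i)%:R * step R m) - H t).
  have h5 := l2norm_triangle (euler m k) (euler m (k + i)) (flow t).
  rewrite /euler_path -/k in ht; lra.
rewrite (_ : 2 * L * (3 * e) = 6 * L * e) -/Q => [h|]; last by ring.
have h1 : (b - t) * Q <= n%:R * step R m * Q + rho * `|Q|.
  rewrite -lerBlDl -mulrBl (le_trans (ler_norm _))// normrM ler_wpM2r//.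
  by rewrite ler_norml; apply/andP; split; lra.
have h2 : dotV (euler m (k + n) - euler m k) (y - x) <=
    dotV (flow b - flow t) (y - x) + 2 * rho * Y.
  rewrite -lerBlDl -dotVBl (le_trans (dotV_le _ _))// ler_wpM2r//.
  have -> : euler m (k + n) - euler m k - (flow b - flow t) =
    (euler_path m b - flow b) - (euler_path m t - flow t).
    by rewrite /euler_path kn; apply/funext => v; rewrite !fctE; ring.
  by rewrite (le_trans (l2normD _ _))// l2normN mulrC mulr_natr mulr2n lerD.
have h3 : rho * `|Q| + 2 * rho * Y <= eps.
  apply: (@le_trans _ _ (rho * (2 * Y + `|Q| + 1))); first by lra.
  by rewrite -ler_pdivlMr// ge_min lexx orbT.
lra.
Qed.

(** In the limit the flow moves by a negative subgradient wherever it has a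
    right derivative: the discrete increments are averages of subgradients
    taken at nearby points. *)
Lemma flow_subgradient t (D : V -> R) : 0 <= t ->
  (forall e : R, 0 < e -> exists2 d : R, 0 < d & forall b, t < b -> b < t + d ->
    l2norm (flow b - flow t - (b - t) *: D) <= e * (b - t)) ->
  subdifferential psi (flow t + H t) (- D).
Proof.
move=> t0 dD y; set x := flow t + H t.
rewrite dotVNl lerBlDr; apply/ler_addgt0Pr => eps eps0.
have L1 : 0 < L + 1 by rewrite ltr_wpDl.
set Y := l2norm (y - x); have Y0 : 0 <= Y := l2norm_ge0 _.
have W0 : 0 < 6 * L + Y + 1 by rewrite ltr_wpDl// addr_ge0// mulr_ge0.
pose e := eps / (6 * L + Y + 1); have e0 : 0 < e by rewrite divr_gt0.
have [d1 d10 Hd1] := dD e e0.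
have [d2 d20 Hd2] := H_unif e0.
have c0 : 0 < e / (2 * (L + 1)) by rewrite divr_gt0// mulr_gt0.
pose d := Num.min d1 (Num.min d2 (e / (2 * (L + 1)))).
have d0 : 0 < d by rewrite !lt_min d10 d20.
pose b := t + d / 2; have tb : t < b by rewrite ltrDl divr_gt0.
have : b - t < d by rewrite /b; lra.
rewrite !lt_min => /and3P[b1 b2 b3].
have h1 := Hd1 b tb; have {}h1 : l2norm (flow b - flow t - (b - t) *: D) <= e * (b - t).
  by apply: h1; lra.
have h2 := @flow_increment t b x y e t0 tb erefl e0 b3.
have {}h2 : (b - t) * (psi x - psi y - 6 * L * e) <= dotV (flow b - flow t) (y - x).
  by apply: h2 => s st; apply: Hd2; exact: le_lt_trans b2.
have h3 := dotV_le (flow b - flow t - (b - t) *: D) (y - x).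
rewrite dotVBl dotVZl in h3.
have h4 : l2norm (flow b - flow t - (b - t) *: D) * l2norm (y - x) <= e * (b - t) * Y.
  by rewrite ler_wpM2r.
have bt : 0 < b - t by rewrite subr_gt0.
have h5 : (b - t) * (psi x - psi y - 6 * L * e) <= (b - t) * (dotV D (y - x) + e * Y).
  by lra.
rewrite ler_pM2l// in h5.
have : e * (6 * L + Y + 1) = eps by rewrite /e divfK// gt_eqF.
lra.
Qed.

End Euler.

(** * Solutions of subdifferential inclusions *)

Section VectorCalculus.
Variables (R : realType) (V : finType).
Implicit Types (x y : R -> V -> R) (t a b : R).

Lemma is_derive_vec x t : derivable_vec x t ->
  forall v, is_derive t 1 (fun s => x s v) (derive_vec x t v).
Proof. by move=> dx v; apply: DeriveDef; [exact: dx|rewrite /derive_vec derive1E]. Qed.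

Lemma derive_vecE x t (D : V -> R) :
  (forall v, is_derive t 1 (fun s => x s v) (D v)) ->
  derivable_vec x t /\ derive_vec x t = D.
Proof.
move=> H; split=> [v|]; first by case: (H v).
by apply/funext => v; rewrite /derive_vec derive1E; case: (H v).
Qed.

Lemma is_derive_bigsum (I : Type) (r : seq I) (f : I -> R -> R) (df : I -> R) t :
  (forall i, is_derive t 1 (f i) (df i)) ->
  is_derive t 1 (fun s => \sum_(i <- r) f i s) (\sum_(i <- r) df i).
Proof.
move=> H; elim: r => [|i r IH].
  rewrite big_nil (_ : (fun s => _) = cst 0); first exact: is_derive_cst.
  by apply/funext => s; rewrite big_nil.
rewrite big_cons (_ : (fun s => _) = (fun s => f i s + \sum_(j <- r) f j s)).
  by have := H i => ?; exact: is_deriveD.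
by apply/funext => s; rewrite big_cons.
Qed.

Lemma is_deriveM_fun (f g : R -> R) t (df dg : R) :
  is_derive t 1 f df -> is_derive t 1 g dg ->
  is_derive t 1 (fun s => f s * g s) (df * g t + f t * dg).
Proof.
move=> Hf Hg.
have -> : df * g t + f t * dg = f t *: dg + g t *: df.
  by rewrite /GRing.scale/=; ring.
exact: is_deriveM.
Qed.

Lemma is_derive_sqrt_fun (f : R -> R) t (df : R) : 0 < f t -> is_derive t 1 f df ->
  is_derive t 1 (fun s => Num.sqrt (f s)) (df / (2 * Num.sqrt (f t))).
Proof.
move=> f0 Hf; have Hs := is_derive1_sqrt f0.
rewrite mulrC; exact: is_derive1_comp.
Qed.

Lemma is_derive_dotV x y t (dx dy : V -> R) :
  (forall v, is_derive t 1 (fun s => x s v) (dx v)) ->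
  (forall v, is_derive t 1 (fun s => y s v) (dy v)) ->
  is_derive t 1 (fun s => dotV (x s) (y s)) (dotV dx (y t) + dotV (x t) dy).
Proof.
move=> Hx Hy; rewrite /dotV -big_split/=; apply: is_derive_bigsum => v.
exact: is_deriveM_fun.
Qed.

Lemma ac_dotV a b x y : abs_continuous (@l2norm R V) a b x ->
  abs_continuous (@l2norm R V) a b y -> acR a b (fun t => dotV (x t) (y t)).
Proof.
by move=> /ac_vec acx /ac_vec acy; apply: ac_sum => v; apply: acM.
Qed.

Lemma acB_vec a b x y : abs_continuous (@l2norm R V) a b x ->
  abs_continuous (@l2norm R V) a b y ->
  abs_continuous (@l2norm R V) a b (fun t => x t - y t).
Proof.
by move=> /ac_vec acx /ac_vec acy; apply/ac_vec => v; apply: acB.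
Qed.

Lemma ac_sqrt a b (f : R -> R) (c : R) : 0 < c -> (forall t, c <= f t) ->
  acR a b f -> acR a b (fun t => Num.sqrt (f t)).
Proof.
move=> c0 cf acf; have C0 : 0 < Num.sqrt c by rewrite sqrtr_gt0.
apply: (@ac_dom1 _ _ _ _ _ a b _ _ (Num.sqrt c)^-1) acf _ => [|s t _ _ _].
  by rewrite invr_ge0 ltW.
have ft : 0 <= f t by rewrite (le_trans (ltW c0)).
have fs : 0 <= f s by rewrite (le_trans (ltW c0)).
have -> : f t - f s = (Num.sqrt (f t) - Num.sqrt (f s)) * (Num.sqrt (f t) + Num.sqrt (f s)).
  by rewrite -subr_sqr !sqr_sqrtr.
rewrite normrM mulrCA ler_peMr// mulrC ler_pdivlMr// mul1r ger0_norm.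
  by rewrite (le_trans (ler_wsqrtr (cf t)))// lerDl sqrtr_ge0.
by rewrite addr_ge0// sqrtr_ge0.
Qed.

End VectorCalculus.

Section Solutions.
Variables (R : realType) (V : finType).
Notation mu := (@lebesgue_measure R).
Variable phi : (V -> R) -> R.
Implicit Types (x y h k : R -> V -> R) (a b t : R).

(** Stated on an arbitrary interval, so that solutions can be restricted,
    translated in time and compared with constant ones. *)
Definition strong_solution a b h x :=
  abs_continuous (@l2norm R V) a b x /\
  {ae mu, forall t, a < t -> t < b -> derivable_vec x t /\
    subdifferential phi (x t) (h t - derive_vec x t)}.

Lemma strong_solutionS a b a' b' h x : a <= a' -> b' <= b ->
  strong_solution a b h x -> strong_solution a' b' h x.
Proof.
move=> aa bb [acx aex]; split; first exact: acS acx.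
apply: aeS aex => t H at_ tb; apply: H; first exact: le_lt_trans at_.
exact: lt_le_trans bb.
Qed.

Lemma strong_solution_cst a b (y z : V -> R) : subdifferential phi y z ->
  strong_solution a b (fun=> z) (fun=> y).
Proof.
move=> yz; split.
  by apply/ac_vec => v; exact: ac_cst.
apply: aeW => t _ _.
have [dy ->] : derivable_vec (fun=> y) t /\ derive_vec (fun=> y) t = 0.
  by apply: derive_vecE => v; exact: is_derive_cst.
by rewrite subr0.
Qed.

(** Monotonicity makes [|x - y|^2 / 2] grow at rate at most [|h - k| |x - y|].
    The norm is regularised to [sqrt (|x - y|^2 + e^2)] so as to be
    differentiable where [x] and [y] meet. *)
Theorem contraction a b h k x y : a <= b ->
  strong_solution a b h x -> strong_solution a b k y ->
  intb a b (fun s => l2norm (h s - k s)) ->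
  l2norm (x b - y b) <= l2norm (x a - y a) + prim a (fun s => l2norm (h s - k s)) b.
Proof.
move=> ab [acx aex] [acy aey] hki; set g := fun s => l2norm (h s - k s).
apply/ler_addgt0Pr => e e0.
pose d t := x t - y t.
pose N t := dotV (d t) (d t) + e ^+ 2.
have e20 : 0 < e ^+ 2 by rewrite exprn_gt0.
have Ne t : e ^+ 2 <= N t by rewrite lerDr dotV_ge0.
have N0 t : 0 < N t by rewrite (lt_le_trans e20).
have acd : abs_continuous (@l2norm R V) a b d by exact: acB_vec.
have acN : acR a b (fun t => Num.sqrt (N t)).
  by apply: (ac_sqrt e20 Ne); apply: acD (ac_cst _ _ _); exact: ac_dotV.
pose F t := Num.sqrt (N t) - prim a g t.
have : F b <= F a.
  apply: ac_nonincreasing => //; first by apply: acB => //; exact: prim_ac.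
  have := prim_derive hki; rewrite -/g.
  apply: aeS2 (aeS2 _ aex aey) => [t H1 H2 at_ tb|t H1 H2]; last exact: (conj H1 H2).
  move: H1 => [/(_ at_ tb)[dx hx] /(_ at_ tb)[dy ky]].
  have dg := H2 at_ tb.
  set x' := derive_vec x t in hx; set y' := derive_vec y t in ky.
  have dd v : is_derive t 1 (fun s => d s v) ((x' - y') v).
    have := is_derive_vec dx v; have := is_derive_vec dy v => ? ?.
    exact: is_deriveB.
  have dN : is_derive t 1 N (2 * dotV (d t) (x' - y')).
    rewrite -[2 * _]addr0 mulr_natl mulr2n -{1}[dotV (d t) _]dotVC.
    by have := is_derive_dotV dd dd => ?; exact: is_deriveD.
  have dS : is_derive t 1 (fun s => Num.sqrt (N s))
     (2 * dotV (d t) (x' - y') / (2 * Num.sqrt (N t))).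
    exact: is_derive_sqrt_fun.
  exists (2 * dotV (d t) (x' - y') / (2 * Num.sqrt (N t)) - g t).
    exact: is_deriveB.
  have S0 : 0 < Num.sqrt (N t) by rewrite sqrtr_gt0.
  rewrite subr_le0 ler_pdivrMr ?mulr_gt0//.
  have mono := subdifferential_monotone hx ky.
  have h1 : dotV (d t) (x' - y') <= dotV (h t - k t) (d t).
    have -> : dotV (h t - k t) (d t) =
        dotV (h t - x' - (k t - y')) (d t) + dotV (d t) (x' - y').
      by rewrite (dotVC (d t)) -dotVDl; congr dotV; apply/funext => v; rewrite !fctE; ring.
    by rewrite lerDr.
  have h2 : dotV (h t - k t) (d t) <= g t * Num.sqrt (N t).
    rewrite (le_trans (dotV_le _ _))// ler_wpM2l ?l2norm_ge0// ler_wsqrtr//.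
    by rewrite lerDl ltW.
  lra.
rewrite /F (@prim0 _ a a)// subr0 lerBlDr => h1.
have h2 : l2norm (x b - y b) <= Num.sqrt (N b) by rewrite ler_wsqrtr// lerDl ltW.
have h3 : Num.sqrt (N a) <= l2norm (x a - y a) + e.
  rewrite -[leRHS]ger0_norm ?addr_ge0 ?l2norm_ge0 ?(ltW e0)// -sqrtr_sqr ler_wsqrtr//.
  rewrite sqrrD sqr_l2norm /N/d.
  have : 0 <= l2norm (x a - y a) * e *+ 2 by rewrite mulrn_wge0// mulr_ge0 ?l2norm_ge0 ?(ltW e0).
  lra.
lra.
Qed.

End Solutions.

(** * Energy inequalities along solutions *)

Section CauchySchwarz.
Context d (T : measurableType d) (R : realType) (mu : {measure set T -> \bar R}).
Variable (D : set T).
Hypothesis mD : measurable D.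
Implicit Types f g : T -> R.

Lemma integrableZ_fun f (l : R) : mu.-integrable D (EFin \o f) ->
  mu.-integrable D (EFin \o (fun s => l * f s)).
Proof. by move=> fi; apply: eq_integrable (integrableZl mD l fi). Qed.

Lemma integrableD_fun f g :
  mu.-integrable D (EFin \o f) -> mu.-integrable D (EFin \o g) ->
  mu.-integrable D (EFin \o (fun s => f s + g s)).
Proof. by move=> fi gi; apply: eq_integrable (integrableD mD fi gi). Qed.

Lemma integrableB_fun f g :
  mu.-integrable D (EFin \o f) -> mu.-integrable D (EFin \o g) ->
  mu.-integrable D (EFin \o (fun s => f s - g s)).
Proof. by move=> fi gi; apply: eq_integrable (integrableB mD fi gi). Qed.

(** Cauchy-Schwarz, from the arithmetic-geometric inequality
    [2 f g <= l f^2 + g^2 / l] with the optimal weight [l]. *)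
Lemma Rintegral_CS f g :
  mu.-integrable D (EFin \o (fun s => f s ^+ 2)) ->
  mu.-integrable D (EFin \o (fun s => g s ^+ 2)) ->
  mu.-integrable D (EFin \o (fun s => f s * g s)) ->
  \int[mu]_(s in D) (f s * g s) <=
  Num.sqrt (\int[mu]_(s in D) (f s ^+ 2)) * Num.sqrt (\int[mu]_(s in D) (g s ^+ 2)).
Proof.
move=> fi gi fgi.
set A := \int[mu]_(s in D) (f s ^+ 2); set B := \int[mu]_(s in D) (g s ^+ 2).
set I := (X in X <= _).
have A0 : 0 <= A by apply: Rintegral_ge0 => s _; exact: sqr_ge0.
have B0 : 0 <= B by apply: Rintegral_ge0 => s _; exact: sqr_ge0.
have key (l : R) : 0 < l -> 2 * I <= l * A + l^-1 * B.
  move=> l0; rewrite -!RintegralZl// -RintegralD//; last 2 first.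
  - exact: integrableZ_fun.
  - exact: integrableZ_fun.
  apply: le_Rintegral => //.
  - exact: integrableZ_fun.
  - by apply: integrableD_fun => //; exact: integrableZ_fun.
  move=> s _; rewrite -subr_ge0.
  have -> : l * f s ^+ 2 + l^-1 * g s ^+ 2 - 2 * (f s * g s) =
     l^-1 * (l * f s - g s) ^+ 2 by field; rewrite gt_eqF.
  by rewrite mulr_ge0 ?sqr_ge0// invr_ge0 ltW.
have sA := sqr_sqrtr A0; have sB := sqr_sqrtr B0.
have sA0 := sqrtr_ge0 A; have sB0 := sqrtr_ge0 B.
set p := Num.sqrt A in sA sA0 *; set q := Num.sqrt B in sB sB0 *.
apply/ler_addgt0Pr => e e0.
have w0 : 0 < p + q + 1 by rewrite ltr_wpDl// addr_ge0.
pose c := Num.min 1 (e / (p + q + 1)).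
have c0 : 0 < c by rewrite lt_min ltr01 divr_gt0.
have c1 : c <= 1 by rewrite ge_min lexx.
have c2 : c * (p + q + 1) <= e by rewrite -ler_pdivlMr// ge_min lexx orbT.
have pc : 0 < p + c by rewrite ltr_wpDl.
have qc : 0 < q + c by rewrite ltr_wpDl.
have := key ((q + c) / (p + c)); rewrite divr_gt0// => /(_ isT) h.
have h1 : (q + c) / (p + c) * A <= (q + c) * (p + c).
  rewrite -sA -mulrA ler_pM2l// mulrC ler_pdivrMr// -expr2 ler_sqr ?nnegrE ?(ltW pc)//.
  by rewrite lerDl ltW.
have h2 : ((q + c) / (p + c))^-1 * B <= (q + c) * (p + c).
  rewrite invf_div -sB mulrAC ler_pdivrMr// -mulrA [in leRHS]mulrC -mulrA ler_pM2l//.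
  by rewrite -expr2 ler_sqr ?nnegrE ?(ltW qc)// lerDl ltW.
have h3 : (q + c) * (p + c) <= p * q + e.
  have -> : (q + c) * (p + c) = p * q + c * (p + q + c) by ring.
  by rewrite lerD2l (le_trans _ c2)// ler_pM2l// lerD2l.
lra.
Qed.

End CauchySchwarz.

Section ScalarTools.
Variable R : realType.
Notation mu := (@lebesgue_measure R).
Implicit Types (a b t : R) (f g : R -> R).

Lemma ac_continuous_at a b f t : acR a b f -> a < t -> t < b ->
  forall e : R, 0 < e -> exists2 d : R, 0 < d & forall s, `|s - t| < d -> `|f s - f t| <= e.
Proof.
move=> acf at_ tb e e0; have [d d0 Hd] := ac_unif acf e0.
exists (Num.min d (Num.min (t - a) (b - t))).
  by rewrite !lt_min d0 !subr_gt0 at_ tb.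
move=> s; rewrite !lt_min => /and3P[s1 s2 s3]; apply: ltW.
have [st|ts] := leP s t.
  rewrite ler0_norm ?subr_le0// in s1 s2 s3; rewrite distrC; apply: Hd => //; lra.
by rewrite gtr0_norm ?subr_gt0// in s1 s2 s3; apply: Hd => //; lra.
Qed.

(** At a zero of a differentiable factor, continuity of the other one is
    enough for the product rule. *)
Lemma is_deriveM0 f g t (df : R) : f t = 0 -> is_derive t 1 f df ->
  (forall e : R, 0 < e -> exists2 d : R, 0 < d & forall s, `|s - t| < d -> `|g s - g t| <= e) ->
  is_derive t 1 (fun s => f s * g s) (df * g t).
Proof.
move=> f0 /is_deriveP Hf Hg; apply/is_deriveP => e e0.
have g1 : 0 < `|g t| + 1 by rewrite ltr_wpDl.
have f1 : 0 < `|df| + 1 by rewrite ltr_wpDl.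
have e1 : 0 < e / (2 * (`|g t| + 1)) by rewrite divr_gt0// mulr_gt0.
have e2 : 0 < Num.min 1 (e / (2 * (`|df| + 1))).
  by rewrite lt_min ltr01 divr_gt0// mulr_gt0.
have [d1 d10 H1] := Hf _ e1; have [d2 d20 H2] := Hg _ e2.
exists (Num.min d1 d2); first by rewrite lt_min d10.
move=> s; rewrite lt_min => /andP[s1 s2].
have {}H1 := H1 s s1; have := H2 s s2; rewrite le_min => /andP[k1 k2].
rewrite f0 mul0r subr0.
rewrite f0 subr0 in H1.
have -> : f s * g s - df * g t * (s - t) =
  (f s - df * (s - t)) * g s + df * (s - t) * (g s - g t) by ring.
rewrite (le_trans (ler_normD _ _))// !normrM.
have gs : `|g s| <= `|g t| + 1.
  by rewrite -[g s](subrK (g t)) addrC (le_trans (ler_normD _ _))// lerD2l.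
have st0 := normr_ge0 (s - t).
have h1 : `|f s - df * (s - t)| * `|g s| <= e / 2 * `|s - t|.
  apply: (@le_trans _ _ (e / (2 * (`|g t| + 1)) * `|s - t| * (`|g t| + 1))).
    by rewrite ler_pM.
  by rewrite le_eqVlt; apply/orP; left; apply/eqP; field; rewrite gt_eqF.
have h2 : `|df| * `|s - t| * `|g s - g t| <= e / 2 * `|s - t|.
  apply: (@le_trans _ _ ((`|df| + 1) * `|s - t| * (e / (2 * (`|df| + 1))))).
    by rewrite ler_pM// ?mulr_ge0// ler_wpM2r// lerDl.
  by rewrite le_eqVlt; apply/orP; left; apply/eqP; field; rewrite gt_eqF.
lra.
Qed.

(** Both sides have the same derivative almost everywhere. *)
Lemma ac_ftc a b f (df : R -> R) : a <= b -> acR a b f -> intb a b df ->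
  {ae mu, forall t, a < t -> t < b -> is_derive t 1 f (df t)} ->
  f b - f a = prim a df b.
Proof.
move=> ab acf dfi aef.
have := @ac_constant _ a b (fun t => f t - prim a df t) ab.
move=> /(_ _ _)/wrap[].
- by apply: acB => //; exact: prim_ac.
- apply: aeS2 aef (prim_derive dfi) => t H1 H2 at_ tb.
  by have := H1 at_ tb; have := H2 at_ tb => ? ?; rewrite -(subrr (df t)); exact: is_deriveB.
by rewrite [X in _ = _ - X]prim0// => h; lra.
Qed.

End ScalarTools.

Section Energy.
Variables (R : realType) (V : finType).
Notation mu := (@lebesgue_measure R).
Variable phi : (V -> R) -> R.
Implicit Types (x y h k : R -> V -> R) (a b t : R).

(** Differentiating [c t * phi (x t) + q t] needs no chain rule: the
    subgradient inequality at [x t] bounds the backward increments of [phi]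
    along [x] by those of a linear functional of [x]. *)
Lemma weighted_energy a b h x (c c' q q' : R -> R) : a <= b ->
  strong_solution phi a b h x -> acR a b (fun t => phi (x t)) ->
  (forall t, a <= t -> 0 <= c t) -> acR a b c -> acR a b q ->
  {ae mu, forall t, a < t -> t < b -> is_derive t 1 c (c' t)} ->
  {ae mu, forall t, a < t -> t < b -> is_derive t 1 q (q' t)} ->
  {ae mu, forall t, a < t -> t < b ->
    subdifferential phi (x t) (h t - derive_vec x t) ->
    c' t * phi (x t) + c t * dotV (h t - derive_vec x t) (derive_vec x t) + q' t <= 0} ->
  c b * phi (x b) + q b <= c a * phi (x a) + q a.
Proof.
move=> ab [acx aex] acp c0 acc acq aec aeq aeE.
apply: (@ac_left_majorant _ a b (fun t => c t * phi (x t) + q t)) => //.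
  by apply: acD => //; exact: acM.
apply: aeS (aeI (aeI aex aeE) (aeI aec aeq)) => t [[Hx HI] [Hc Hq]] at_ tb.
have [dx zx] := Hx at_ tb; have {}HI := HI at_ tb zx.
have {}Hc := Hc at_ tb; have {}Hq := Hq at_ tb.
set z := h t - derive_vec x t in zx HI.
exists (fun s => (c s - c t) * phi (x s) + (c t * dotV z (x s) + q s)).
  move=> s as_ st; rewrite subrr mul0r add0r.
  have := zx (x s); rewrite dotVBr => h1.
  have {}h1 : c t * (phi (x t) - phi (x s)) <= c t * (dotV z (x t) - dotV z (x s)).
    by apply: ler_wpM2l; [exact/c0/ltW|lra].
  lra.
exists (c' t * phi (x t) + (c t * dotV z (derive_vec x t) + q' t)); last by lra.
have d1 : is_derive t 1 (fun s => (c s - c t) * phi (x s)) (c' t * phi (x t)).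
  apply: is_deriveM0; first by rewrite subrr.
    by rewrite -[c' t]subr0; exact: is_deriveB.
  exact: (ac_continuous_at acp at_ tb).
have d2 : is_derive t 1 (fun s => dotV z (x s)) (dotV z (derive_vec x t)).
  have := is_derive_dotV (fun v => is_derive_cst (z v) t 1) (is_derive_vec dx).
  by rewrite (_ : dotV (fun=> 0) _ = 0) ?add0r// dotV0l.
have d3 : is_derive t 1 (fun s => c t * dotV z (x s)) (c t * dotV z (derive_vec x t)).
  by have := is_deriveM_fun (is_derive_cst (c t) t 1) d2; rewrite mul0r add0r.
have d4 : is_derive t 1 (fun s => c t * dotV z (x s) + q s)
   (c t * dotV z (derive_vec x t) + q' t) by exact: is_deriveD.
exact: is_deriveD.
Qed.

End Energy.

(** * The right derivative *)

Section MeasurableNorm.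
Variables (R : realType) (V : finType).

Lemma measurable_sqrt_fun (D : set R) (f : R -> R) :
  measurable_fun D f -> measurable_fun D (fun s => Num.sqrt (f s)).
Proof.
move=> mf; apply: measurableT_comp mf.
by apply: continuous_measurable_fun; exact: sqrt_continuous.
Qed.

Lemma measurable_dotV (D : set R) (f g : R -> V -> R) :
  (forall v, measurable_fun D (fun s => f s v)) ->
  (forall v, measurable_fun D (fun s => g s v)) ->
  measurable_fun D (fun s => dotV (f s) (g s)).
Proof.
move=> mf mg; apply: measurable_sum => v.
exact: measurable_funM.
Qed.

Lemma measurable_l2norm (D : set R) (f : R -> V -> R) :
  (forall v, measurable_fun D (fun s => f s v)) ->
  measurable_fun D (fun s => l2norm (f s)).
Proof. by move=> mf; apply: measurable_sqrt_fun; exact: measurable_dotV. Qed.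

Lemma intb_dominated (a b : R) (f g : R -> R) : measurable_fun `]a, b[ f ->
  (forall s, a < s -> s < b -> `|f s| <= g s) -> intb a b g -> intb a b f.
Proof.
move=> mf fg gi; apply: (le_integrable _ _ _ gi) => //.
  exact/measurable_EFinP.
move=> s /=; rewrite in_itv/= => /andP[as_ sb].
by rewrite lee_fin (le_trans (fg s as_ sb))// ler_norm.
Qed.

Lemma intb_sum (a b : R) (f : R -> V -> R) : (forall v, intb a b (fun s => f s v)) ->
  intb a b (fun s => \sum_v f s v).
Proof.
move=> fi; rewrite (_ : _ \o _ = fun s => (\sum_v (f s v)%:E)%E).
  by apply: integrable_sum => // v _; exact: fi.
by apply/funext => s /=; rewrite sumEFin.
Qed.

Lemma intb_measurable (a b : R) (f : R -> R) : intb a b f -> measurable_fun `]a, b[ f.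
Proof. by move=> /integrableP[/measurable_EFinP]. Qed.

Lemma intb_l2norm (a b : R) (f : R -> V -> R) : (forall v, intb a b (fun s => f s v)) ->
  intb a b (fun s => l2norm (f s)).
Proof.
move=> fi; apply: (@intb_dominated _ _ _ (fun s => \sum_v `|f s v|)).
- by apply: measurable_l2norm => v; exact: intb_measurable.
- by move=> s _ _; rewrite ger0_norm ?l2norm_ge0// l2norm_le_sum.
- by apply: intb_sum => v; apply: integrable_norm; exact: fi.
Qed.

Lemma intb_bounded (a b M : R) (f : R -> R) : measurable_fun `]a, b[ f ->
  (forall s, a < s -> s < b -> `|f s| <= M) -> intb a b f.
Proof.
move=> mf fM; apply: measurable_bounded_integrable => //=.
  by rewrite lebesgue_measure_itv; case: ifPn => _; rewrite ?ltry // -EFinB ltry.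
exists M; split; first exact: num_real.
move=> N MN s /=; rewrite in_itv/= => /andP[as_ sb].
by rewrite (le_trans (fM s as_ sb))// ltW.
Qed.

Lemma intb_cst (a b c : R) : intb a b (fun=> c).
Proof. by apply: (@intb_bounded _ _ `|c|). Qed.

End MeasurableNorm.

Section MinimalSection.
Variables (R : realType) (V : finType).
Variable phi : (V -> R) -> R.

(** Parallelogram identity: two distinct elements of minimal norm would have a
    midpoint of smaller norm, which belongs to the set by convexity. *)
Lemma min_norm_unique (p a b : V -> R) :
  let C := [set p - z | z in subdifferential phi a] in
  min_norm_elt C b -> forall b', min_norm_elt C b' -> b = b'.
Proof.
move=> C [[z Hz <-] mb] b' [[z' Hz' <-] mb'].
pose m := 2^-1 *: (z + z').
have Hm : subdifferential phi a m.
  by move=> y; have := Hz y; have := Hz' y; rewrite /m dotVZl dotVDl; lra.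
have h1 := mb _ (ex_intro2 _ _ m Hm erefl).
have h2 := mb' _ (ex_intro2 _ _ m Hm erefl).
have h1' : l2norm (p - z) ^+ 2 <= l2norm (p - m) ^+ 2.
  by rewrite ler_sqr ?nnegrE ?l2norm_ge0.
have h2' : l2norm (p - z') ^+ 2 <= l2norm (p - m) ^+ 2.
  by rewrite ler_sqr ?nnegrE ?l2norm_ge0.
have par : l2norm (p - z - (p - z')) ^+ 2 + 4 * l2norm (p - m) ^+ 2 =
    2 * l2norm (p - z) ^+ 2 + 2 * l2norm (p - z') ^+ 2.
  rewrite !sqr_l2norm /dotV !mulr_sumr -!big_split/=; apply: eq_bigr => v _.
  by rewrite /m !fctE /GRing.scale/=; field.
have : l2norm (p - z - (p - z')) ^+ 2 <= 0 by lra.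
rewrite le_eqVlt ltNge sqr_ge0 orbF sqrf_eq0 => /eqP h.
by apply/eqP; rewrite -subr_eq0; apply/eqP/l2norm_le0; rewrite h.
Qed.

End MinimalSection.

(** Tychonoff's theorem for the cube [-M, M]^V. *)
Lemma bounded_cluster (R : realType) (V : finType) (F : set_system R)
    {PF : ProperFilter F} (q : R -> V -> R) (M : R) :
  (\forall t \near F, l2norm (q t) <= M) ->
  exists eta : V -> R, forall (P : set R) (e : R), F P -> 0 < e ->
    exists2 t, P t & l2norm (q t - eta) <= e.
Proof.
move=> qM.
pose W := prod_topology (fun _ : V => R).
have cK : compact [set f : W | forall v, `[- M, M]%classic (f v)].
  apply: (@tychonoff V (fun _ => (R : topologicalType)) (fun _ => `[- M, M]%classic) _) => v.
  exact: segment_compact.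
have /cK[eta [_ cl]] : ((q : R -> W) @ F) [set f : W | forall v, `[- M, M]%classic (f v)].
  apply: filterS qM => t qt v /=; rewrite in_itv/= -ler_norml.
  exact: le_trans (normr_le_l2norm _ _) qt.
exists eta => P e FP e0.
pose c := e / (#|V|%:R + 1).
have c0 : 0 < c by rewrite divr_gt0// ltr_wpDl.
have nB : \forall f \near (eta : W), forall v, `|eta v - f v| < c.
  have nBv v : \forall f \near (eta : W), `|eta v - f v| < c.
    have := @proj_continuous V (fun=> (R : topologicalType)) v eta.
    move=> /(_ _ (nbhsx_ballx (eta v : R) c c0)); exact.
  have := @filter_forall W V (fun v f => `|eta v - f v| < c) _ (nbhs_filter (eta : W)) nBv.
  exact.
have FqP : F (q @^-1` (q @` P)) by apply: filterS FP => t Pt; exists t.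
have [f [[t Pt <-] /= Bf]] := cl (q @` P) _ FqP nB.
exists t => //; rewrite l2normB; apply: l2norm_le_coord => // v; exact/ltW/Bf.
Qed.

Section RightDerivative.
Variables (R : realType) (V : finType).
Notation mu := (@lebesgue_measure R).
Variables (phi : (V -> R) -> R) (T L : R) (h x : R -> V -> R) (t0 : R).
Hypothesis h_int : forall v, intb 0 T (fun s => h s v).
Hypothesis x_sol : strong_solution phi 0 T h x.
Hypothesis z_bound : {ae mu, forall t, 0 < t -> t < T ->
  l2norm (h t - derive_vec x t) <= L}.
Hypothesis phi_ac : acR 0 T (fun t => phi (x t)).
Hypotheses (t0_ge0 : 0 <= t0) (t0_lt : t0 < T).
Hypothesis h_leb : right_lebesgue_point h t0.
Hypothesis sub_ne : exists z, subdifferential phi (x t0) z.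

Let h0 := right_value h t0.
Let quot tau : V -> R := tau^-1 *: (x (t0 + tau) - x t0).

Let L_ge0 (z : V -> R) : l2norm z <= L -> 0 <= L.
Proof. exact: le_trans (l2norm_ge0 _). Qed.

(** The graph of the subdifferential is closed: averaging the inclusion over
    a short interval gives the subgradient inequality up to a small error. *)
Lemma quot_subgradient y (e : R) : 0 < e -> exists2 d : R, 0 < d &
  forall tau, 0 < tau -> tau < d ->
    dotV (right_mean h t0 tau - quot tau) (y - x t0) <= phi y - phi (x t0) + e.
Proof.
move=> e0; have [acx aex] := x_sol.
have e2 : 0 < e / 2 by rewrite divr_gt0.
have L1 : 0 < `|L| + 1 by rewrite ltr_wpDl.
have e3 : 0 < e / 2 / (`|L| + 1) by rewrite divr_gt0.
have [d1 d10 H1] := ac_unif phi_ac e2.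
have [d2 d20 H2] := ac_unif acx e3.
exists (Num.min (T - t0) (Num.min d1 d2)).
  by rewrite !lt_min subr_gt0 t0_lt d10.
move=> tau tau0; rewrite !lt_min => /and3P[c1 c2 c3].
set w := y - x t0; set kap := phi y - phi (x t0) + e.
pose b := t0 + tau.
have t0b : t0 <= b by rewrite lerDl ltW.
have bT : b <= T by rewrite /b; lra.
have hb v : intb t0 b (fun s => h s v) by apply: intbS (h_int v).
pose Hv s v := prim t0 (fun r => h r v) s.
have acH : abs_continuous (@l2norm R V) t0 b Hv by apply/ac_vec => v; exact: prim_ac.
have acx' : abs_continuous (@l2norm R V) t0 b x by exact: acS acx.
have acw : abs_continuous (@l2norm R V) t0 b (fun=> w) by apply/ac_vec => v; exact: ac_cst.
pose F s := dotV (Hv s - x s) w - kap * s.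
have : F b <= F t0.
  apply: ac_nonincreasing => //.
    apply: acB; first by apply: ac_dotV => //; exact: acB_vec.
    by apply: acM; [exact: ac_cst|exact: ac_id].
  have aeH : {ae mu, forall t, forall v, t0 < t -> t < b ->
      is_derive t 1 (fun s => Hv s v) (h t v)}.
    by apply: ae_forall => v; exact: prim_derive (hb v).
  apply: aeS (aeI aeH (aeI aex z_bound)) => t [dH [Hx Hz]] at_ tb.
  have t0t : 0 < t by exact: le_lt_trans at_.
  have tT : t < T by exact: lt_le_trans bT.
  have [dx zx] := Hx t0t tT; have {}Hz := Hz t0t tT.
  set z := h t - derive_vec x t in zx Hz.
  exists (dotV z w - kap).
    have d1' v : is_derive t 1 (fun s => (Hv s - x s) v) (z v).
      have := is_derive_vec dx v => ?; have := dH v at_ tb => ?.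
      exact: is_deriveB.
    have d2' := is_derive_dotV d1' (fun v => is_derive_cst (w v) t 1).
    have d3' := is_deriveM_fun (is_derive_cst kap t 1) (is_derive_id t 1).
    rewrite mul0r add0r mulr1 in d3'.
    rewrite (_ : dotV z w = dotV z w + dotV (Hv t - x t) (fun=> 0)).
      exact: is_deriveB.
    by rewrite dotVC [X in _ = _ + X]dotVC (_ : (fun=> 0) = 0)// dotV0l addr0.
  rewrite subr_le0 /kap.
  have tt0 : t - t0 < tau by rewrite /b in tb; lra.
  have k1 := H1 t0 t t0_ge0 (ltW at_) (ltW tT) (lt_trans tt0 c2).
  have k2 := H2 t0 t t0_ge0 (ltW at_) (ltW tT) (lt_trans tt0 c3).
  have k3 := zx y.
  have k4 : dotV z (x t - x t0) <= e / 2.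
    rewrite (le_trans (dotV_le _ _))//.
    apply: (@le_trans _ _ ((`|L| + 1) * (e / 2 / (`|L| + 1)))).
      rewrite ler_pM ?l2norm_ge0// ?(ltW k2)// (le_trans Hz)//.
      by rewrite (le_trans (ler_norm L))// lerDl.
    by rewrite mulrC divfK// gt_eqF.
  have k5 : dotV z w = dotV z (y - x t) + dotV z (x t - x t0).
    by rewrite -dotVDr; congr dotV; rewrite /w addrA subrK.
  have := ler_norm (- (phi (x t) - phi (x t0))); rewrite normrN; lra.
rewrite /F => hF.
have HvE : Hv b = tau *: right_mean h t0 tau.
  by apply/funext => v; rewrite /right_mean fctE /GRing.scale/= mulVKf// gt_eqF.
have Hv0 : Hv t0 = 0 by apply/funext => v; rewrite /Hv prim0.
have qE : x b - x t0 = tau *: quot tau.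
  by rewrite /quot scalerA mulfV ?gt_eqF// scale1r.
have : tau * dotV (right_mean h t0 tau - quot tau) w <= tau * kap.
  rewrite -dotVZl scalerBr -HvE -qE.
  move: hF; rewrite Hv0 !dotVBl dotV0l /b; lra.
by rewrite ler_pM2l.
Qed.

(** Comparison with the stationary solution [x t0] of the problem with constant
    forcing [z]. *)
Lemma quot_le z (e : R) : subdifferential phi (x t0) z -> 0 < e ->
  exists2 d : R, 0 < d & forall tau, 0 < tau -> tau < d ->
    l2norm (quot tau) <= l2norm (h0 - z) + e.
Proof.
move=> zx e0; have [_ leb] := h_leb.
move/cvgrPdist_le : leb => /(_ _ e0) /nbhs_ballP[d /= d0 Hd].
exists (Num.min d (T - t0)); first by rewrite lt_min d0 subr_gt0.
move=> tau tau0; rewrite lt_min => /andP[taud tauT].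
have := Hd tau; rewrite /ball/= sub0r normrN (gtr0_norm tau0) => /(_ taud tau0).
rewrite sub0r normrN => leb.
pose b := t0 + tau.
have t0b : t0 <= b by rewrite lerDl ltW.
have bT : b <= T by rewrite /b; lra.
have hb v : intb t0 b (fun s => h s v) by apply: intbS (h_int v).
have hc (c : V -> R) v : intb t0 b (fun s => (h s - c) v).
  by apply: (integrableB_fun _ (hb v)) => //; exact: intb_cst.
have solb : strong_solution phi t0 b h x by exact: strong_solutionS x_sol.
have solc := @strong_solution_cst R V phi t0 b _ _ zx.
have := contraction t0b solb solc (intb_l2norm (hc z)).
rewrite subrr l2norm0 add0r => ctr.
have tri : prim t0 (fun s => l2norm (h s - z)) b <=
    prim t0 (fun s => l2norm (h s - h0)) b + l2norm (h0 - z) * tau.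
  have -> : l2norm (h0 - z) * tau = prim t0 (fun=> l2norm (h0 - z)) b.
    by rewrite prim_cst// /b addrAC subrr add0r.
  rewrite /prim -RintegralD//; [|exact: (intb_l2norm (hc h0))|exact: intb_cst].
  apply: le_Rintegral => //; first exact: (intb_l2norm (hc z)).
    apply: integrableD_fun => //; first exact: (intb_l2norm (hc h0)).
    exact: intb_cst.
  by move=> s _; exact: l2norm_triangle.
rewrite /quot l2normZ gtr0_norm ?invr_gt0// mulrC ler_pdivrMr//.
have : prim t0 (fun s => l2norm (h s - h0)) b <= e * tau.
  rewrite -ler_pdivrMr// mulrC; apply: le_trans leb.
  exact: ler_norm.
rewrite -/b; lra.
Qed.

(** The quotients are bounded by [quot_le]. A cluster point lies in [C] by
    [quot_subgradient] and has minimal norm in [C] by [quot_le]; as such an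
    element is unique, the quotients converge to it. *)
Theorem right_derivative : right_derivable x t0 /\
  min_norm_elt [set h0 - z | z in subdifferential phi (x t0)] (right_derive x t0).
Proof.
set C := [set h0 - z | z in _].
have rm : forall e : R, 0 < e ->
    \forall tau \near (0:R)^'+, l2norm (right_mean h t0 tau - h0) <= e.
  apply: cvg_l2norm => v; exact: (h_leb.1 v).
have gt0 : \forall tau \near (0:R)^'+, 0 < tau by exact: nbhs_right_gt.
have near0 (d : R) : 0 < d -> \forall tau \near (0:R)^'+, tau < d.
  by move=> d0; exact: nbhs_right_lt.
(* for finer filters as well: convergence is proved by contradiction along one *)
have cluster_min (F : set_system R) (PF : ProperFilter F) :
    (forall P : set R, (\forall tau \near (0:R)^'+, P tau) -> F P) ->
    exists2 eta, min_norm_elt C eta &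
      forall (P : set R) (e : R), F P -> 0 < e ->
        exists2 t, P t & l2norm (quot t - eta) <= e.
  move=> FR; have [z0 Hz0] := sub_ne.
  have [d0 d00 Hd0] := quot_le Hz0 ltr01.
  have : \forall t \near F, l2norm (quot t) <= l2norm (h0 - z0) + 1.
    apply: FR; near=> tau; apply: Hd0; near: tau; [exact: gt0|exact: near0].
  move=> /bounded_cluster[eta Heta]; exists eta => //; split.
    exists (h0 - eta); last by rewrite opprB addrCA subrr addr0.
    move=> y; rewrite -lerBrDl; set w := y - x t0.
    apply/ler_addgt0Pr => e e0.
    have W0 : 0 < 2 * l2norm w + 1 by rewrite ltr_wpDl// mulr_ge0// l2norm_ge0.
    have e2 : 0 < e / 2 by rewrite divr_gt0.
    have e3 : 0 < e / 2 / (2 * l2norm w + 1) by rewrite divr_gt0.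
    have [d d1 Hd] := quot_subgradient y e2.
    have FP : F [set tau | dotV (right_mean h t0 tau - quot tau) w <= phi y - phi (x t0) + e / 2 /\
        l2norm (right_mean h t0 tau - h0) <= e / 2 / (2 * l2norm w + 1)].
      apply: FR; near=> tau; split; last by near: tau; exact: rm.
      by apply: Hd; near: tau; [exact: gt0|exact: near0].
    have [tau [k1 k2] k3] := Heta _ _ FP e3.
    have -> : h0 - eta = (right_mean h t0 tau - quot tau) +
      ((quot tau - eta) - (right_mean h t0 tau - h0)).
      by apply/funext => v; rewrite !fctE; ring.
    rewrite dotVDl.
    have : dotV ((quot tau - eta) - (right_mean h t0 tau - h0)) w <=
      (e / 2 / (2 * l2norm w + 1) + e / 2 / (2 * l2norm w + 1)) * l2norm w.
      rewrite (le_trans (dotV_le _ _))// ler_wpM2r ?l2norm_ge0//.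
      by rewrite (le_trans (l2normD _ _))// l2normN lerD.
    have : e / 2 / (2 * l2norm w + 1) * (2 * l2norm w + 1) = e / 2.
      by rewrite divfK// gt_eqF.
    lra.
  move=> _ [z Hz <-]; apply/ler_addgt0Pr => e e0.
  have e2 : 0 < e / 2 by rewrite divr_gt0.
  have [d d1 Hd] := quot_le Hz e2.
  have FP : F [set tau | l2norm (quot tau) <= l2norm (h0 - z) + e / 2].
    by apply: FR; near=> tau; apply: Hd; near: tau; [exact: gt0|exact: near0].
  have [tau /= k1 k2] := Heta _ _ FP e2.
  have := ler_l2normB eta (quot tau); rewrite l2normB => /ler_normlP[_]; lra.
have [//|eta mineta _] := cluster_min ((0:R)^'+) _.
(* otherwise the quotients have a cluster point along the times at which they
   stay away from [eta] *)
have cvgq v : (fun tau => tau^-1 * (x (t0 + tau) v - x t0 v)) @ (0:R)^'+ --> eta v.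
  apply/cvgrPdist_le => e e0; apply: contrapT => nE.
  pose D := [set tau : R | ~ `|eta v - tau^-1 * (x (t0 + tau) v - x t0 v)| <= e].
  pose F := within D ((0:R)^'+).
  have PF : ProperFilter F.
    split; last exact: within_filter.
    move=> F0; apply: nE; move: F0; rewrite /F /within /=.
    by apply: filterS => tau Htau; apply: contrapT => /Htau.
  have [P HP|eta' mineta' cl] := cluster_min F PF.
    by rewrite /F /within/=; apply: filterS HP => tau.
  have FD : F D by rewrite /F /within/=; apply: filterE.
  have [tau Dtau k] := cl D e FD e0; apply: Dtau.
  rewrite (min_norm_unique mineta mineta') distrC.
  exact: le_trans (normr_le_l2norm (quot tau - eta') v) k.
split; first by move=> v; apply/cvg_ex; exists (eta v); exact: cvgq.
suff -> : right_derive x t0 = eta by [].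
by apply/funext => v; apply: cvg_lim => //; exact: cvgq.
Unshelve. all: by end_near. Qed.

End RightDerivative.

(** * The hypergraph energy and its truncation *)

Section PowerFunction.
Variables (R : realType) (p : R).
Hypothesis p_ge1 : 1 <= p.
Implicit Types s r K : R.

Let p_gt0 : 0 < p. Proof. exact: lt_le_trans ltr01 p_ge1. Qed.

(** The tangent inequality is Young's inequality for [r] and [s^(p - 1)]. *)
Lemma powR_tangent s r : 0 <= s -> 0 <= r ->
  s `^ p / p + s `^ (p - 1) * (r - s) <= r `^ p / p.
Proof.
move=> s0 r0; have [p1|p1] := eqVneq p 1.
  by rewrite p1 subrr powRr0 !powRr1// mul1r divr1 addrC subrK divr1.
have p1' : 0 < p - 1 by rewrite subr_gt0 lt_neqAle eq_sym p1.
have q0 : 0 < p / (p - 1) by rewrite divr_gt0.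
have := @conjugate_powR _ r (s `^ (p - 1)) p (p / (p - 1)) r0 (powR_ge0 _ _) p_gt0 q0.
have -> : p^-1 + (p / (p - 1))^-1 = 1 by field; rewrite !gt_eqF.
move=> /(_ erefl).
rewrite -powRrM (_ : (p - 1) * (p / (p - 1)) = p); last by field; rewrite gt_eqF.
have := mulr_powRB1 s0 p_gt0; set S := s `^ (p - 1) => <- h.
have : s * S / (p / (p - 1)) = s * S - s * S / p.
  by field; rewrite !gt_eqF.
lra.
Qed.

(** The power [s^p / p], continued affinely beyond [K]. *)
Definition cutpow K s : R :=
  Num.min s K `^ p / p + Num.min s K `^ (p - 1) * (s - Num.min s K).

Lemma cutpowE K s : s <= K -> cutpow K s = s `^ p / p.
Proof. by move=> sK; rewrite /cutpow min_l// subrr mulr0 addr0. Qed.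

Lemma cutpow_le K s : 0 <= K -> 0 <= s -> cutpow K s <= s `^ p / p.
Proof. by move=> K0 s0; apply: powR_tangent; rewrite // le_min s0. Qed.

Lemma cutpow_ge0 K s : 0 <= cutpow K s.
Proof.
rewrite addr_ge0 ?mulr_ge0 ?powR_ge0 ?invr_ge0 ?(ltW p_gt0)//.
by rewrite subr_ge0 ge_min lexx.
Qed.

Lemma cutpow_tangent K s r : 0 <= K -> 0 <= s -> 0 <= r ->
  cutpow K s + Num.min s K `^ (p - 1) * (r - s) <= cutpow K r.
Proof.
move=> K0 s0 r0; rewrite /cutpow; set m := Num.min s K; set n := Num.min r K.
have m0 : 0 <= m by rewrite le_min s0.
have n0 : 0 <= n by rewrite le_min r0.
have h := powR_tangent m0 n0.
have h2 : m `^ (p - 1) * (r - n) <= n `^ (p - 1) * (r - n).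
  have [rK|Kr] := leP r K; first by rewrite /n min_l// subrr !mulr0.
  rewrite ler_wpM2r//; first by rewrite subr_ge0 ge_min lexx.
  rewrite ge0_ler_powR ?nnegrE ?subr_ge0//.
  by rewrite /n min_r ?(ltW Kr)// ge_min lexx orbT.
lra.
Qed.

End PowerFunction.

Section EdgeOscillation.
Variables (R : realType) (V : finType).
Implicit Types (e : {set V}) (x y : V -> R).

Lemma edge_osc_ge e x u v : u \in e -> v \in e -> x u - x v <= edge_osc e x.
Proof.
move=> ue ve; apply: le_trans (le_bigmax_cond _ _ ue).
exact: (le_bigmax_cond _ (fun v => x u - x v) ve).
Qed.

Lemma edge_osc_attained e x : (0 < #|e|)%N ->
  exists u v, [/\ u \in e, v \in e & edge_osc e x = x u - x v].
Proof.
move=> /card_gt0P[w we].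
pose A (c : R) := exists u v, [/\ u \in e, v \in e & c = x u - x v].
have A0 : A 0 by exists w, w; rewrite subrr.
have Amax c d : A c -> A d -> A (Num.max c d) by move=> Ac Ad; rewrite maxEle; case: ifP.
apply: (big_ind A) => // u ue; apply: (big_ind A) => // v ve.
by exists u, v.
Qed.

Lemma edge_osc_ge0 e x : 0 <= edge_osc e x.
Proof. by rewrite /edge_osc bigmax_idl le_max lexx. Qed.

Lemma edge_osc_le e x : edge_osc e x <= 2 * l2norm x.
Proof.
have [e0|e0] := posnP #|e|.
  rewrite /edge_osc big_pred0 ?mulr_ge0 ?l2norm_ge0// => u.
  by move/eqP : e0; rewrite cards_eq0 => /eqP ->; rewrite inE.
have [u [v [_ _ ->]]] := edge_osc_attained x e0.
have := normr_le_l2norm x u; have := normr_le_l2norm x v.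
move=> /ler_normlP[h1 h2] /ler_normlP[h3 h4]; lra.
Qed.

Definition indV (u : V) : V -> R := fun v => (v == u)%:R.

Lemma dotV_ind u y : dotV (indV u) y = y u.
Proof.
rewrite /dotV (bigD1 u)//= /indV eqxx mul1r big1 ?addr0// => v vu.
by rewrite (negbTE vu) mul0r.
Qed.

Lemma l2norm_ind u : l2norm (indV u) = 1.
Proof. by rewrite /l2norm dotV_ind /indV eqxx sqrtr1. Qed.

End EdgeOscillation.

Section HypergraphEnergy.
Variables (R : realType) (V : finType) (G : hypergraph R V) (p : R).
Hypothesis p_ge1 : 1 <= p.
Implicit Types (e : {set V}) (x y : V -> R) (K : R).

Let p_gt0 : 0 < p. Proof. exact: lt_le_trans ltr01 p_ge1. Qed.

Definition cut_energy K x : R :=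
  \sum_(e in edges G) weight G e * cutpow p K (edge_osc e x).

Lemma energyE x : energy G p x = \sum_(e in edges G) weight G e * (edge_osc e x `^ p / p).
Proof.
rewrite /energy mulr_sumr; apply: eq_bigr => e _.
by rewrite mulrC mulrA.
Qed.

Lemma energy_ge0 x : 0 <= energy G p x.
Proof.
rewrite energyE; apply: sumr_ge0 => e eG.
by rewrite mulr_ge0 ?(ltW (weight_gt0 eG))// divr_ge0 ?powR_ge0// ltW.
Qed.

Lemma cut_energy_ge0 K x : 0 <= cut_energy K x.
Proof.
apply: sumr_ge0 => e eG.
by rewrite mulr_ge0 ?(ltW (weight_gt0 eG))// cutpow_ge0.
Qed.

Lemma cut_energy_le K x : 0 <= K -> cut_energy K x <= energy G p x.
Proof.
move=> K0; rewrite energyE; apply: ler_sum => e eG.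
by rewrite ler_wpM2l ?(ltW (weight_gt0 eG))// cutpow_le// edge_osc_ge0.
Qed.

Lemma cut_energyE K x : 2 * l2norm x <= K -> cut_energy K x = energy G p x.
Proof.
move=> xK; rewrite energyE; apply: eq_bigr => e eG.
by rewrite cutpowE// (le_trans (edge_osc_le e x)).
Qed.

(** An explicit subgradient: on each hyperedge, the slope of the cut power
    times [1_u - 1_v] for a pair realising the oscillation. *)
Lemma cut_energy_subgradient K : 0 <= K -> exists L, forall x,
  exists2 z, subdifferential (cut_energy K) x z & l2norm z <= L.
Proof.
move=> K0; pose c e x := weight G e * Num.min (edge_osc e x) K `^ (p - 1).
exists (\sum_(e in edges G) (weight G e * K `^ (p - 1) * 2)) => x.
have /choice[b Hb] e : exists b : V -> R, e \in edges G ->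
    [/\ dotV b x = edge_osc e x, forall y, dotV b y <= edge_osc e y & l2norm b <= 2].
  have [eG|eG] := boolP (e \in edges G); last by exists 0.
  have e0 : (0 < #|e|)%N by apply: ltn_trans (edge_card_gt1 eG).
  have [u [v [ue ve ouv]]] := edge_osc_attained x e0.
  exists (indV R u - indV R v) => _; split.
  - by rewrite dotVBl !dotV_ind ouv.
  - by move=> y; rewrite dotVBl !dotV_ind edge_osc_ge.
  - rewrite (le_trans (l2normD _ _))// l2normN !l2norm_ind; lra.
have c0 e : e \in edges G -> 0 <= c e x.
  by move=> eG; rewrite mulr_ge0 ?powR_ge0// ltW// weight_gt0.
have osc0 e : 0 <= Num.min (edge_osc e x) K by rewrite le_min edge_osc_ge0.
pose z := \sum_(e in edges G) c e x *: b e.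
have dotz y : dotV z y = \sum_(e in edges G) c e x * dotV (b e) y.
  rewrite /z; elim/big_rec2 : _ => [|e r s _ IH]; first by rewrite dotV0l.
  by rewrite dotVDl dotVZl IH.
exists z.
  move=> y; rewrite dotz -big_split/=; apply: ler_sum => e eG.
  have [b1 b2 b3] := Hb e eG.
  rewrite /c -mulrA -mulrDr ler_wpM2l ?(ltW (weight_gt0 eG))//.
  apply: le_trans (cutpow_tangent p_ge1 K0 (edge_osc_ge0 e x) (edge_osc_ge0 e y)).
  by rewrite lerD2l ler_wpM2l ?powR_ge0// dotVBr b1 lerB.
rewrite /z; elim/big_rec2 : _ => [|e r s eG IH]; first by rewrite l2norm0.
rewrite (le_trans (l2normD _ _))// lerD// l2normZ ger0_norm ?c0//.
have [_ _ b3] := Hb e eG.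
rewrite ler_pM ?l2norm_ge0 ?c0// /c ler_wpM2l ?(ltW (weight_gt0 eG))//.
rewrite ge0_ler_powR ?nnegrE ?subr_ge0//.
by rewrite ge_min lexx orbT.
Qed.

Lemma cut_energy_subdifferential K x z : 0 <= K -> 2 * l2norm x <= K ->
  subdifferential (cut_energy K) x z -> subdifferential (energy G p) x z.
Proof.
move=> K0 xK Hz y; rewrite -(cut_energyE xK).
exact: le_trans (Hz y) (cut_energy_le y K0).
Qed.

Lemma energy_subgradient x : exists z, subdifferential (energy G p) x z.
Proof.
have K0 : 0 <= 2 * l2norm x by rewrite mulr_ge0// l2norm_ge0.
have [L /(_ x)[z Hz _]] := cut_energy_subgradient K0.
by exists z; apply: cut_energy_subdifferential Hz.
Qed.

Lemma edge_osc_comp_mean e x : e \in edges G -> edge_osc e (comp_mean G x) = 0.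
Proof.
move=> eG.
have sym : connect_sym (share_edge G).
  apply: sym_connect_sym => u v.
  by apply: eq_existsb => f; rewrite [in LHS]andbA [in RHS]andbA andbAC.
have eq u v : u \in e -> v \in e -> comp_mean G x u = comp_mean G x v.
  move=> ue ve; apply: eq_bigr => S /imsetP[w _ ->]; congr (_ * _%:R).
  rewrite !inE.
  have uv : share_edge G u v by apply/existsP; exists e; rewrite eG ue ve.
  by rewrite (same_connect_r sym (connect1 uv)).
have e0 : (0 < #|e|)%N by apply: ltn_trans (edge_card_gt1 eG).
have [u [v [ue ve ->]]] := edge_osc_attained (comp_mean G x) e0.
by rewrite (eq u v)// subrr.
Qed.

Lemma energy_comp_mean x : energy G p (comp_mean G x) = 0.
Proof.
rewrite energyE big1// => e eG; rewrite edge_osc_comp_mean// powR0 ?mul0r ?mulr0//.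
by rewrite gt_eqF.
Qed.

End HypergraphEnergy.

(** * Existence *)

Section Existence.
Variables (R : realType) (V : finType).
Notation mu := (@lebesgue_measure R).

Lemma subdifferential_bound (psi : (V -> R) -> R) (L : R) x z : 0 <= L ->
  (forall x y, psi x - psi y <= L * l2norm (x - y)) ->
  subdifferential psi x z -> l2norm z <= L.
Proof.
move=> L0 psiL /(_ (x + z)); rewrite addrAC subrr add0r -sqr_l2norm => h1.
have := psiL (x + z) x; rewrite addrAC subrr add0r => h2.
have := l2norm_ge0 z; rewrite le_eqVlt => /predU1P[z0|z0].
  by rewrite -z0.
by rewrite -(ler_pM2r z0) -expr2; lra.
Qed.

Section Forcing.
Variables (T : R) (h : R -> V -> R).
Hypothesis T_gt0 : 0 < T.
Hypothesis h_int : forall v, intb 0 T (fun s => h s v).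

Definition clamp (t : R) : R := Num.min (Num.max t 0) T.

Lemma clamp_itv t : 0 <= clamp t /\ clamp t <= T.
Proof.
rewrite /clamp; split; last by rewrite ge_min lexx orbT.
by rewrite le_min le_max lexx orbT ltW.
Qed.

Lemma clampE t : 0 <= t -> t <= T -> clamp t = t.
Proof. by move=> t0 tT; rewrite /clamp max_l// min_l. Qed.

Lemma clamp_le s t : s <= t -> 0 <= clamp t - clamp s <= t - s.
Proof.
move=> st; have := T_gt0; rewrite /clamp => T0.
case: (leP (Num.max t 0) T); case: (leP (Num.max s 0) T);
  case: (leP t 0) => ?; case: (leP s 0) => ? ? ?; apply/andP; split; lra.
Qed.

(** Freezing the primitive outside [0, T] makes it uniformly continuous on R. *)
Definition forcing (t : R) : V -> R := fun v => prim 0 (fun s => h s v) (clamp t).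

Lemma forcing_ac : abs_continuous (@l2norm R V) 0 T forcing.
Proof.
apply/ac_vec => v; apply: (@ac_dom1 _ _ _ _ _ 0 T _ _ 1 ler01 (prim_ac (h_int v))).
move=> s t s0 st tT; have t0 := le_trans s0 st; have sT := le_trans st tT.
by rewrite mul1r /forcing !clampE.
Qed.

Lemma forcing_unif (e : R) : 0 < e -> exists2 d : R, 0 < d &
  forall s t : R, `|t - s| < d -> l2norm (forcing t - forcing s) <= e.
Proof.
move=> e0; have [d d0 Hd] := ac_unif forcing_ac e0; exists d => // s t.
have fc r : forcing r = forcing (clamp r).
  by have [c1 c2] := clamp_itv r; rewrite /forcing (clampE c1 c2).
wlog st : s t / s <= t => [W std|].
  have [st|/ltW ts] := leP s t; first exact: W.
  by rewrite l2normB; apply: W => //; rewrite distrC.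
rewrite ger0_norm ?subr_ge0// => std.
have /andP[c1 c2] := clamp_le st.
have [a1 a2] := clamp_itv s; have [b1 b2] := clamp_itv t.
rewrite (fc t) (fc s); apply/ltW/Hd => //; first by rewrite -subr_ge0.
exact: le_lt_trans std.
Qed.

Lemma forcing_continuous v : continuous (fun t => forcing t v).
Proof.
move=> t; apply/cvgrPdist_le => e e0; have [d d0 Hd] := forcing_unif e0.
near=> s; apply: (le_trans (normr_le_l2norm (forcing t - forcing s) v)).
apply: Hd; near: s; apply: cvgr_dist_lt => //; exact: cvg_id.
Unshelve. all: by end_near. Qed.

Lemma forcing_derive : {ae mu, forall t, forall v, 0 < t -> t < T ->
  is_derive t 1 (fun s => forcing s v) (h t v)}.
Proof.
apply: ae_forall => v; apply: aeS (prim_derive (h_int v)) => t H t0 tT.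
have := H t0 tT; apply: near_eq_is_derive; near=> s.
rewrite /forcing clampE// ltW//; near: s; [exact: lt_nbhsr|exact: lt_nbhsl].
Unshelve. all: by end_near. Qed.

End Forcing.

Lemma right_increment (u : R -> V -> R) (t : R) (D : V -> R) :
  (forall v, is_derive t 1 (fun s => u s v) (D v)) ->
  forall e : R, 0 < e -> exists2 d : R, 0 < d & forall b, t < b -> b < t + d ->
    l2norm (u b - u t - (b - t) *: D) <= e * (b - t).
Proof.
move=> Du e e0; pose c := e / (#|V|%:R + 1).
have c0 : 0 < c by rewrite divr_gt0// ltr_wpDl.
have /choice[d Hd] v : exists d : R, 0 < d /\ forall s : R, `|s - t| < d ->
    `|u s v - u t v - D v * (s - t)| <= c * `|s - t|.
  by have /is_deriveP /(_ _ c0)[d d0 H] := Du v; exists d.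
exists (\big[Num.min/1]_v d v).
  by apply: (big_ind (fun z => 0 < z)) => // [p q p0 q0|v _]; [rewrite lt_min p0|case: (Hd v)].
move=> b tb bd; have bt : 0 < b - t by rewrite subr_gt0.
apply: l2norm_le_coord => [|v]; first exact: mulr_gt0.
have [_ Hv] := Hd v; have := Hv b; rewrite gtr0_norm// => /(_ _)/wrap[].
  rewrite ltrBlDl (lt_le_trans bd)// lerD2l.
  by rewrite (bigD1 v)//= ge_min lexx.
by rewrite !fctE [_ *: _]mulrC mulrAC.
Qed.

(** Lipschitz potentials: the limit of the Euler scheme, driven by the primitive
    of the forcing term. *)
Theorem lipschitz_existence (psi : (V -> R) -> R) (L T : R) (h : R -> V -> R)
    (x0 : V -> R) :
  (forall x, exists2 z, subdifferential psi x z & l2norm z <= L) ->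
  0 < T -> (forall v, intb 0 T (fun s => h s v)) ->
  exists x : R -> V -> R, [/\ x 0 = x0, forall v, continuous (fun t => x t v),
    strong_solution psi 0 T h x & {ae mu, forall t, 0 < t -> t < T ->
      l2norm (h t - derive_vec x t) <= L}].
Proof.
move=> sub T0 hi.
have /choice[zeta Hz] y : exists z, subdifferential psi y z /\ l2norm z <= L.
  by have [z z1 z2] := sub y; exists z.
have z1 y := (Hz y).1; have z2 y := (Hz y).2.
pose H := forcing T h; have HU := forcing_unif T0 hi.
pose u := flow zeta H x0.
have uL := flow_lipschitz z1 z2 x0 HU.
have uLv v s t : `|u t v - u s v| <= L * `|t - s|.
  exact: le_trans (normr_le_l2norm (u t - u s) v) (uL s t).
have L0 : 0 <= L := le_trans (l2norm_ge0 _) (z2 x0).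
have acu : abs_continuous (@l2norm R V) 0 T u.
  apply: (ac_dom1 L0 (@ac_id R 0 T)) => s t _ st _.
  exact: uL.
have aeu : {ae mu, forall t, forall v, 0 < t -> t < T -> derivable (fun s => u s v) t 1}.
  by apply: ae_forall => v; exact: (lipschitz_derivable_ae _ _ (uLv v)).
pose x t := u t + H t.
have key : {ae mu, forall t, 0 < t -> t < T -> derivable_vec x t /\
    (subdifferential psi (x t) (h t - derive_vec x t) /\
     l2norm (h t - derive_vec x t) <= L)}.
  apply: aeS (aeI aeu (forcing_derive hi)) => t [du dH] t0 tT.
  have du' : derivable_vec u t by move=> v; exact: du.
  have {}du' := is_derive_vec du'.
  have [dx xE] : derivable_vec x t /\ derive_vec x t = derive_vec u t + h t.
    apply: derive_vecE => v; have := du' v; have := dH v t0 tT => ? ?.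
    exact: is_deriveD.
  split=> //; rewrite xE opprD addrCA subrr addr0.
  have sg : subdifferential psi (x t) (- derive_vec u t).
    exact: (flow_subgradient z1 z2 HU (ltW t0) (right_increment du')).
  split => //; apply: (subdifferential_bound L0 _ sg) => y y'.
  exact: (psi_lipschitz z1 z2).
exists x; split.
- rewrite /x /u flow0//.
  have -> : H 0 = 0.
    by apply/funext => v; rewrite /H /forcing clampE ?(ltW T0)// prim0.
  by rewrite addr0.
- move=> v t; apply: cvgD; first exact: (lipschitz_continuous (uLv v)).
  exact: forcing_continuous.
- split; first (apply/ac_vec => v; apply: acD; first exact: (ac_vec _ _ _).1).
    exact: (ac_vec _ _ _).1 (forcing_ac hi) v.
  by apply: aeS key => t K t0 tT; have [? []] := K t0 tT.
- by apply: aeS key => t K t0 tT; have [? []] := K t0 tT.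
Qed.

(** The energy is cut beyond a bound that the solution cannot reach: it stays
    within [|x0 - v| + \int |h|] of the stationary solution [v = comp_mean x0]. *)
Theorem energy_existence (G : hypergraph R V) (p T : R) (h : R -> V -> R)
    (x0 : V -> R) : 1 <= p -> 0 < T -> (forall v, intb 0 T (fun s => h s v)) ->
  exists x : R -> V -> R, [/\ x 0 = x0, forall v, continuous (fun t => x t v),
    strong_solution (energy G p) 0 T h x,
    exists L, {ae mu, forall t, 0 < t -> t < T -> l2norm (h t - derive_vec x t) <= L} &
    acR 0 T (fun t => energy G p (x t))].
Proof.
move=> p1 T0 hi; pose v := comp_mean G x0.
have hni : intb 0 T (fun s => l2norm (h s)) := intb_l2norm hi.
pose rho := l2norm (x0 - v) + prim 0 (fun s => l2norm (h s)) T.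
pose K := 2 * (l2norm v + rho).
have prim_ge0 t : 0 <= prim 0 (fun s => l2norm (h s)) t.
  by apply: Rintegral_ge0 => s _; exact: l2norm_ge0.
have K0 : 0 <= K by rewrite mulr_ge0// !addr_ge0// l2norm_ge0.
have [L HL] := cut_energy_subgradient G p1 K0.
have [x [xE cx solx zL]] := lipschitz_existence x0 HL T0 hi.
have cut0 : subdifferential (cut_energy G p K) v 0.
  move=> y; rewrite dotV0l addr0 (_ : cut_energy G p K v = 0) ?cut_energy_ge0//.
  apply/eqP; rewrite eq_le cut_energy_ge0// andbT.
  by rewrite -(energy_comp_mean G p1 x0) cut_energy_le.
have xK t : 0 <= t -> t <= T -> 2 * l2norm (x t) <= K.
  move=> t0 tT.
  have sol0 := @strong_solution_cst R V _ 0 t _ _ cut0.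
  have solt : strong_solution (cut_energy G p K) 0 t h x by exact: strong_solutionS solx.
  have := contraction t0 solt sol0.
  have -> : (fun s => l2norm (h s - 0)) = (fun s => l2norm (h s)).
    by apply/funext => s; rewrite subr0.
  move=> /(_ (intbS (lexx 0) tT hni)); rewrite xE => h1.
  have h2 := prim_split t0 tT hni.
  have h3 : 0 <= prim t (fun s => l2norm (h s)) T.
    by apply: Rintegral_ge0 => s _; exact: l2norm_ge0.
  have h4 := l2normD (x t - v) v; rewrite subrK in h4.
  rewrite /K /rho; lra.
have enE t : 0 <= t -> t <= T -> energy G p (x t) = cut_energy G p K (x t).
  by move=> t0 tT; rewrite cut_energyE//; exact: xK.
exists x; split => //; last first.
- case: solx => acx _.
  have L0 : 0 <= L by have [z _] := HL x0; exact: le_trans (l2norm_ge0 _).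
  apply: (ac_dom1 L0 acx) => s t s0 st tT.
  rewrite !enE ?(le_trans s0 st)// ?(le_trans st tT)//.
  have /choice[zeta Hz] y : exists z, subdifferential (cut_energy G p K) y z /\ l2norm z <= L.
    by have [z z1 z2] := HL y; exists z.
  have lip := psi_lipschitz (fun y => (Hz y).1) (fun y => (Hz y).2) .
  by rewrite ler_norml lerNl opprB lip andbT l2normB lip.
- by exists L.
case: solx => acx aex; split => //; apply: aeS aex => t H t0 tT.
have [dx sub] := H t0 tT; split => //.
by apply: cut_energy_subdifferential sub => //; apply: xK; exact: ltW.
Qed.

End Existence.

(** * Lebesgue and Sobolev spaces on an interval *)

Section LebesgueSpaces.
Variables (R : realType) (V : finType).
Notation mu := (@lebesgue_measure R).
Implicit Types (T r : R) (f : R -> V -> R).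

Lemma Lnorm_ltyP T r f : r != 0 ->
  (forall v, measurable_fun `]0, T[ (fun t => f t v)) ->
  ('N[mu]_(r%:E)[EFin \o ((fun t => l2norm (f t)) \_ `]0, T[)%R] < +oo)%E <->
  intb 0 T (fun t => l2norm (f t) `^ r).
Proof.
move=> r0 mf; set F := (X in EFin \o X); pose D : set R := `]0, T[%classic.
have mp : measurable_fun `]0, T[ (fun t => l2norm (f t) `^ r).
  apply: (measurableT_comp (measurable_powR r)); exact: measurable_l2norm.
have E : ('N[mu]_(r%:E)[EFin \o F] `^ r = \int[mu]_(t in D) (l2norm (f t) `^ r)%:E)%E.
  rewrite poweR_Lnorm// [RHS]integral_mkcond; apply: eq_integral => t _ /=.
  rewrite /F patchE [RHS]patchE; case: ifPn => _ /=.
    by rewrite ger0_norm ?l2norm_ge0.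
  by rewrite normr0 powR0.
have E' : (\int[mu]_(t in D) `|(EFin \o (fun t => (l2norm (f t) `^ r)%R)) t|)%E =
    ('N[mu]_(r%:E)[EFin \o F] `^ r)%E.
  by rewrite E; apply: eq_integral => t _ /=; rewrite ger0_norm ?powR_ge0.
split=> [N|/integrableP[_]].
  apply/integrableP; split; first exact/measurable_EFinP.
  by rewrite E'; exact: poweR_lty.
by rewrite E'; exact: lty_poweRy.
Qed.

Lemma inL2P T f : inL 2%:E T f <->
  (forall v, measurable_fun `]0, T[ (fun t => f t v)) /\
  intb 0 T (fun t => l2norm (f t) ^+ 2).
Proof.
have E : (fun t => l2norm (f t) `^ 2) = (fun t => l2norm (f t) ^+ 2).
  by apply/funext => t; rewrite powR_mulrn ?l2norm_ge0.
by split=> -[mf N]; split=> //; move: N; rewrite Lnorm_ltyP// E.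
Qed.

Lemma inL1P T f : inL 1%:E T f <->
  (forall v, measurable_fun `]0, T[ (fun t => f t v)) /\
  intb 0 T (fun t => l2norm (f t)).
Proof.
have E : (fun t => l2norm (f t) `^ 1) = (fun t => l2norm (f t)).
  by apply/funext => t; rewrite powRr1 ?l2norm_ge0.
by split=> -[mf N]; split=> //; move: N; rewrite Lnorm_ltyP ?oner_eq0// E.
Qed.

Lemma inLy T f (M : R) : (forall v, measurable_fun `]0, T[ (fun t => f t v)) -> 0 <= M ->
  {ae mu, forall t, 0 < t -> t < T -> l2norm (f t) <= M} -> inL +oo%E T f.
Proof.
move=> mf M0 aef; split=> //; rewrite unlock; case: ifPn => // _.
apply: (@le_lt_trans _ _ M%:E); last exact: ltry.
apply/ess_supP; apply: aeS aef => t H /=.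
rewrite patchE; case: ifPn => [|_]; last by rewrite normr0 lee_fin.
rewrite inE/= in_itv/= => /andP[t0 tT].
by rewrite lee_fin ger0_norm ?l2norm_ge0// H.
Qed.

(** The residual [h - x'] is controlled at almost every time only. *)
Lemma intb_dominated_ae (a b : R) (f g : R -> R) : measurable_fun `]a, b[ f ->
  (forall s, 0 <= g s) ->
  {ae mu, forall s, a < s -> s < b -> `|f s| <= g s} -> intb a b g -> intb a b f.
Proof.
move=> mf g0 fg /integrableP[mg gi]; apply/integrableP; split.
  exact/measurable_EFinP.
apply: le_lt_trans gi; apply: ae_ge0_le_integral => //.
- by apply: measurableT_comp => //; exact/measurable_EFinP.
- by apply: measurableT_comp.
apply: aeS fg => s H /=; rewrite in_itv/= => /andP[as_ sb].
by rewrite lee_fin (ger0_norm (g0 s)) H.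
Qed.

Lemma intb_of_sqr (a b : R) (f : R -> R) : measurable_fun `]a, b[ f ->
  intb a b (fun s => f s ^+ 2) -> intb a b f.
Proof.
move=> mf f2; apply: (intb_dominated mf (g := fun s => 1 + f s ^+ 2)).
  move=> s _ _; have := sqr_ge0 (`|f s| - 1); rewrite sqrrB1 real_normK ?num_real//.
  have := normr_ge0 (f s); lra.
by apply: integrableD_fun => //; exact: intb_cst.
Qed.

Lemma intb_coord (a b : R) f : (forall v, measurable_fun `]a, b[ (fun t => f t v)) ->
  intb a b (fun t => l2norm (f t)) -> forall v, intb a b (fun t => f t v).
Proof.
by move=> mf fi v; apply: (intb_dominated _ _ fi) => // s _ _; exact: normr_le_l2norm.
Qed.

End LebesgueSpaces.

(** * Integration by parts against test functions *)

Section TestFunctions.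
Variables (R : realType) (T : R).
Notation mu := (@lebesgue_measure R).
Hypothesis T_gt0 : 0 < T.
Implicit Types (psi f df : R -> R).

Lemma test_function0 psi (t : R) : test_function T psi -> ~ (0 < t /\ t < T) -> psi t = 0.
Proof.
move=> [_ _ _ sub] nt; apply/eqP; apply: contrapT => /negP pt.
have /sub : closure [set t | psi t != 0] t by exact: subset_closure.
by rewrite /= in_itv/= => /andP.
Qed.

Lemma test_function_derive psi (t : R) : test_function T psi ->
  is_derive t 1 psi (derive1 psi t).
Proof. by case=> d _ _ _; apply: DeriveDef => //; rewrite derive1E. Qed.

Lemma test_function_ac psi : test_function T psi -> acR 0 T psi.
Proof.
move=> tp; have [_ cd _ _] := tp.
have [M M0 HM] : exists2 M, 0 < M & forall t, 0 <= t -> t <= T -> `|derive1 psi t| <= M.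
  by apply: within_bounded; apply: continuous_subspaceT.
apply: (ac_dom1 (ltW M0) (@ac_id R 0 T)) => s t s0 st tT.
move: st; rewrite le_eqVlt => /predU1P[->|st]; first by rewrite !subrr normr0 mulr0.
have [|c + ->] := MVT st (fun x _ => test_function_derive x tp).
  apply: continuous_subspaceT => x; apply: differentiable_continuous.
  by apply/derivable1_diffP; case: tp.
rewrite in_itv/= => /andP[sc ct]; rewrite normrM ler_wpM2r// HM//.
  exact: le_trans s0 (ltW sc).
exact: le_trans (ltW ct) tT.
Qed.

(** The product of [f] and the test function is absolutely continuous and
    vanishes at both ends. *)
Lemma test_function_by_parts psi f df : test_function T psi ->
  acR 0 T f -> intb 0 T df ->
  {ae mu, forall t, 0 < t -> t < T -> is_derive t 1 f (df t)} ->
  \int[mu]_(s in `]0, T[) (f s * derive1 psi s) =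
  - \int[mu]_(s in `]0, T[) (df s * psi s).
Proof.
move=> tp acf dfi aef; have acp := test_function_ac tp.
have [_ cd _ _] := tp.
have [M M0 HM] := ac_bounded acp; have [N N0 HN] := ac_bounded acf.
have [M' M'0 HM'] : exists2 M, 0 < M & forall t, 0 <= t -> t <= T -> `|derive1 psi t| <= M.
  by apply: within_bounded; apply: continuous_subspaceT.
have mp : measurable_fun `]0, T[ psi.
  apply: measurable_funTS; apply: continuous_measurable_fun => x.
  apply: differentiable_continuous; apply/derivable1_diffP; by case: tp.
have mdp : measurable_fun `]0, T[ (derive1 psi).
  by apply: measurable_funTS; exact: continuous_measurable_fun.
have mf : measurable_fun `]0, T[ f.
  apply: (@measurable_funS _ _ _ _ `[0, T]%classic) => //.
    by apply: subset_itv; rewrite bnd_simp.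
  by apply: subspace_continuous_measurable_fun => //; exact: ac_within.
have i1 : intb 0 T (fun s => df s * psi s).
  apply: (@intb_dominated _ _ _ _ (fun s => M * `|df s|)).
  - by apply: measurable_funM => //; exact: intb_measurable.
  - by move=> s s0 sT; rewrite normrM mulrC ler_wpM2r// HM// ltW.
  - by apply: integrableZ_fun => //; exact: integrable_norm.
have i2 : intb 0 T (fun s => f s * derive1 psi s).
  apply: (@intb_bounded _ _ _ (N * M')); first exact: measurable_funM.
  by move=> s s0 sT; rewrite normrM ler_pM// ?HN ?HM'// ltW.
have := @ac_ftc R 0 T (fun s => f s * psi s) (fun s => df s * psi s + f s * derive1 psi s)
  (ltW T_gt0).
move=> /(_ _ _ _)/wrap[].
- exact: acM.
- exact: integrableD_fun.
- apply: aeS aef => t H t0 tT; apply: is_deriveM_fun; first exact: H.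
  exact: test_function_derive.
rewrite !(test_function0 tp) ?ltxx; try by case; rewrite ?ltxx.
by rewrite !mulr0 subrr /prim RintegralD// => h; lra.
Qed.

End TestFunctions.

(** * Translation invariance of null sets *)

Section Shift.
Variable R : realType.
Notation mu := (@lebesgue_measure R).

Lemma measurable_shift (d : R) : measurable_fun setT (fun t : R => t + d).
Proof.
apply: continuous_measurable_fun => t.
by apply: cvgD; [exact: cvg_id|exact: cvg_cst].
Qed.

Lemma lebesgue_measure_shift (d : R) (A : set (measurableTypeR R)) : measurable A ->
  mu ((fun t => t + d) @^-1` A) = mu A.
Proof.
move=> mA; pose f : measurableTypeR R -> measurableTypeR R := fun t => t + d.
have mf : measurable_fun [set: measurableTypeR R] f by exact: measurable_shift.
pose nu : {measure set (measurableTypeR R) -> \bar R} :=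
  measure_function_pushforward__canonical__measure_function_Measure mu mf.
change (nu A = mu A); apply/esym.
apply: (lebesgue_measure_unique (mu := nu)) => // X [[a b] _ <-].
change (mu `]a, b]%classic = mu (f @^-1` `]a, b]%classic)).
have -> : f @^-1` `]a, b]%classic = `]a - d, b - d]%classic.
  by apply/seteqP; split => t /=; rewrite !in_itv/= ltrBlDr lerBrDr.
rewrite [LHS]lebesgue_measure_itv [RHS]lebesgue_measure_itv /= !lte_fin ltrD2r.
by case: ifP => // _; rewrite -!EFinD; congr EFin; ring.
Qed.

Lemma ae_shift (d : R) (P : R -> Prop) : {ae mu, forall t, P t} ->
  {ae mu, forall t, P (t + d)}.
Proof.
move=> [A [mA A0 PA]]; exists ((fun t => t + d) @^-1` A); split.
- by rewrite -[X in measurable X]setTI; apply: measurable_shift.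
- by rewrite lebesgue_measure_shift.
- by move=> t Pt; apply: PA.
Qed.

End Shift.

(** * Weakly differentiable functions are indefinite integrals *)

Section DuBoisReymond.
Variable R : realType.
Notation mu := (@lebesgue_measure R).
Implicit Types (r s t c d : R).

(** [sabs] is a primitive of [|r|]; second differences of the absolute value and
    of [sabs] give a hat function of height [d] on [-d, d] and its primitive. *)
Definition sabs r : R := r * `|r| / 2.
Definition hat d r : R := (`|r + d| + `|r - d| - 2 * `|r|) / 2.
Definition hatprim d r : R := (sabs (r + d) + sabs (r - d) - 2 * sabs r) / 2.

Lemma is_derive_sabs r : is_derive r 1 sabs `|r|.
Proof.
have [r0|r0|r0] := ltgtP r 0.
- apply: (@near_eq_is_derive _ _ _ (fun s => - (s * s) / 2)).
    near=> s; rewrite /sabs ltr0_norm ?mulrN//; near: s; exact: lt_nbhsl.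
  have := is_deriveM_fun (is_derive_id r 1) (is_derive_id r 1) => h1.
  have := is_deriveM_fun (is_deriveN h1) (is_derive_cst (2^-1 : R) r 1).
  rewrite ltr0_norm// => h2; apply: (is_derive_eq h2) => /=.
  by field.
- apply: (@near_eq_is_derive _ _ _ (fun s => s * s / 2)).
    near=> s; rewrite /sabs gtr0_norm//; near: s; exact: lt_nbhsr.
  have := is_deriveM_fun (is_derive_id r 1) (is_derive_id r 1) => h1.
  have := is_deriveM_fun h1 (is_derive_cst (2^-1 : R) r 1).
  rewrite gtr0_norm// => h2; apply: (is_derive_eq h2) => /=.
  by field.
- rewrite r0 normr0; apply/is_deriveP => e e0; exists e => // s.
  rewrite !subr0 mul0r subr0 /sabs mul0r mul0r subr0 => se.
  have h2 : `|2^-1 : R| = 2^-1 by rewrite ger0_norm// invr_ge0.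
  rewrite !normrM normr_id h2 mulrAC ler_wpM2r//.
  by have := normr_ge0 s; lra.
Unshelve. all: by end_near. Qed.

Lemma is_derive_shift (f : R -> R) c t (df : R) : is_derive (t + c) 1 f df ->
  is_derive t 1 (fun s => f (s + c)) df.
Proof.
move=> /is_deriveP H; apply/is_deriveP => e /H[d d0 Hd]; exists d => // s.
by have := Hd (s + c); rewrite opprD addrACA subrr addr0.
Qed.

Lemma is_derive_hatprim d c t : is_derive t 1 (fun s => hatprim d (s - c)) (hat d (t - c)).
Proof.
apply: is_derive_shift; set r := t - c.
have h1 := is_derive_shift (is_derive_sabs (r + d)).
have h2 := is_derive_shift (is_derive_sabs (r - d)).
have h3 := is_deriveM_fun (is_derive_cst (2 : R) r 1) (is_derive_sabs r).
rewrite mul0r add0r in h3.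
have h4 := is_deriveB (is_deriveD h1 h2) h3.
have := is_deriveM_fun h4 (is_derive_cst (2^-1 : R) r 1).
by rewrite mulr0 addr0.
Qed.

Lemma hat_ge0 d r : 0 <= hat d r.
Proof.
rewrite /hat divr_ge0// subr_ge0.
have := ler_normD (r + d) (r - d); rewrite addrACA subrr addr0 -mulr2n normrMn.
by rewrite mulr_natl.
Qed.

Lemma hat_out d r : 0 <= d -> d <= `|r| -> hat d r = 0.
Proof.
move=> d0; rewrite /hat; have [r0|r0] := leP 0 r; rewrite ?(ger0_norm r0) ?(ltr0_norm r0) => dr.
  by rewrite !ger0_norm; lra.
by rewrite !ler0_norm; lra.
Qed.

Lemma hatprim_right d r : 0 <= d -> d <= r -> hatprim d r = d ^+ 2 / 2.
Proof.
by move=> d0 dr; rewrite /hatprim /sabs !ger0_norm; [field|lra..].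
Qed.

Lemma hatprim_left d r : 0 <= d -> r <= - d -> hatprim d r = - (d ^+ 2 / 2).
Proof.
by move=> d0 dr; rewrite /hatprim /sabs !ler0_norm; [field|lra..].
Qed.

Lemma continuous_hat d c : continuous (fun s => hat d (s - c)).
Proof.
have cs (k : R) : continuous (fun s : R => `|s + k|).
  by move=> s; apply: cvg_norm; apply: cvgD; [exact: cvg_id|exact: cvg_cst].
move=> s; rewrite /hat; apply: cvgMl; apply: cvgB; first apply: cvgD.
- under eq_fun do rewrite -addrA; rewrite -addrA; exact: cs.
- under eq_fun do rewrite -addrA; rewrite -addrA; exact: cs.
- by apply: cvgMr; exact: cs.
Qed.

(** The two hats have equal integrals, so the primitive of their difference
    vanishes outside [a - d, b + d]. *)
Lemma test_function_hats T a b d : 0 < d -> d < a -> a <= b -> b < T - d ->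
  test_function T (fun s => hatprim d (s - a) - hatprim d (s - b)) /\
  derive1 (fun s => hatprim d (s - a) - hatprim d (s - b)) =
    (fun s => hat d (s - a) - hat d (s - b)).
Proof.
move=> d0 da ab bT; set psi := fun s => _.
have dpsi t : is_derive t 1 psi (hat d (t - a) - hat d (t - b)).
  have := is_derive_hatprim d a t; have := is_derive_hatprim d b t => ? ?.
  exact: is_deriveB.
have dE : derive1 psi = (fun s => hat d (s - a) - hat d (s - b)).
  by apply/funext => t; rewrite derive1E; case: (dpsi t).
have sub : closure [set t | psi t != 0] `<=` `[a - d, b + d].
  have /closure_id -> : closed (`[a - d, b + d]%classic : set R) by exact: interval_closed.
  apply: closureS => t /=; apply: contra_neqP => /negP.
  rewrite in_itv/= negb_and -!ltNge => /orP[ta|tb]; rewrite /psi.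
    by rewrite !hatprim_left ?subrr; lra.
  by rewrite !hatprim_right ?subrr; lra.
split=> //; split.
- by move=> t; case: (dpsi t).
- by rewrite dE => t; apply: cvgB; exact: continuous_hat.
- apply: subclosed_compact sub; first exact: closed_closure.
  exact: segment_compact.
- by apply: subset_trans sub _; apply: subset_itv; rewrite bnd_simp; lra.
Qed.

Lemma within_near T (f : R -> R) t : {within `[0, T], continuous f} ->
  0 <= t -> t <= T -> forall e : R, 0 < e -> exists2 d : R, 0 < d &
  forall s, 0 <= s -> s <= T -> `|s - t| < d -> `|f s - f t| <= e.
Proof.
move=> /subspace_continuousP cf t0 tT e e0.
have := cf t; rewrite /= in_itv/= t0 tT => /(_ isT)/cvgrPdist_le/(_ e e0).
rewrite near_withinE => /nbhs_ballP[d /= d0 Hd]; exists d => // s s0 sT sd.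
rewrite distrC; apply: Hd; first by rewrite /ball/= distrC.
by rewrite /= in_itv/= s0.
Qed.

Lemma intb_within (a b : R) (f : R -> R) : {within `[a, b], continuous f} -> intb a b f.
Proof.
move=> cf; have [M _ HM] := within_bounded cf.
apply: (@intb_bounded _ _ _ M) => [|s s0 sT]; last by apply: HM; exact: ltW.
apply: (@measurable_funS _ _ _ _ `[a, b]%classic) => //.
  by apply: subset_itv; rewrite bnd_simp.
exact: subspace_continuous_measurable_fun.
Qed.

Lemma ac_hatprim T d c : acR 0 T (fun s => hatprim d (s - c)).
Proof.
have acs (k k' : R) : acR 0 T (fun s => sabs (s + k + k')).
  have aci : acR 0 T (fun s => s + k + k').
    by apply: acD (ac_cst _ _ _); apply: acD (ac_cst _ _ _); exact: ac_id.
  apply: acM; last exact: ac_cst.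
  apply: acM => //; apply: (ac_dom1 ler01 aci) => s t _ _ _; rewrite mul1r.
  exact: ler_dist_dist.
rewrite /hatprim; apply: acM; last exact: ac_cst.
apply: acB; first by apply: acD; exact: acs.
apply: acM; first exact: ac_cst.
rewrite (_ : (fun s => sabs (s - c)) = fun s => sabs (s - c + 0)); first exact: acs.
by apply/funext => s; rewrite addr0.
Qed.

(** A continuous function with [u b < u a] would have a positive integral against
    the difference of two narrow hats at [a] and [b]. *)
Lemma weak_derivative_le (T : R) (u : R -> R) : 0 < T ->
  {within `[0, T], continuous u} ->
  (forall psi, test_function T psi ->
     \int[mu]_(s in `]0, T[) (u s * derive1 psi s) = 0) ->
  forall a b, 0 < a -> a < b -> b < T -> u a <= u b.
Proof.
move=> T0 cu H a b a0 ab bT; rewrite leNgt; apply/negP => uba.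
pose c := (u a + u b) / 2; pose eta := (u a - u b) / 4.
have eta0 : 0 < eta by rewrite divr_gt0// subr_gt0.
have aT : a < T := lt_trans ab bT; have b0 : 0 < b := lt_trans a0 ab.
have [d1 d10 H1] := within_near cu (ltW a0) (ltW aT) eta0.
have [d2 d20 H2] := within_near cu (ltW b0) (ltW bT) eta0.
have m0 : 0 < Num.min (Num.min d1 d2) (Num.min a (T - b)).
  by rewrite !lt_min d10 d20 a0 subr_gt0.
pose d := Num.min (Num.min d1 d2) (Num.min a (T - b)) / 2.
have d0 : 0 < d by rewrite divr_gt0.
have : d < Num.min (Num.min d1 d2) (Num.min a (T - b)) by rewrite /d; lra.
rewrite lt_min => /andP[]; rewrite lt_min => /andP[dd1 dd2].
rewrite lt_min => /andP[da db].
have bTd : b < T - d by lra.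
have [tp dpsi] := test_function_hats d0 da (ltW ab) bTd.
set psi := (X in test_function T X) in tp dpsi.
have I1 := H psi tp.
have I2 : \int[mu]_(s in `]0, T[) (1 * derive1 psi s) = 0.
  rewrite (test_function_by_parts T0 tp (f := fun=> 1) (df := fun=> 0)).
  - rewrite (_ : (fun s => 0 * psi s) = fun=> 0) ?Rintegral_cst//= ?mul0r ?oppr0//.
    by apply/funext => s; rewrite mul0r.
  - exact: ac_cst.
  - exact: intb_cst.
  - by apply: aeW => t _ _; exact: is_derive_cst.
have cha : {within `[0, T], continuous (fun s => hat d (s - a))}.
  by apply: continuous_subspaceT; exact: continuous_hat.
have cdp : {within `[0, T], continuous (derive1 psi)}.
  by apply: continuous_subspaceT; case: tp.
have i1 : intb 0 T (fun s => u s * derive1 psi s).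
  by apply: intb_within => s; apply: cvgM; [exact: cu|exact: cdp].
have i2 : intb 0 T (fun s => 1 * derive1 psi s).
  by apply: intb_within => s; apply: cvgM; [exact: cvg_cst|exact: cdp].
have i3 : intb 0 T (fun s => hat d (s - a)) by exact: intb_within.
have I3 : \int[mu]_(s in `]0, T[) (hat d (s - a)) = d ^+ 2.
  have := ac_ftc (ltW T0) (ac_hatprim T d a) i3.
  move=> /(_ _)/wrap[]; first by apply: aeW => t _ _; exact: is_derive_hatprim.
  rewrite /prim => <-.
  by rewrite hatprim_right ?(ltW d0) ?hatprim_left ?(ltW d0)//; [field|lra..].
have : eta * \int[mu]_(s in `]0, T[) (hat d (s - a)) <=
    \int[mu]_(s in `]0, T[) (u s * derive1 psi s) - c * \int[mu]_(s in `]0, T[) (1 * derive1 psi s).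
  rewrite -!RintegralZl// -RintegralB//; last exact: integrableZ_fun.
  apply: le_Rintegral => //; first exact: integrableZ_fun.
    by apply: integrableB_fun => //; exact: integrableZ_fun.
  move=> s /=; rewrite in_itv/= => /andP[s0 sT].
  rewrite mul1r dpsi -mulrBl mulrBr.
  have ha := hat_ge0 d (s - a); have hb := hat_ge0 d (s - b).
  have k1 : eta * hat d (s - a) <= (u s - c) * hat d (s - a).
    have [sd|ds] := ltP `|s - a| d; last by rewrite hat_out ?(ltW d0)// !mulr0.
    rewrite ler_wpM2r//.
    have := H1 s (ltW s0) (ltW sT) (lt_trans sd dd1) => /ler_normlP[]; rewrite /c /eta; lra.
  have k2 : (u s - c) * hat d (s - b) <= 0.
    have [sd|ds] := ltP `|s - b| d; last by rewrite hat_out ?(ltW d0)// mulr0.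
    rewrite mulr_le0_ge0//.
    have := H2 s (ltW s0) (ltW sT) (lt_trans sd dd2) => /ler_normlP[]; rewrite /c /eta; lra.
  lra.
rewrite I1 I2 I3 mulr0 subr0 leNgt mulr_gt0//.
by rewrite exprn_gt0.
Qed.

(** Points of [0, T] are limits of interior points, where the previous lemma
    applies to [u] and to [- u]. *)
Lemma weak_derivative_constant (T : R) (u : R -> R) : 0 < T ->
  {within `[0, T], continuous u} ->
  (forall psi, test_function T psi ->
     \int[mu]_(s in `]0, T[) (u s * derive1 psi s) = 0) ->
  forall a b, 0 <= a -> a <= T -> 0 <= b -> b <= T -> u a = u b.
Proof.
move=> T0 cu H.
have cNu : {within `[0, T], continuous (fun s => - u s)}.
  by move=> s; apply: cvgN; exact: cu.
have HN psi : test_function T psi ->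
    \int[mu]_(s in `]0, T[) (- u s * derive1 psi s) = 0.
  move=> tp; have := H psi tp.
  have i1 : intb 0 T (fun s => u s * derive1 psi s).
    apply: intb_within => s; apply: cvgM; [exact: cu|].
    by apply: continuous_subspaceT; case: tp.
  have -> : (fun s => - u s * derive1 psi s) = (fun s => -1 * (u s * derive1 psi s)).
    by apply/funext => s; rewrite mulN1r mulNr.
  by rewrite RintegralZl// => ->; rewrite mulr0.
have eq a b : 0 < a -> a < T -> 0 < b -> b < T -> u a = u b.
  wlog ab : a b / a < b => [W|] a0 aT b0 bT.
    have [ab|ab|->//] := ltgtP a b; first exact: W.
    by apply/esym; exact: W.
  apply/eqP; rewrite eq_le (weak_derivative_le T0 cu H)//=.
  by rewrite -lerN2 (weak_derivative_le T0 cNu HN).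
have approx a (e : R) : 0 <= a -> a <= T -> 0 < e ->
    exists r, [/\ 0 < r, r < T & `|u r - u a| <= e].
  move=> a0 aT e0; have [d d0 Hd] := within_near cu a0 aT e0.
  pose th := Num.min 2^-1 (d / (T + 1)).
  have T1 : 0 < T + 1 by lra.
  have th0 : 0 < th by rewrite lt_min invr_gt0 ltr0n divr_gt0.
  have th1 : th <= 2^-1 by rewrite ge_min lexx.
  have th2 : th * (T + 1) <= d by rewrite -ler_pdivlMr// ge_min lexx orbT.
  exists (a + th * (T / 2 - a)).
  have h1 : 0 < th * T by rewrite mulr_gt0.
  have h2 : 0 <= th * (T - a) by rewrite mulr_ge0 ?subr_ge0// ltW.
  have h3 : 0 <= th * a by rewrite mulr_ge0// ltW.
  have h4 : th * a <= 2^-1 * a by rewrite ler_wpM2r.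
  have h5 : th * (T - a) <= 2^-1 * (T - a) by rewrite ler_wpM2r// subr_ge0.
  split; [lra|lra|].
  apply: Hd; [lra|lra|].
  by rewrite addrAC subrr add0r ltr_norml; apply/andP; split; lra.
move=> a b a0 aT b0 bT; apply/eqP; rewrite -subr_eq0 -normr_le0.
apply/ler_addgt0Pr => e e0; rewrite add0r.
have e2 : 0 < e / 2 by rewrite divr_gt0.
have [r [r0 rT Hr]] := approx a _ a0 aT e2.
have [q [q0 qT Hq]] := approx b _ b0 bT e2.
rewrite (le_trans (ler_distD (u r) _ _))// (splitr e) lerD//; first by rewrite distrC.
by rewrite (eq r q).
Qed.

End DuBoisReymond.

Section Sobolev.
Variables (R : realType) (V : finType) (T : R).
Notation mu := (@lebesgue_measure R).
Hypothesis T_gt0 : 0 < T.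
Variables (h dh : R -> V -> R).
Hypothesis hW : inW1 1%:E T h dh.

Lemma inW1_int v : intb 0 T (fun s => dh s v).
Proof. by case: hW => _ _ /inL1P[mdh idh] _; exact: intb_coord. Qed.

Lemma inW1_norm_int : intb 0 T (fun s => l2norm (dh s)).
Proof. by case: hW => _ _ /inL1P[]. Qed.

(** The difference of [h] and of the primitive of [dh] has weak derivative zero. *)
Lemma inW1_primitive v s : 0 <= s -> s <= T ->
  h s v = h 0 v + prim 0 (fun r => dh r v) s.
Proof.
move=> s0 sT; have [ch _ _ wd] := hW.
pose D := prim 0 (fun r => dh r v).
have acD : acR 0 T D := prim_ac (inW1_int v).
have cD := ac_within acD.
have := @weak_derivative_constant R T (fun r => h r v - D r) T_gt0.
move=> /(_ _ _ s 0)/wrap[].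
- by move=> r; apply: cvgB; [exact: (ch v)|exact: cD].
- move=> psi tp.
  have cdp : {within `[0, T], continuous (derive1 psi)}.
    by apply: continuous_subspaceT; case: tp.
  have i1 : intb 0 T (fun r => h r v * derive1 psi r).
    by apply: intb_within => r; apply: cvgM; [exact: (ch v)|exact: cdp].
  have i2 : intb 0 T (fun r => D r * derive1 psi r).
    by apply: intb_within => r; apply: cvgM; [exact: cD|exact: cdp].
  under eq_Rintegral do rewrite mulrBl.
  rewrite RintegralB// (wd psi tp v).
  rewrite (test_function_by_parts T_gt0 tp acD (inW1_int v)) ?subrr//.
  exact: prim_derive (inW1_int v).
rewrite s0 sT lexx (ltW T_gt0) => /(_ isT isT isT isT).
by rewrite /D (@prim0 _ 0 0)// subr0 => <-; rewrite subrK.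
Qed.

Lemma inW1_ac : abs_continuous (@l2norm R V) 0 T h.
Proof.
apply/ac_vec => v; apply: (ac_dom1 ler01 (prim_ac (inW1_int v))) => s t s0 st tT.
have t0 := le_trans s0 st; have sT := le_trans st tT.
by rewrite mul1r (inW1_primitive v s0 sT) (inW1_primitive v t0 tT) opprD addrACA subrr add0r.
Qed.

Lemma inW1_derive : {ae mu, forall t, forall v, 0 < t -> t < T ->
  is_derive t 1 (fun s => h s v) (dh t v)}.
Proof.
apply: ae_forall => v; apply: aeS (prim_derive (inW1_int v)) => t H t0 tT.
apply: (@near_eq_is_derive _ _ _ (fun s => h 0 v + prim 0 (fun r => dh r v) s)).
  near=> s; rewrite -inW1_primitive//; apply: ltW; near: s; [exact: lt_nbhsr|exact: lt_nbhsl].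
by have := H t0 tT => ?; rewrite -[dh t v]add0r; exact: is_deriveD.
Unshelve. all: by end_near. Qed.

(** The increment [w] is tested against itself, so that only scalar integrals
    occur. *)
Lemma inW1_increment s t : 0 <= s -> s <= t -> t <= T ->
  l2norm (h t - h s) <= prim s (fun r => l2norm (dh r)) t.
Proof.
move=> s0 st tT.
have i1 : intb s t (fun r => l2norm (dh r)) by apply: intbS inW1_norm_int.
set w := h t - h s.
have iv v : intb s t (fun r => w v * dh r v).
  by apply: integrableZ_fun => //; apply: intbS (inW1_int v).
have sT := le_trans st tT; have t0 := le_trans s0 st.
have E : l2norm w ^+ 2 = prim s (fun r => dotV (dh r) w) t.
  rewrite sqr_l2norm {1}/w dotVBl.
  apply: (@ac_ftc _ s t (fun r => dotV (h r) w)) => //.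
  - apply: (acS s0 tT); apply: ac_dotV inW1_ac _.
    by apply/ac_vec => v; exact: ac_cst.
  - apply: intb_sum => v; rewrite (_ : (fun _ => _) = fun r => w v * dh r v)//.
    by apply/funext => r; rewrite mulrC.
  - apply: aeS inW1_derive => r H sr rt.
    have dr := fun v => H v (le_lt_trans s0 sr) (lt_le_trans rt tT).
    have := is_derive_dotV dr (fun v => is_derive_cst (w v) r 1).
    by rewrite (_ : dotV _ (fun=> 0) = 0) ?addr0// dotVC dotV0l.
have le : l2norm w ^+ 2 <= l2norm w * prim s (fun r => l2norm (dh r)) t.
  rewrite E /prim -RintegralZl//; apply: le_Rintegral => //.
  - apply: intb_sum => v; rewrite (_ : (fun _ => _) = fun r => w v * dh r v)//.
    by apply/funext => r; rewrite mulrC.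
  - exact: integrableZ_fun.
  - by move=> r _; rewrite dotVC; apply: dotV_le.
have [d0|d0] := eqVneq (l2norm w) 0.
  by rewrite d0; apply: Rintegral_ge0 => r _; exact: l2norm_ge0.
by rewrite -(ler_pM2l (x := l2norm w)) ?lt_neqAle ?(eq_sym 0) ?d0 ?l2norm_ge0.
Qed.

End Sobolev.

(** * Continuous functions and right Lebesgue points *)

Section RightLebesguePoint.
Variable R : realType.
Notation mu := (@lebesgue_measure R).

Lemma normr_mean_le (t tau e : R) (f : R -> R) : 0 < tau -> intb t (t + tau) f ->
  (forall s, t < s -> s < t + tau -> `|f s| <= e) ->
  `|tau^-1 * \int[mu]_(s in `]t, (t + tau)[) f s| <= e.
Proof.
move=> tau0 fi fe; rewrite normrM gtr0_norm ?invr_gt0// mulrC ler_pdivrMr//.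
rewrite (le_trans (le_normr_Rintegral _ fi))//.
have tE : e * tau = prim t (fun=> e) (t + tau).
  by rewrite prim_cst ?lerDl ?(ltW tau0)// addrAC subrr add0r.
rewrite tE; apply: le_Rintegral => //.
- exact: (integrable_norm fi).
- exact: intb_cst.
- by move=> s /=; rewrite in_itv/= => /andP[ts st]; exact: fe.
Qed.

Lemma continuous_right_lebesgue_point (V : finType) (T t : R)
    (h : R -> V -> R) : (forall v, {within `[0, T], continuous (fun s => h s v)}) ->
  0 <= t -> t < T -> right_lebesgue_point h t /\ right_value h t = h t.
Proof.
move=> ch t0 tT.
have small (c : V -> R) (e : R) : 0 < e -> c = h t -> exists2 d : R, 0 < d &
    forall s, t < s -> s < t + d -> s < T /\ l2norm (h s - c) <= e.
  move=> e0 ->; pose k := e / (#|V|%:R + 1).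
  have k0 : 0 < k by rewrite divr_gt0// ltr_wpDl.
  have /choice[d Hd] v : exists d : R, 0 < d /\ forall s, 0 <= s -> s <= T ->
      `|s - t| < d -> `|h s v - h t v| <= k.
    by have [d d0 Hd] := within_near (ch v) t0 (ltW tT) k0; exists d.
  exists (Num.min (T - t) (\big[Num.min/1]_v d v)).
    rewrite lt_min subr_gt0 tT.
    by apply: (big_ind (fun z => 0 < z)) => // [p q p0 q0|v _]; [rewrite lt_min p0|case: (Hd v)].
  move=> s ts; rewrite -ltrBlDl lt_min => /andP[s1 s2].
  have sT : s < T by lra.
  split=> //; apply: l2norm_le_coord => // v.
  have [_ Hv] := Hd v; apply: Hv; [lra|lra|].
  rewrite gtr0_norm ?subr_gt0// (lt_le_trans s2)//.
  by rewrite (bigD1 v)//= ge_min lexx.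
have hi v : intb 0 T (fun s => h s v) by exact: intb_within.
have near_right (e : R) : 0 < e -> \forall tau \near (0:R)^'+, [/\ 0 < tau, t + tau <= T &
    forall s, t < s -> s < t + tau -> l2norm (h s - h t) <= e].
  move=> e0; have [d d0 Hd] := small _ e e0 erefl.
  near=> tau; have tau0 : 0 < tau by near: tau; exact: nbhs_right_gt.
  have taud : tau < d by near: tau; exact: nbhs_right_lt.
  have tauT : tau < T - t by near: tau; apply: nbhs_right_lt; rewrite subr_gt0.
  split=> [//||s ts st]; first by lra.
  by have [|_] := Hd s ts; first by lra.
have mean_cvg v : right_mean h t tau v @[tau --> (0:R)^'+] --> h t v.
  apply/cvgrPdist_le => e e0; near=> tau.
  have [tau0 tauT Hs] : [/\ 0 < tau, t + tau <= T &
    forall s, t < s -> s < t + tau -> l2norm (h s - h t) <= e].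
    by near: tau; exact: near_right.
  have ttau : t <= t + tau by rewrite lerDl ltW.
  have i1 : intb t (t + tau) (fun s => h s v) by apply: intbS (hi v).
  have i2 := intb_cst t (t + tau) (h t v).
  have -> : h t v - right_mean h t tau v =
      tau^-1 * \int[mu]_(s in `]t, (t + tau)[) (h t v - h s v).
    rewrite RintegralB// -/(prim t (fun=> h t v) (t + tau)) prim_cst//.
    by rewrite (addrAC t) subrr add0r mulrBr [X in _ = X - _]mulrC mulfK ?gt_eqF.
  apply: normr_mean_le => //; first exact: integrableB_fun.
  move=> s ts st; rewrite distrC; apply: le_trans (Hs s ts st).
  exact: (normr_le_l2norm (h s - h t)).
have valE : right_value h t = h t by apply/funext => v; apply/cvg_lim.
split=> //; split; first by move=> v; apply/cvg_ex; exists (h t v).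
rewrite valE; apply/cvgrPdist_le => e e0; near=> tau.
have [tau0 tauT Hs] : [/\ 0 < tau, t + tau <= T &
  forall s, t < s -> s < t + tau -> l2norm (h s - h t) <= e].
  by near: tau; exact: near_right.
rewrite sub0r normrN; apply: normr_mean_le => //.
  apply: intb_l2norm => v; apply: integrableB_fun => //; last exact: intb_cst.
  by apply: intbS (hi v).
by move=> s ts st; rewrite ger0_norm ?l2norm_ge0//; exact: Hs.
Unshelve. all: by end_near. Qed.

End RightLebesguePoint.

(** * The energy inequality *)

Section EnergyInequality.
Variables (R : realType) (V : finType).
Notation mu := (@lebesgue_measure R).

Lemma intb_dot (a b : R) (f g : R -> V -> R) :
  (forall v, measurable_fun `]a, b[ (fun t => f t v)) ->
  (forall v, measurable_fun `]a, b[ (fun t => g t v)) ->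
  intb a b (fun t => l2norm (f t) ^+ 2) -> intb a b (fun t => l2norm (g t) ^+ 2) ->
  intb a b (fun t => dotV (f t) (g t)) /\
  intb a b (fun t => l2norm (f t) * l2norm (g t)).
Proof.
move=> mf mg fi gi; 
have fgi : intb a b (fun t => l2norm (f t) ^+ 2 + l2norm (g t) ^+ 2) by exact: integrableD_fun.
have amgm (r s : R) : 0 <= r -> 0 <= s -> r * s <= r ^+ 2 + s ^+ 2.
  by move=> r0 s0; have := sqr_ge0 (r - s); have := sqr_ge0 (r + s); nra.
split; apply: intb_dominated fgi.
- exact: measurable_dotV.
- by move=> s _ _; rewrite (le_trans (normr_dotV_le _ _))// amgm ?l2norm_ge0.
- by apply: measurable_funM; exact: measurable_l2norm.
- by move=> s _ _; rewrite ger0_norm ?mulr_ge0 ?amgm ?l2norm_ge0.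
Qed.

Variables (phi : (V -> R) -> R) (T : R) (h x : R -> V -> R).
Hypothesis T_gt0 : 0 < T.
Hypothesis h_meas : forall v, measurable_fun `]0, T[ (fun t => h t v).
Hypothesis h_int : intb 0 T (fun t => l2norm (h t) ^+ 2).
Hypothesis x_cont : forall v, continuous (fun t => x t v).
Hypothesis x_sol : strong_solution phi 0 T h x.
Hypothesis x_res : exists L : R, {ae mu, forall t, 0 < t -> t < T ->
  l2norm (h t - derive_vec x t) <= L}.
Hypothesis phi_ac : acR 0 T (fun t => phi (x t)).

Lemma derive_vec_measurable v : measurable_fun `]0, T[ (fun t => derive_vec x t v).
Proof. by apply: measurable_funS (measurable_derive1 (@x_cont v)). Qed.

Lemma derive_vec_sqr_int : intb 0 T (fun t => l2norm (derive_vec x t) ^+ 2).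
Proof.
have [L HL] := x_res; pose g t := 2 * l2norm (h t) ^+ 2 + 2 * L ^+ 2.
apply: (@intb_dominated_ae _ 0 T _ g).
- by apply: measurable_funX; apply: measurable_l2norm; exact: derive_vec_measurable.
- by move=> s; rewrite addr_ge0// mulr_ge0// sqr_ge0.
- apply: aeS HL => s H s0 sT; have {}H := H s0 sT.
  rewrite ger0_norm ?sqr_ge0// /g.
  have := l2norm_triangle (h s) (derive_vec x s) 0; rewrite !subr0 l2normB => tr.
  have [a0 b0] := (l2norm_ge0 (derive_vec x s), l2norm_ge0 (h s)).
  have c0 := l2norm_ge0 (h s - derive_vec x s).
  apply: (@le_trans _ _ ((l2norm (h s) + L) ^+ 2)).
    by rewrite ler_pXn2r ?nnegrE//; lra.
  by have := sqr_ge0 (l2norm (h s) - L); rewrite !expr2; lra.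
- by apply: integrableD_fun => //; [exact: integrableZ_fun|exact: intb_cst].
Qed.

(** The constant weight [1], with [x'] as test vector. *)
Lemma energy_inequality t : 0 <= t -> t <= T ->
  phi (x t) + prim 0 (fun s => l2norm (derive_vec x s) ^+ 2) t <=
  phi (x 0) + prim 0 (fun s => dotV (h s) (derive_vec x s)) t.
Proof.
move=> t0 tT; have dm := derive_vec_measurable; have di := derive_vec_sqr_int.
have [hdi _] := intb_dot h_meas dm h_int di.
pose q := prim 0 (fun s => l2norm (derive_vec x s) ^+ 2 - dotV (h s) (derive_vec x s)).
have qi : intb 0 T (fun s => l2norm (derive_vec x s) ^+ 2 - dotV (h s) (derive_vec x s)).
  exact: integrableB_fun.
have := @weighted_energy _ _ phi 0 t h x (fun=> 1) (fun=> 0) q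
  (fun s => l2norm (derive_vec x s) ^+ 2 - dotV (h s) (derive_vec x s)) t0.
move=> /(_ _ _ _ _ _ _ _ _)/wrap[].
- exact: strong_solutionS x_sol.
- exact: acS phi_ac.
- by move=> s _; exact: ler01.
- exact: ac_cst.
- by apply: acS (prim_ac qi).
- by apply: aeW => s _ _; exact: is_derive_cst.
- by apply: aeS (prim_derive qi) => s H s0 st; apply: H => //; exact: lt_le_trans tT.
- by apply: aeW => s _ _ _; rewrite mul0r add0r mul1r dotVBl sqr_l2norm; lra.
rewrite !mul1r /q (@prim0 _ 0 0)// addr0 /prim RintegralB//; first lra.
- exact: intbS di.
- exact: intbS hdi.
Qed.

(** From [X^2 <= f^2 + H X]: the larger root of the quadratic is at most [H + f]. *)
Lemma le_of_sqr_le (X H f c d g : R) : 0 <= X -> 0 <= H -> 0 <= f -> 0 <= c ->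
  d <= g -> g <= H * X -> c + X ^+ 2 <= f ^+ 2 + d -> X <= H + f.
Proof.
move=> X0 H0 f0 c0 dg gHX E; rewrite leNgt; apply/negP => lt.
have Xp : 0 < X by lra.
have h1 : X * (H + f) < X * X by rewrite ltr_pM2l.
have h2 : f * f <= X * f by rewrite ler_wpM2r//; lra.
by move: E h1; rewrite !expr2 mulrDr; lra.
Qed.

Lemma derivative_bound t : 0 <= t -> t <= T -> 0 <= phi (x 0) -> 0 <= phi (x t) ->
  Num.sqrt (\int[mu]_(s in `]0, t[) (l2norm (derive_vec x s) ^+ 2)) <=
  Num.sqrt (\int[mu]_(s in `]0, t[) (l2norm (h s) ^+ 2)) + Num.sqrt (phi (x 0)).
Proof.
move=> t0 tT f0 ft; have := energy_inequality t0 tT; rewrite /prim.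
have dm := derive_vec_measurable; have di := derive_vec_sqr_int.
have [hdi hni] := intb_dot h_meas dm h_int di.
have di' : intb 0 t (fun s => l2norm (derive_vec x s) ^+ 2) by exact: intbS di.
have hi' : intb 0 t (fun s => l2norm (h s) ^+ 2) by exact: intbS h_int.
have hdi' : intb 0 t (fun s => dotV (h s) (derive_vec x s)) by exact: intbS hdi.
have hni' : intb 0 t (fun s => l2norm (h s) * l2norm (derive_vec x s)) by exact: intbS hni.
have := Rintegral_CS _ hi' di' hni' => /(_ (measurable_itv _)) cs.
have le : \int[mu]_(s in `]0, t[) dotV (h s) (derive_vec x s) <=
    \int[mu]_(s in `]0, t[) (l2norm (h s) * l2norm (derive_vec x s)).
  by apply: le_Rintegral => // s _; exact: dotV_le.
have I0 : 0 <= \int[mu]_(s in `]0, t[) (l2norm (derive_vec x s) ^+ 2).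
  by apply: Rintegral_ge0 => s _; exact: sqr_ge0.
set H := Num.sqrt _ in cs *; set X := Num.sqrt _ in cs *; set f := Num.sqrt _.
have [X0 H0 F0] : [/\ 0 <= X, 0 <= H & 0 <= f] by split; exact: sqrtr_ge0.
rewrite -[X in _ + X <= _](sqr_sqrtr I0) -[X in _ <= X + _](sqr_sqrtr f0) -/X -/f => E.
exact: (le_of_sqr_le X0 H0 F0 ft le cs E).
Qed.

Lemma solution_inW1 : inW1 2%:E T x (derive_vec x).
Proof.
have [/ac_vec acx aex] := x_sol.
split.
- by move=> v; apply: continuous_subspaceT; exact: x_cont.
- apply/inL2P; split.
    move=> v; have := continuous_measurable_fun (@x_cont v).
    by apply: measurable_funS.
  have [M HM] : exists M : R, forall s, 0 < s -> s < T -> l2norm (x s) ^+ 2 <= M.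
    have := ac_bounded (ac_dotV (x_sol.1) (x_sol.1)) => -[M M0 HM].
    exists M => s s0 sT; rewrite sqr_l2norm.
    by rewrite (le_trans (ler_norm _))// HM// ltW.
  apply: (@intb_bounded _ _ _ M).
    apply: measurable_funX; apply: measurable_l2norm => v.
    by have := continuous_measurable_fun (@x_cont v); apply: measurable_funS.
  by move=> s s0 sT; rewrite ger0_norm ?sqr_ge0// HM.
- by apply/inL2P; split; [exact: derive_vec_measurable|exact: derive_vec_sqr_int].
- move=> psi tp v.
  apply: (test_function_by_parts T_gt0 tp (acx v)).
    apply: (@intb_coord _ _ 0 T (derive_vec x) derive_vec_measurable).
    apply: intb_of_sqr derive_vec_sqr_int.
    by apply: measurable_l2norm; exact: derive_vec_measurable.
  by apply: aeS aex => t H t0 tT; apply: is_derive_vec; case: (H t0 tT).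
Qed.

End EnergyInequality.

Lemma strong_solution_unique (R : realType) (V : finType) (phi : (V -> R) -> R)
    (T : R) (h x y : R -> V -> R) : 
  strong_solution phi 0 T h x -> strong_solution phi 0 T h y -> x 0 = y 0 ->
  forall t, 0 <= t -> t <= T -> x t = y t.
Proof.
move=> solx soly xy0 t t0 tT.
have hh : (fun s => l2norm (h s - h s)) = fun=> 0.
  by apply/funext => s; rewrite subrr l2norm0.
have := @contraction _ _ phi 0 t h h x y t0.
move=> /(_ _ _ _)/wrap[].
- exact: strong_solutionS solx.
- exact: strong_solutionS soly.
- by rewrite hh; exact: intb_cst.
rewrite hh prim_cst// mul0r addr0 xy0 subrr l2norm0.
by move=> /l2norm_le0/eqP; rewrite subr_eq0 => /eqP.
Qed.

(** * Decay of the slope for weakly differentiable forcing *)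

Section RightQuotients.
Variables (R : realType) (V : finType).
Implicit Types (x h : R -> V -> R) (a b d s t : R).

Definition quotient x t d : V -> R := d^-1 *: (x (t + d) - x t).

Lemma quotient_derivable x t : derivable_vec x t ->
  forall v, quotient x t d v @[d --> (0:R)^'+] --> derive_vec x t v.
Proof.
move=> dx v; have /is_deriveP H := is_derive_vec dx v.
apply/cvgrPdist_le => e e0; have [d d0 Hd] := H e e0.
near=> tau; have tau0 : 0 < tau by near: tau; exact: nbhs_right_gt.
have taud : tau < d by near: tau; exact: nbhs_right_lt.
have := Hd (t + tau); rewrite (addrAC t) subrr add0r (gtr0_norm tau0) => /(_ taud).
have -> : x (t + tau) v - x t v - derive_vec x t v * tau =
    (quotient x t tau v - derive_vec x t v) * tau.
  rewrite mulrBl; congr (_ - _).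
  by rewrite /quotient !fctE /GRing.scale/= mulrAC mulVf ?gt_eqF// mul1r.
by rewrite normrM (gtr0_norm tau0) ler_pM2r// distrC.
Unshelve. all: by end_near. Qed.

Lemma right_derive_derivable x t : derivable_vec x t ->
  right_derivable x t /\ right_derive x t = derive_vec x t.
Proof.
move=> dx; have H := quotient_derivable dx.
split=> [v|]; first by apply/cvg_ex; exists (derive_vec x t v); exact: H.
by apply/funext => v; apply/cvg_lim => //; exact: H.
Qed.

Lemma quotient_right_derivable x t : right_derivable x t ->
  forall v, quotient x t d v @[d --> (0:R)^'+] --> right_derive x t v.
Proof. by move=> dx v; exact: dx. Qed.

Lemma ac_shift (W : zmodType) (n : W -> R) a b d (f : R -> W) :
  abs_continuous n (a + d) (b + d) f -> abs_continuous n a b (fun s => f (s + d)).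
Proof.
move=> acf e /acf[eta eta0 H]; exists eta => // k l r lr tri sm.
apply: (H k (fun i => l i + d) (fun i => r i + d)).
- by move=> i; rewrite !lerD2r.
- move=> i j _ _ [s [/=]]; rewrite !in_itv/= => /andP[i1 i2] /andP[j1 j2].
  by apply: tri => //; exists (s - d); split; rewrite /= in_itv/= ltrBrDr ltrBlDr; apply/andP.
- by under eq_bigr do rewrite opprD addrACA subrr addr0.
Qed.

Lemma strong_solution_shift (phi : (V -> R) -> R) a b d h x :
  strong_solution phi (a + d) (b + d) h x ->
  strong_solution phi a b (fun s => h (s + d)) (fun s => x (s + d)).
Proof.
move=> [acx aex]; split; first exact: ac_shift acx.
apply: aeS (ae_shift d aex) => t H at_ tb.
have [dx sx] : derivable_vec x (t + d) /\
    subdifferential phi (x (t + d)) (h (t + d) - derive_vec x (t + d)).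
  by apply: H; rewrite ltrD2r.
have [dy ->] := derive_vecE (fun v => is_derive_shift (is_derive_vec dx v)).
by [].
Qed.

End RightQuotients.

Section SlopeDecay.
Variables (R : realType) (V : finType).
Notation mu := (@lebesgue_measure R).
Variables (phi : (V -> R) -> R) (T : R) (h dh x : R -> V -> R) (c : V -> R).
Hypothesis T_gt0 : 0 < T.
Hypothesis h_sqr_int : intb 0 T (fun t => l2norm (h t) ^+ 2).
Hypothesis hW : inW1 1%:E T h dh.
Hypothesis x_cont : forall v, continuous (fun t => x t v).
Hypothesis x_sol : strong_solution phi 0 T h x.
Hypothesis x_res : exists L : R, {ae mu, forall t, 0 < t -> t < T ->
  l2norm (h t - derive_vec x t) <= L}.
Hypothesis phi_ac : acR 0 T (fun t => phi (x t)).
Hypothesis phi_ge0 : forall y, 0 <= phi y.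
Hypothesis phi_c : phi c = 0.
Implicit Types s t r d : R.

Let dh_int : intb 0 T (fun s => l2norm (dh s)) := inW1_norm_int hW.
Let M := prim 0 (fun s => l2norm (dh s)).
Let N := prim 0 M.
Let A := l2norm (x 0 - c).

Let h_coord_int v : intb 0 T (fun s => h s v).
Proof. by case: hW => ch _ _ _; exact: intb_within. Qed.

Let h_norm_int : intb 0 T (fun s => l2norm (h s)).
Proof. exact: intb_l2norm. Qed.

Let M_ac : acR 0 T M := prim_ac dh_int.

Let M_int : intb 0 T M.
Proof. by apply: intb_within; exact: ac_within M_ac. Qed.

Let M_le s t : 0 <= s -> s <= t -> t <= T -> M s <= M t.
Proof.
move=> s0 st tT; rewrite /M (prim_split s0 st) ?lerDl; last exact: intbS dh_int.
by apply: Rintegral_ge0 => r _; exact: l2norm_ge0.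
Qed.

(** The mean of a nondecreasing function lies between its extreme values. *)
Let N_increment s d : 0 <= s -> 0 <= d -> s + d <= T ->
  d * M s <= N (s + d) - N s /\ N (s + d) - N s <= d * M (s + d).
Proof.
move=> s0 d0 sdT; have sd : s <= s + d by rewrite lerDl.
have iM : intb s (s + d) M by exact: intbS M_int.
have -> : N (s + d) - N s = prim s M (s + d).
  rewrite /N (prim_split s0 sd); last exact: intbS M_int.
  by rewrite addrAC subrr add0r.
have E k : d * k = prim s (fun=> k) (s + d).
  by rewrite prim_cst// (addrAC s) subrr add0r mulrC.
split; rewrite E; apply: le_Rintegral => //; try exact: intb_cst.
- by move=> r /=; rewrite in_itv/= => /andP[sr rd]; apply: M_le => //; lra.
- by move=> r /=; rewrite in_itv/= => /andP[sr rd]; apply: M_le => //; lra.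
Qed.

(** Two solutions that are translates of each other separate at most by the
    accumulated variation of the forcing between the two times. *)
Let shifted_distance s t d : 0 < s -> s <= t -> 0 < d -> t + d < T ->
  l2norm (x (t + d) - x t) <= l2norm (x (s + d) - x s) + d * (M (t + d) - M s).
Proof.
move=> s0 st d0 tdT; have tT : t < T by lra.
have sol1 : strong_solution phi s t (fun r => h (r + d)) (fun r => x (r + d)).
  by apply: strong_solution_shift; apply: strong_solutionS x_sol; lra.
have sol2 : strong_solution phi s t h x by apply: strong_solutionS x_sol; lra.
have hi v : intb s t (fun r => h (r + d) v - h r v).
  apply: intb_within; apply: ac_within; have /ac_vec ach := inW1_ac T_gt0 hW.
  apply: acB; last by apply: acS (ach v); lra.
  by apply: (@ac_shift _ _ _ s t d (fun r => h r v)); apply: acS (ach v); lra.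
have gi := intb_l2norm hi.
have := contraction st sol1 sol2 gi => /le_trans; apply; rewrite lerD2l.
set g := fun r => _ in gi *.
have acN r1 r2 : 0 <= r1 -> r2 <= T -> acR r1 r2 N.
  by move=> r10 r2T; apply: acS (prim_ac M_int).
have := @ac_nonincreasing _ s t (fun r => prim s g r - (N (r + d) - N r)) st.
move=> /(_ _ _)/wrap[].
- apply: acB; first exact: prim_ac.
  apply: acB; last by apply: acN; lra.
  by apply: (@ac_shift _ _ _ s t d N); apply: acN; lra.
- have aeN := prim_derive M_int.
  apply: aeS (aeI (prim_derive gi) (aeI aeN (ae_shift d aeN))) => r [Hg [HN HNd]] sr rt.
  exists (g r - (M (r + d) - M r)).
    have [r0 rT rdT] : [/\ 0 < r, r < T & r + d < T] by split; lra.
    have h1 := Hg sr rt; have h2 := HN r0 rT.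
    have h3 : is_derive r 1 (fun q => N (q + d)) (M (r + d)).
      by apply: is_derive_shift; apply: HNd => //; lra.
    by apply: is_deriveB; exact: is_deriveB.
  rewrite subr_le0; have rd : r <= r + d by rewrite lerDl ltW.
  have := @inW1_increment _ _ _ T_gt0 _ _ hW r (r + d) _ rd _.
  move=> /(_ _ _)/wrap[]; [lra|lra|].
  rewrite /M (@prim_split _ 0 r (r + d) _ _ rd); [|lra|by apply: intbS dh_int; lra].
  by rewrite addrAC subrr add0r.
have sT : s + d <= T by lra.
have [N1 _] := N_increment (ltW s0) (ltW d0) sT.
have [_ N2] := N_increment (le_trans (ltW s0) st) (ltW d0) (ltW tdT).
rewrite (@prim0 _ s s)// mulrBr; lra.
Qed.

(** Divide the previous estimate by [d] and let [d] tend to [0]. *)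
Lemma slope_le s t : 0 < s -> s < t -> t < T -> derivable_vec x s ->
  right_derivable x t -> l2norm (right_derive x t) <= l2norm (derive_vec x s) + (M t - M s).
Proof.
move=> s0 st tT dxs dxt; have t0 : 0 < t := lt_trans s0 st.
apply/ler_addgt0Pr => e e0; have e3 : 0 < e / 3 by rewrite divr_gt0.
have [d1 d10 H1] := ac_continuous_at M_ac t0 tT e3.
have near1 : \forall d \near (0:R)^'+, l2norm (quotient x t d - right_derive x t) <= e / 3.
  exact: cvg_l2norm (quotient_right_derivable dxt) _ e3.
have near2 : \forall d \near (0:R)^'+, l2norm (quotient x s d - derive_vec x s) <= e / 3.
  exact: cvg_l2norm (quotient_derivable dxs) _ e3.
have near0 : \forall d \near (0:R)^'+, [/\ 0 < d, d < T - t & d < d1].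
  near=> d; split; near: d; first exact: nbhs_right_gt.
  - by apply: nbhs_right_lt; rewrite subr_gt0.
  - exact: nbhs_right_lt.
near (0:R)^'+ => d.
have [d0 ddT dd1] : [/\ 0 < d, d < T - t & d < d1] by near: d.
have Q1 : l2norm (quotient x t d - right_derive x t) <= e / 3 by near: d.
have Q2 : l2norm (quotient x s d - derive_vec x s) <= e / 3 by near: d.
have tdT : t + d < T by lra.
have le := shifted_distance s0 (ltW st) d0 tdT.
have {}le : l2norm (quotient x t d) <= l2norm (quotient x s d) + (M (t + d) - M s).
  rewrite /quotient !l2normZ gtr0_norm ?invr_gt0// ler_pdivrMl// mulrDr.
  by rewrite mulrA mulfV ?gt_eqF// mul1r.
have := H1 (t + d); rewrite (addrAC t) subrr add0r (gtr0_norm d0) => /(_ dd1).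
move=> /ler_normlP[_ HM].
have := l2norm_triangle (quotient x t d) (right_derive x t) 0.
have := l2norm_triangle (derive_vec x s) (quotient x s d) 0.
rewrite !subr0 (l2normB (right_derive x t)); lra.
Unshelve. all: by end_near. Qed.

Let sol_c a b : strong_solution phi a b (fun=> 0) (fun=> c).
Proof.
by apply: strong_solution_cst => y; rewrite phi_c dotV0l addr0; exact: phi_ge0.
Qed.

(** [c] is a stationary solution for the forcing [0]. *)
Lemma distance_to_minimizer s t : 0 <= s -> s <= t -> t <= T ->
  l2norm (x s - c) <= A + prim 0 (fun r => l2norm (h r)) t.
Proof.
move=> s0 st tT; have sT := le_trans st tT.
have hE : (fun r => l2norm (h r - 0)) = (fun r => l2norm (h r)).
  by apply/funext => r; rewrite subr0.
have hi r : r <= T -> intb 0 r (fun q => l2norm (h q)).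
  by move=> rT; exact: intbS h_norm_int.
have := contraction s0 (strong_solutionS (lexx 0) sT x_sol) (sol_c 0 s).
rewrite hE => /(_ (hi s sT)) /le_trans; apply; rewrite lerD2l.
rewrite (prim_split s0 st (hi t tT)) lerDl.
by apply: Rintegral_ge0 => r _; exact: l2norm_ge0.
Qed.

Let h_meas v : measurable_fun `]0, T[ (fun t => h t v).
Proof. exact: intb_measurable. Qed.

Let dx_meas v : measurable_fun `]0, T[ (fun t => derive_vec x t v).
Proof. exact: derive_vec_measurable. Qed.

Let dx_sqr_int : intb 0 T (fun t => l2norm (derive_vec x t) ^+ 2).
Proof. by apply: derive_vec_sqr_int; eauto. Qed.

Let x_meas v : measurable_fun `]0, T[ (fun t => x t v - c v).
Proof.
have /continuous_measurable_fun : continuous (fun t => x t v - c v).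
  by move=> t; apply: cvgB; [exact: x_cont|exact: cvg_cst].
exact: measurable_funS.
Qed.

Lemma weighted_dissipation_int : intb 0 T (fun s => s * l2norm (derive_vec x s) ^+ 2).
Proof.
apply: (@intb_dominated _ _ _ _ (fun s => T * l2norm (derive_vec x s) ^+ 2)).
- apply: measurable_funM => //; apply: measurable_funX.
  exact: measurable_l2norm.
- move=> s s0 sT; have n0 := sqr_ge0 (l2norm (derive_vec x s)).
  rewrite ger0_norm; last by apply: mulr_ge0 => //; exact: ltW.
  by rewrite ler_wpM2r// ltW.
- exact: integrableZ_fun.
Qed.

Lemma weighted_variation_int k : intb 0 T (fun s => s ^+ k * l2norm (dh s)).
Proof.
apply: (@intb_dominated _ _ _ _ (fun s => T ^+ k * l2norm (dh s))).
- apply: measurable_funM; last exact: intb_measurable.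
  exact: measurable_funX.
- move=> s s0 sT; rewrite ger0_norm; last first.
    by apply: mulr_ge0; [apply/exprn_ge0/ltW|exact: l2norm_ge0].
  by rewrite ler_wpM2r ?l2norm_ge0// lerXn2r ?nnegrE ?(ltW s0) ?(ltW sT)// ltW.
- exact: integrableZ_fun.
Qed.


Let id_ac a b : acR a b (fun s => s) := @ac_id R a b.

(** Testing the equation at time [s] with [s * x' s + (x s - c)] produces the
    weighted dissipation; the term [s * h s] is integrated by parts in time. *)
Lemma weighted_dissipation_le t : 0 < t -> t < T ->
  prim 0 (fun s => s * l2norm (derive_vec x s) ^+ 2) t <=
  A ^+ 2 / 2 + (t * l2norm (h t)) ^+ 2 / 2 +
  prim 0 (fun s => s * l2norm (dh s)) t * (A + prim 0 (fun s => l2norm (h s)) t).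
Proof.
move=> t0 tT; have tT' := ltW tT; set B := A + _.
pose w s := s * l2norm (derive_vec x s) ^+ 2.
pose m s := s * l2norm (dh s).
have wi : intb 0 t w by exact: intbS weighted_dissipation_int.
have mi : intb 0 t m by exact: intbS (weighted_variation_int 1).
have Bmi : intb 0 t (fun s => B * m s) by exact: integrableZ_fun.
have m0 s : 0 <= s -> 0 <= m s by move=> s0; rewrite mulr_ge0 ?l2norm_ge0.
have xB s : 0 < s -> s < t -> l2norm (x s - c) <= B.
  by move=> s0 st; apply: distance_to_minimizer => //; exact: ltW.
have sub : `]0, t[%classic `<=` `]0, T[%classic.
  by apply: subset_itv; rewrite bnd_simp.
have mxi : intb 0 t (fun s => m s * l2norm (x s - c)).
  apply: intb_dominated Bmi.
    apply: measurable_funM; first exact: intb_measurable.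
    by apply: measurable_l2norm => v; apply: measurable_funS (x_meas v).
  move=> s s0 st; rewrite ger0_norm; last by apply: mulr_ge0; [exact/m0/ltW|exact: l2norm_ge0].
  by rewrite mulrC ler_wpM2r ?xB// m0// ltW.
have mx_le : prim 0 (fun s => m s * l2norm (x s - c)) t <= prim 0 m t * B.
  rewrite mulrC /prim -RintegralZl//; apply: le_Rintegral => // s /=.
  rewrite in_itv/= => /andP[s0 st].
  by rewrite mulrC ler_wpM2r ?xB// m0// ltW.
pose y s := x s - c.
have [/ac_vec acx aex] := strong_solutionS (lexx 0) tT' x_sol.
have acy : abs_continuous (@l2norm R V) 0 t y.
  by apply/ac_vec => v; apply: acB; [exact: acx|exact: ac_cst].
have ach : abs_continuous (@l2norm R V) 0 t h by exact: acS (inW1_ac T_gt0 hW).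
pose q s := dotV (y s) (y s) / 2 - s * dotV (h s) (y s) +
  (prim 0 w s - prim 0 (fun r => m r * l2norm (x r - c)) s).
pose q' s := dotV (derive_vec x s) (y s) - (dotV (h s) (y s) +
  s * (dotV (dh s) (y s) + dotV (h s) (derive_vec x s))) + (w s - m s * l2norm (y s)).
have := @weighted_energy _ _ phi 0 t h x (fun s => s) (fun=> 1) q q' (ltW t0).
move=> /(_ _ _ _ _ _ _ _ _)/wrap[].
- exact: strong_solutionS x_sol.
- exact: acS phi_ac.
- by [].
- exact: id_ac.
- apply: acD; last by apply: acB; exact: prim_ac.
  apply: acB; first by apply: acM; [exact: ac_dotV|exact: ac_cst].
  by apply: acM; [exact: id_ac|exact: ac_dotV].
- by apply: aeW => s _ _; exact: is_derive_id.
- apply: aeS (aeI (aeI aex (inW1_derive T_gt0 hW)) (aeI (prim_derive wi) (prim_derive mxi))).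
  move=> s [[Hx Hh] [Hw Hm]] s0 st; have sT := lt_trans st tT.
  have dx := is_derive_vec (Hx s0 st).1.
  have dy v : is_derive s 1 (fun r => y r v) (derive_vec x s v).
    have := dx v => ?; rewrite -[derive_vec x s v]subr0.
    by apply: is_deriveB; exact: is_derive_cst.
  have dhs v := Hh v s0 sT.
  have h1 := is_deriveM_fun (is_derive_dotV dy dy) (is_derive_cst (2^-1 : R) s 1).
  have h2 := is_deriveM_fun (is_derive_id s 1) (is_derive_dotV dhs dy).
  have h3 := is_deriveB (Hw s0 st) (Hm s0 st).
  apply: (is_derive_eq (is_deriveD (is_deriveB h1 h2) h3)).
  by rewrite /q' (dotVC (y s) (derive_vec x s)) /y /=; field.
- apply: aeW => s s0 st sub_s.
  have := sub_s c; rewrite phi_c => le.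
  have hle : - dotV (dh s) (y s) <= l2norm (dh s) * l2norm (y s).
    by rewrite (le_trans (ler_norm _))// normrN normr_dotV_le.
  have {}hle := ler_wpM2l (ltW s0) hle.
  have e1 : c - x s = - y s by rewrite opprB.
  move: le; rewrite e1 dotVNr dotVBl => le.
  rewrite /q' /w /m dotVBl -sqr_l2norm; lra.
have p0 f : prim 0 f 0 = 0 by exact: prim0.
rewrite /q !p0 subrr addr0 !mul0r add0r subr0 -!sqr_l2norm -/A.
have hy : t * dotV (h t) (y t) <= (t * l2norm (h t)) ^+ 2 / 2 + l2norm (y t) ^+ 2 / 2.
  have h1 := ler_wpM2l (ltW t0) (dotV_le (h t) (y t)).
  by have := sqr_ge0 (t * l2norm (h t) - l2norm (y t)); rewrite !expr2; lra.
have fx := mulr_ge0 (ltW t0) (phi_ge0 (x t)).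
rewrite -/w -/m; move: mx_le => /=; rewrite -/A; lra.
Qed.


(** Averaging the slope estimate over [s] with weight [s]; [l] balances the
    two terms of Young's inequality. *)
Lemma weighted_slope_le t l : 0 < t -> t < T -> 0 < l -> right_derivable x t ->
  t ^+ 2 / 2 * l2norm (right_derive x t) <=
  l / 2 * prim 0 (fun s => s * l2norm (derive_vec x s) ^+ 2) t + t ^+ 2 / (4 * l) +
  prim 0 (fun s => s ^+ 2 * l2norm (dh s)) t / 2.
Proof.
move=> t0 tT l0 dxt; have tT' := ltW tT; set k := l2norm (right_derive x t).
pose w s := s * l2norm (derive_vec x s) ^+ 2.
pose m s := s ^+ 2 * l2norm (dh s).
have wi : intb 0 t w by exact: intbS weighted_dissipation_int.
have mi : intb 0 t m by exact: intbS (weighted_variation_int 2).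
have iM : intb 0 t (fun s => l2norm (dh s)) by exact: intbS dh_int.
pose F s := s * s / 2 * (M s + (k - M t)) -
  (l / 2 * prim 0 w s + s * s / (4 * l) + prim 0 m s / 2).
pose F' s := s * (M s + (k - M t)) + s * s / 2 * l2norm (dh s) -
  (l / 2 * w s + s / (2 * l) + m s / 2).
have acs2 : acR 0 t (fun s => s * s) by apply: acM; exact: id_ac.
have acc (z : R) : acR 0 t (fun=> z) by exact: ac_cst.
have := @ac_nonincreasing _ 0 t F (ltW t0).
move=> /(_ _ _)/wrap[].
- apply: acB; first apply: acM.
  + exact: acM.
  + by apply: acD => //; exact: acS M_ac.
  + apply: acD; first apply: acD.
    * by apply: acM => //; exact: prim_ac.
    * exact: acM.
    * by apply: acM => //; exact: prim_ac.
- have [_ aex] := x_sol.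
  apply: aeS (aeI (aeI aex (prim_derive iM)) (aeI (prim_derive wi) (prim_derive mi))).
  move=> s [[Hx HM] [Hw Hm]] s0 st; have sT := lt_trans st tT.
  have {}HM := HM s0 st; have {}Hw := Hw s0 st; have {}Hm := Hm s0 st.
  exists (F' s).
    have c1 (z : R) := is_derive_cst z s 1.
    have h0 := is_deriveM_fun (is_derive_id s 1) (is_derive_id s 1).
    have hM : is_derive s 1 (fun r => M r + (k - M t)) (l2norm (dh s)).
      by rewrite -[l2norm _]addr0; exact: is_deriveD HM (c1 _).
    have h1 := is_deriveM_fun (is_deriveM_fun h0 (c1 2^-1)) hM.
    have h2 := is_deriveM_fun (c1 (l / 2)) Hw.
    have h3 := is_deriveM_fun h0 (c1 (4 * l)^-1).
    have h4 := is_deriveM_fun Hm (c1 2^-1).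
    apply: (is_derive_eq (is_deriveB h1 (is_deriveD (is_deriveD h2 h3) h4))).
    by rewrite /F' /=; field; rewrite gt_eqF.
  have sl := slope_le s0 st tT (Hx s0 sT).1 dxt.
  have := ler_wpM2l (ltW s0) sl; rewrite -/k => {}sl.
  have young : l2norm (derive_vec x s) <= l / 2 * l2norm (derive_vec x s) ^+ 2 + (2 * l)^-1.
    set z := l2norm _; rewrite -subr_ge0.
    have -> : l / 2 * z ^+ 2 + (2 * l)^-1 - z = (l * z - 1) ^+ 2 / (2 * l).
      by field; rewrite gt_eqF.
    by rewrite divr_ge0 ?sqr_ge0// mulr_ge0// ltW.
  have := ler_wpM2l (ltW s0) young.
  rewrite /F' /w /m expr2; lra.
have p0 f : prim 0 f 0 = 0 by exact: prim0.
rewrite /F !p0 -/k -/w -/m !expr2; lra.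
Qed.

(** By [weighted_dissipation_le], [2 I <= D^2] with [D = t |h t| + A + sqrt (2 J1 B)];
    the weight [l = t / D] in [weighted_slope_le] then gives
    [t k <= D + J2 / t]. *)
Lemma slope_decay t : 0 < t -> t < T -> right_derivable x t ->
  l2norm (right_derive x t) <=
    l2norm (h t) + t^-1 * A +
    (t ^+ 2)^-1 * prim 0 (fun s => s ^+ 2 * l2norm (dh s)) t +
    Num.sqrt 2 / t * Num.sqrt (prim 0 (fun s => s * l2norm (dh s)) t) *
      Num.sqrt (A + prim 0 (fun s => l2norm (h s)) t).
Proof.
move=> t0 tT dxt; have ws l l0 := @weighted_slope_le t l t0 tT l0 dxt.
have wd := weighted_dissipation_le t0 tT.
move: ws wd.
set k := l2norm (right_derive x t); set I := prim 0 _ t; set J2 := prim 0 _ t.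
set J1 := prim 0 _ t; set B := A + _ => ws wd.
have A0 : 0 <= A by exact: l2norm_ge0.
have B0 : 0 <= B.
  by rewrite addr_ge0//; apply: Rintegral_ge0 => s _; exact: l2norm_ge0.
have J0 : 0 <= J1.
  apply: Rintegral_ge0 => s /=; rewrite in_itv/= => /andP[s0 _].
  by rewrite mulr_ge0 ?l2norm_ge0 ?(ltW s0).
set r2 := Num.sqrt 2; set rJ := Num.sqrt J1; set rB := Num.sqrt B.
have H0 := l2norm_ge0 (h t).
pose D := t * l2norm (h t) + A + r2 * rJ * rB.
have q0 : 0 <= r2 * rJ * rB by rewrite !mulr_ge0 ?sqrtr_ge0.
have th0 : 0 <= t * l2norm (h t) by apply: mulr_ge0 => //; exact: ltW.
have D0 : 0 <= D by rewrite /D; lra.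
have ID : 2 * I <= D ^+ 2.
  have E : (r2 * rJ * rB) ^+ 2 = 2 * (J1 * B).
    by rewrite !exprMn !sqr_sqrtr// mulrA.
  have h1 := mulr_ge0 th0 A0; have h2 := mulr_ge0 th0 q0; have h3 := mulr_ge0 A0 q0.
  move: wd E; rewrite /D !expr2; lra.
have kD : t * k <= D + J2 / t.
  (* [D] may vanish, so a positive [D'] close to it is used in the weight *)
  apply/ler_addgt0Pr => e e0; pose D' := D + e; have D'0 : 0 < D' by rewrite /D'; lra.
  have := ws (t / D') (divr_gt0 t0 D'0).
  have le : t / D' / 2 * I <= t * D' / 4.
    have -> : t * D' / 4 = t / D' / 2 * (D' ^+ 2 / 2) by field; rewrite gt_eqF.
    rewrite ler_wpM2l ?divr_ge0 ?(ltW t0) ?(ltW D'0)//.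
    have : D ^+ 2 <= D' ^+ 2 by rewrite lerXn2r ?nnegrE ?(ltW D'0)// /D'; lra.
    lra.
  have -> : t ^+ 2 / (4 * (t / D')) = t * D' / 4 by field; rewrite !gt_eqF.
  rewrite expr2 => wsD.
  have t2 : 0 < t / 2 by rewrite divr_gt0.
  rewrite -(ler_pM2l t2).
  have -> : t / 2 * (D + J2 / t + e) = t * D' / 2 + J2 / 2.
    by rewrite /D'; field; rewrite gt_eqF.
  lra.
have -> : l2norm (h t) + t^-1 * A + (t ^+ 2)^-1 * J2 + r2 / t * rJ * rB =
    t^-1 * (D + J2 / t) by rewrite /D; field; rewrite gt_eqF.
by rewrite ler_pdivlMl.
Qed.

(** The estimate of [slope_decay], multiplied by [t], with every integral bounded
    by its value at [T]; for the double weight, [s^2 <= t * T]. *)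
Lemma scaled_derivative_bounded : (forall t, 0 < t -> t < T -> right_derivable x t) ->
  inL +oo%E T (fun t => t *: derive_vec x t).
Proof.
move=> dxr; have [Hb Hb0 HHb] : exists2 b : R, 0 <= b &
    forall t, 0 <= t -> t <= T -> l2norm (h t) <= b.
  have ach := inW1_ac T_gt0 hW; have [b b0 Hb] := ac_bounded (ac_dotV ach ach).
  exists (Num.sqrt b) => [|t t0 tT]; first exact: sqrtr_ge0.
  by rewrite /l2norm ler_wsqrtr// (le_trans (ler_norm _))// Hb.
have T0 := ltW T_gt0.
have MT0 : 0 <= M T by apply: Rintegral_ge0 => s _; exact: l2norm_ge0.
have TM0 := mulr_ge0 T0 MT0.
have A0 : 0 <= A by exact: l2norm_ge0.
pose K := T * Hb + A + T * M T + Num.sqrt 2 * Num.sqrt (T * M T) *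
  Num.sqrt (A + prim 0 (fun s => l2norm (h s)) T).
have K0 : 0 <= K.
  have r0 : 0 <= Num.sqrt 2 * Num.sqrt (T * M T) *
      Num.sqrt (A + prim 0 (fun s => l2norm (h s)) T) :> R.
    by rewrite !mulr_ge0 ?sqrtr_ge0.
  by have := mulr_ge0 T0 Hb0; rewrite /K; lra.
apply: (inLy _ K0) => [v|].
  by apply: measurable_funM => //; exact: dx_meas.
have [_ aex] := x_sol; apply: aeS aex => t Hx t0 tT; have tT' := ltW tT.
have [dx _] := Hx t0 tT; have [_ <-] := right_derive_derivable dx.
have i1 k : intb 0 t (fun s => k * l2norm (dh s)).
  by apply: integrableZ_fun => //; exact: intbS dh_int.
have Mk k : 0 <= k -> prim 0 (fun s => k * l2norm (dh s)) t <= k * M T.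
  move=> k0; rewrite /prim RintegralZl//; last exact: intbS dh_int.
  by rewrite ler_wpM2l// M_le ?(ltW t0).
have J2 : prim 0 (fun s => s ^+ 2 * l2norm (dh s)) t <= t * (T * M T).
  rewrite mulrA; apply: le_trans (Mk _ (mulr_ge0 (ltW t0) T0)).
  apply: le_Rintegral => //; first exact: intbS (weighted_variation_int 2).
  move=> s /=; rewrite in_itv/= => /andP[s0 st].
  rewrite ler_wpM2r ?l2norm_ge0// expr2; apply: ler_pM; lra.
have J1 : prim 0 (fun s => s * l2norm (dh s)) t <= T * M T.
  apply: le_trans (Mk _ T0).
  apply: le_Rintegral => //; first exact: intbS (weighted_variation_int 1).
  move=> s /=; rewrite in_itv/= => /andP[s0 st].
  by rewrite ler_wpM2r ?l2norm_ge0//; lra.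
have B1 : A + prim 0 (fun s => l2norm (h s)) t <= A + prim 0 (fun s => l2norm (h s)) T.
  rewrite lerD2l (prim_split (ltW t0) tT' h_norm_int) lerDl.
  by apply: Rintegral_ge0 => s _; exact: l2norm_ge0.
have := slope_decay t0 tT (dxr t t0 tT).
set j2 := prim 0 _ t in J2 *; set j1 := prim 0 _ t in J1 *; set b := A + _ in B1 *.
rewrite -(ler_pM2l t0) l2normZ gtr0_norm// => /le_trans; apply.
rewrite !mulrDr mulrA mulfV ?gt_eqF// mul1r.
have -> : t * ((t ^+ 2)^-1 * j2) = t^-1 * j2 by field; rewrite gt_eqF.
have -> : t * (Num.sqrt 2 / t * Num.sqrt j1 * Num.sqrt b) =
    Num.sqrt 2 * Num.sqrt j1 * Num.sqrt b by field; rewrite gt_eqF.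
have h1 : t * l2norm (h t) <= T * Hb by apply: ler_pM; rewrite ?l2norm_ge0 ?HHb ?(ltW t0).
have h2 : t^-1 * j2 <= T * M T by rewrite ler_pdivrMl.
rewrite /K; apply: lerD; first by apply: lerD => //; apply: lerD.
by apply: ler_pM; rewrite ?mulr_ge0 ?sqrtr_ge0// ?ler_wpM2l ?sqrtr_ge0 ?ler_wsqrtr.
Qed.

End SlopeDecay.

(** * The Cauchy problem *)

(** Membership of [h t] in [x' t + L (x t)] says that [h t - x' t] is a subgradient. *)
Lemma cauchy_solutionP (R : realType) (V : finType) (G : hypergraph R V) (p T : R)
    (h : R -> V -> R) (x0 : V -> R) (x : R -> V -> R) :
  cauchy_solution G p T h x0 x <->
  strong_solution (energy G p) 0 T h x /\ x 0 = x0.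
Proof.
split=> [[acx x00 aex]|[[acx aex] x00]]; split=> //; first split=> //.
  apply: aeS aex => t H t0 tT.
  have /H[dx [z zx <-]] : t \in `]0, T[ by rewrite in_itv/= t0.
  by split=> //; rewrite addrAC subrr add0r.
apply: aeS aex => t H; rewrite in_itv/= => /andP[t0 tT]; have [dx zx] := H t0 tT.
by split=> //; exists (h t - derive_vec x t) => //; rewrite addrC subrK.
Qed.

Theorem theorem3p1 (R : realType) (V : finType) (G : hypergraph R V) (p T : R)
    (hp : 1 <= p) (hT : 0 < T) (x0 : V -> R) (h : R -> V -> R)
    (hh : inL 2%:E T h) :
  exists x : R -> V -> R,
    cauchy_solution G p T h x0 x /\
    (forall y : R -> V -> R, cauchy_solution G p T h x0 y ->
       forall t : R, 0 <= t <= T -> y t = x t) /\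
    inW1 2%:E T x (derive_vec x) /\
    abs_continuous (fun r : R => `|r|) 0 T (fun t : R => energy G p (x t)) /\
    (forall t : R, 0 <= t <= T ->
       Num.sqrt (\int[@lebesgue_measure R]_(s in `]0, t[) (l2norm (derive_vec x s) ^+ 2))
       <= Num.sqrt (\int[@lebesgue_measure R]_(s in `]0, t[) (l2norm (h s) ^+ 2))
          + Num.sqrt (energy G p x0)) /\
    (forall t0 : R, 0 <= t0 < T -> right_lebesgue_point h t0 ->
       right_derivable x t0 /\
       min_norm_elt [set right_value h t0 - z | z in laplacian G p (x t0)]
         (right_derive x t0)) /\
    (forall dh : R -> V -> R, inW1 1%:E T h dh ->
       inL +oo%E T (fun t : R => t *: derive_vec x t) /\
       (forall t : R, 0 < t < T ->
          right_derivable x t /\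
          l2norm (right_derive x t) <=
            l2norm (h t)
            + t^-1 * l2norm (x0 - comp_mean G x0)
            + (t ^+ 2)^-1 *
              \int[@lebesgue_measure R]_(s in `]0, t[) (s ^+ 2 * l2norm (dh s))
            + Num.sqrt 2 / t
              * Num.sqrt (\int[@lebesgue_measure R]_(s in `]0, t[) (s * l2norm (dh s)))
              * Num.sqrt (l2norm (x0 - comp_mean G x0)
                  + \int[@lebesgue_measure R]_(s in `]0, t[) l2norm (h s)))).
Proof.
have [mh h2i] := (inL2P T h).1 hh.
have hni : intb 0 T (fun s => l2norm (h s)).
  by apply: intb_of_sqr h2i; exact: measurable_l2norm.
have hi v : intb 0 T (fun s => h s v) by exact: intb_coord.
have [x [x00 cx solx resx acE]] := energy_existence G x0 hp hT hi.
have E0 y := energy_ge0 G hp y.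
have rder t : 0 <= t -> t < T -> right_lebesgue_point h t ->
    right_derivable x t /\
    min_norm_elt [set right_value h t - z | z in laplacian G p (x t)] (right_derive x t).
  move=> t0 tT leb; have [L HL] := resx.
  by apply: (right_derivative hi solx HL acE t0 tT leb); exact: energy_subgradient.
exists x; split; first by apply/cauchy_solutionP.
split.
  move=> y /cauchy_solutionP[soly y0] t /andP[t0 tT].
  by apply: (strong_solution_unique soly solx) => //; rewrite y0.
split; first exact: (solution_inW1 hT h2i cx solx resx).
split; first exact: acE.
split.
  move=> t /andP[t0 tT]; rewrite -x00.
  exact: (derivative_bound mh h2i cx solx resx acE t0 tT).
split; first by move=> t /andP[t0 tT]; exact: rder.
move=> dh hW; have [ch _ _ _] := hW.
have dxr t : 0 < t -> t < T -> right_derivable x t.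
  move=> t0 tT; have [leb _] := continuous_right_lebesgue_point ch (ltW t0) tT.
  by have [] := rder t (ltW t0) tT leb.
have Ec := energy_comp_mean G hp x0.
split.
  exact: (scaled_derivative_bounded hT h2i hW cx solx resx acE E0 Ec).
move=> t /andP[t0 tT]; split; first exact: dxr.
have := slope_decay hT h2i hW cx solx resx acE E0 Ec t0 tT (dxr t t0 tT).
by rewrite x00.
Qed.
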